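(* Let $N$ and $R$ be free $A$-supermodules with $\operatorname{rank}(N\oplus R)>2$ and $A$-quadratic forms $q_N$ and $q_R$ respectively such that $q_R\equiv0$ and $q_N$ is an orthogonal sum of an almost diagonalizable $A$-quadratic form and an invertibly diagonalizable $A$-quadratic form on a free $A$-supermodule of rank 2. Let $M=N\oplus R$ with $q=q_N\oplus q_R$ and let $\mathcal E$ be a subalgebra of $\operatorname{osp}(q)$ containing $\operatorname{eosp}(q)$. With the notation of the context, the map $\operatorname{Der}_KA\to(\operatorname{Der}_KA)_M$, $\Delta\mapsto\Delta_M$, is a Lie superalgebra isomorphism, and $$\operatorname{Der}_K\mathcal E_\infty=\operatorname{ad}\mathcal E_\infty+\{d_{S,0}\in\mathcal D_{\mathcal E}: S\in\operatorname{osp}(q)\oplus(\operatorname{Der}_KA)_M,\ [S,\mathcal E]\subset\mathcal E\}$$ with $$\operatorname{ad}\mathcal E_\infty\cap\{d_{S,0}\in\mathcal D_{\mathcal E}: S\in\operatorname{osp}(q),\ [S,\mathcal E]\subset\mathcal E\}=\operatorname{ad}\mathcal E=\{d_{S,0}: S\in\mathcal E\}.$$ Hence, whenever $\mathcal S_{\mathcal E}=\mathcal E\rtimes\mathcal S_0$, $\operatorname{Der}_K\mathcal E_\infty=\operatorname{ad}(\mathcal E_\infty)\rtimes\{d_{S,0}\in\mathcal D_{\mathcal E}: S\in\mathcal S_0\}$. In particular: (1) If $\mathcal E=\operatorname{eosp}(q)$, then $\operatorname{Der}_K\mathcal E_\infty=\mathbf{ad}_{\mathrm{loc}}\,\mathcal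 E_\infty\rtimes\{d_{S,0}: S\in\operatorname{End}_AR\oplus(\operatorname{Der}_KA)_M\}$. Moreover, if $M$ is free of finite rank, then $\operatorname{Der}_K\mathcal E_\infty=\operatorname{ad}(\mathcal E_\infty)\rtimes\{d_{S,0}: S\in\operatorname{End}_AR\oplus(\operatorname{Der}_KA)_M\}$. (2) If $\mathcal E=\overline{\operatorname{eosp}(q)}$, then $\operatorname{Der}_K\mathcal E_\infty=\operatorname{ad}(\mathcal E_\infty)\rtimes\{d_{S,0}: S\in\operatorname{End}_AR\oplus(\operatorname{Der}_KA)_M\}$. (3) If $\mathcal E=\operatorname{osp}(q)$, then $\operatorname{Der}_K\mathcal E_\infty=\operatorname{ad}\mathcal E_\infty\rtimes\{d_{S,0}: S\in(\operatorname{Der}_KA)_M\}$.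
   Context: Conventions. All structures are $\mathbb Z_2$-graded; $|z|$ is the degree of a homogeneous element $z$, and formulas involving $|z|$ are for homogeneous elements, extended linearly. Submodules and subalgebras are graded. $K$ is a unital associative superring containing $\tfrac12$ that is supercommutative: $ab=(-1)^{|a||b|}ba$. A $K$-supermodule is a $K$-bimodule $M=M_{\bar0}\oplus M_{\bar1}$ with $K_\alpha M_\beta\subset M_{\alpha+\beta}$ and $am=(-1)^{|a||m|}ma$. A map $\phi$ is $K$-linear if additive with $\phi(ma)=\phi(m)a$; $\operatorname{End}_K M$ is the $K$-supermodule of $K$-linear maps $M\to M$ (graded by degree). Bilinear means biadditive with $\phi(ma,n)=\phi(m,an)$, $\phi(m,na)=\phi(m,n)a$. For endomorphisms, $[x,y]=xy-(-1)^{|x||y|}yx$. $A$ is a superextension of $K$: a unital associative supercommutative $K$-superalgebra. An $A$-quadratic form on an $A$-supermodule $M$ is an $A$-bilinear $q:M\times M\to A$ of degree $\bar0$ with $q(m,n)=(-1)^{|m||n|}q(n,m)$. Free supermodules have homogeneous bases. $a\cdot\mathrm{Id}$ denotes $m\mapsto am$. $\operatorname{osp}(q)=\{x\in\operatorname{End}_A M: q(x(m),n)+(-1)^{|m||n|}q(x(n),m)=0\ \forall m,n\}$. $\mathbf E_{m,n}(p)=m\,q(n,p)-(-1)^{|n||p|}q(m,p)n$; $\operatorname{eosp}(q)$ is the $\mathbb Z$-span of all $\mathbf E_{m,n}$. A family $(x_i)$ in $\operatorname{eosp}(q)$ is summable if for each $m\in M$ only finitely many $x_i(m)$ are nonzero;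 $\overline{\operatorname{eosp}(q)}$ is the set of all sums $\sum x_i\in\operatorname{End}_AM$ of summable families. A quadratic form $q$ on a free $A$-supermodule with homogeneous basis $\{m_i\}_{i\in I}$ is almost diagonalizable (with respect to this basis) if for each $i$ there is $\underline i\in I$ with $q(m_i,m_{\underline i})$ invertible and $q(m_i,m_j)=0$ for $j\ne\underline i$; it is invertibly diagonalizable if moreover $\underline i=i$ for all $i$. For a ($K$-)subalgebra $\mathcal E$ with $\operatorname{eosp}(q)\subset\mathcal E\subset\operatorname{osp}(q)$, $\mathcal E_\infty=\{(a,m,n,x): a\in A,\ m,n\in M,\ x\in\mathcal E\}$ is the Lie superalgebra with product $[(a,m,n,x),(a',m',n',x')]=\big(q(m,n')-q(n,m'),\ am'+xm'-ma'-(-1)^{|x'||m|}x'm,\ -an'+xn'+na'-(-1)^{|x'||n|}x'n,\ \mathbf E_{m,n'}+\mathbf E_{n,m'}+[x,x']\big)$. Here $\mathcal E$ is identified with $\{(0,0,0,x)\}$. $\operatorname{Der}_K$ of a superalgebra: spanned by homogeneous $K$-linear $d$ with $d(xy)=d(x)y+(-1)^{|d||x|}x\,d(y)$. $\operatorname{ad}(x)(y)=[x,y]$. $\mathbf{ad}_{\mathrm{loc}}L$ is the set of locally inner derivations: $d\in\operatorname{Der}_KL$ such that for every finite $\{x_1,\dots,x_n\}\subset L$ there is $x\in L$ with $d(x_i)=[x,x_i]$ for all $i$. $X\rtimes Y$ means a direct sum of an ideal $X$ and a subalgebra $Y$. $\mathcal S_{\mathcal E}$ is the span of the homogeneous $S\in\operatorname{End}_K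 M$ with: (S1) $[S,A\cdot\mathrm{Id}]\subset A\cdot\mathrm{Id}$; (S2) $[S,q(m,n)\mathrm{Id}]=(q(S(m),n)+(-1)^{|m||n|}q(S(n),m))\mathrm{Id}$ for all homogeneous $m,n$; (S3) $[S,\mathcal E]\subset\mathcal E$. $\mathcal T_{\mathcal E}$ is the span of the homogeneous $T\in\operatorname{End}_K M$ with: (T1) $[T,A\cdot\mathrm{Id}]\subset\mathcal E$; (T2) $[T,q(m,n)\mathrm{Id}]=\mathbf E_{T(m),n}+(-1)^{|m||n|}\mathbf E_{T(n),m}$; (T3) $[T,\mathcal E]\subset A\cdot\mathrm{Id}$. For $S\in\mathcal S_{\mathcal E}$, $T\in\mathcal T_{\mathcal E}$, $d_{S,T}(a,m,n,x)=([S,a\,\mathrm{Id}]+[T,x],(S+T)(m),(S-T)(n),[T,a\,\mathrm{Id}]+[S,x])$ (identifying $A$ with $A\cdot\mathrm{Id}$), and $\mathcal D_{\mathcal E}=\{d_{S,T}\}\subset\operatorname{Der}_K\mathcal E_\infty$. The map $S\mapsto d_{S,0}$ is a Lie superalgebra monomorphism from $\{S\in\operatorname{osp}(q)\oplus(\operatorname{Der}_KA)_M:[S,\mathcal E]\subset\mathcal E\}$ to $\mathcal D_{\mathcal E}$. Let $\{n_i\}_{i\in I}$ be the homogeneous basis of $N$ formed by the bases with respect to which the two summands of $q_N$ are almost, respectively invertibly, diagonalizable, and $\{r_j\}_{j\in J}$ a homogeneous basis of $R$. For $\Delta\in\operatorname{Der}_KA$ define $\Delta_M\in\operatorname{End}_KM$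 by $\Delta_M\big(\sum_i a_in_i+\sum_j b_jr_j\big)=\sum_i\big(\tfrac12\Delta(q(n_i,n_{\underline i}))q(n_i,n_{\underline i})^{-1}a_i+\Delta(a_i)\big)n_i+\sum_j\Delta(b_j)r_j$, and $(\operatorname{Der}_KA)_M=\{\Delta_M:\Delta\in\operatorname{Der}_KA\}$. $\operatorname{End}_AR$ is regarded inside $\operatorname{End}_AM$ by extending by $0$ on $N$. *)

(* Defs.v *)
From HB Require Import structures.
From mathcomp Require Import all_boot all_order all_algebra.
From mathcomp Require Import finmap all_classical.

Set Implicit Arguments.
Unset Strict Implicit.
Unset Printing Implicit Defensive.

Import GRing.Theory.
Local Open Scope classical_set_scope.
Local Open Scope ring_scope.

(* A Z/2-grading V = V_0 (+) V_1 is given by its two projections; degrees are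
   booleans, added with (+), and the Koszul sign (-1)^{|x||y|} is
   (-1) ^+ (a && b). *)
HB.mixin Record isSuper V of GRing.Zmodule V := {
  spart : bool -> V -> V;
  spartD : forall a, {morph spart a : x y / x + y};
  spartK : forall a b v, spart a (spart b v) = if a == b then spart b v else 0;
  spart_sum : forall v, spart false v + spart true v = v
}.

#[short(type="superZmodType")]
HB.structure Definition SuperZmodule := {V of GRing.Zmodule V & isSuper V}.

Arguments spart : simpl never.

Definition homog (V : superZmodType) (a : bool) : set V :=
  [set v | spart a v = v].
Arguments homog {V} a _ /.

HB.mixin Record isSuperRing R of GRing.PzRing R & SuperZmodule R := {
  homogM : forall a b (x y : R),
    homog a x -> homog b y -> homog (a (+) b) (x * y)
}.

#[short(type="superRingType")]
HB.structure Definition SuperRing :=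
  {R of GRing.PzRing R & SuperZmodule R & isSuperRing R}.

HB.mixin Record isSuperComRing R of SuperRing R := {
  smulC : forall a b (x y : R),
    homog a x -> homog b y -> x * y = (-1) ^+ (a && b) * (y * x)
}.

#[short(type="superComRingType")]
HB.structure Definition SuperComRing := {R of SuperRing R & isSuperComRing R}.

HB.mixin Record isSuperLmodule (K : superComRingType) V
    of GRing.Lmodule K V & SuperZmodule V := {
  homogZ : forall a b (k : K) (v : V),
    homog a k -> homog b v -> homog (a (+) b) (k *: v)
}.

#[short(type="superLmodType")]
HB.structure Definition SuperLmodule (K : superComRingType) :=
  {V of GRing.Lmodule K V & SuperZmodule V & isSuperLmodule K V}.

(* Superextensions of K (nonzero, as all lalgType).  The compatibilities of the
   product with the right action of K follow from k *: (x * y) = (k *: x) * y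
   and supercommutativity. *)
#[short(type="superExtType")]
HB.structure Definition SuperExt (K : superComRingType) :=
  {A of GRing.Lalgebra K A & SuperComRing A & SuperLmodule K A}.

Arguments homogM {_ _ _ _ _}.
Arguments smulC {_ _ _ _ _}.
Arguments homogZ {_ _ _ _ _ _}.

Section Grading.
Variable V : superZmodType.
Implicit Types (a b : bool) (u v : V).

Lemma spart0 a : spart a (0 : V) = 0.
Proof. by apply: (addrI (spart a 0)); rewrite -spartD !addr0. Qed.

Lemma spartN a : {morph @spart V a : v / - v}.
Proof. by move=> v; apply: (addrI (spart a v)); rewrite -spartD !subrr spart0. Qed.

Lemma homog_spart a v : homog a (spart a v).
Proof. by rewrite /= spartK eqxx. Qed.

Lemma spart_homog a b v : homog b v -> spart a v = if a == b then v else 0.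
Proof. by move=> /= hv; rewrite -hv spartK; case: eqP => // <-; rewrite hv. Qed.

Lemma homog0 a : homog a (0 : V). Proof. exact: spart0. Qed.

Lemma homogD a u v : homog a u -> homog a v -> homog a (u + v).
Proof. by move=> /= hu hv; rewrite spartD hu hv. Qed.

Lemma homogN a v : homog a v -> homog a (- v).
Proof. by move=> /= hv; rewrite spartN hv. Qed.

Lemma spart_sumE v : \sum_(a : bool) spart a v = v.
Proof. by rewrite big_bool /= addrC spart_sum. Qed.

Lemma homog_ind (P : V -> Prop) :
    (forall u v, P u -> P v -> P (u + v)) ->
    (forall a v, homog a v -> P v) ->
  forall v, P v.
Proof.
by move=> PD Ph v; rewrite -(spart_sum v); apply: PD; apply: Ph; exact: homog_spart.
Qed.

End Grading.

Lemma homog1 (R : superRingType) : homog false (1 : R).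
Proof.
have h0 := homog_spart false (1 : R); have h1 := homog_spart true (1 : R).
have e1 : spart true (1 : R) = 0; last by rewrite /= -{2}(spart_sum (1 : R)) e1 addr0.
have /(congr1 (spart true)) : spart true 1 =
    spart true 1 * spart false 1 + spart true 1 * spart true 1 :> R.
  by rewrite -mulrDr spart_sum mulr1.
rewrite spartD (spart_homog _ (homogM h1 h0)) (spart_homog _ (homogM h1 h1)).
rewrite spartK /= addr0 => e10.
have /(congr1 (spart true)) : spart false 1 =
    spart false 1 * spart false 1 + spart true 1 * spart false 1 :> R.
  by rewrite -mulrDl spart_sum mul1r.
rewrite spartD (spart_homog _ (homogM h0 h0)) (spart_homog _ (homogM h1 h0)).
by rewrite spartK /= add0r -e10.
Qed.

Section Super.
Variables (K : superComRingType) (V : superLmodType K).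
Implicit Types (a b c : bool) (k l : K) (v : V).

(* The right action of the bimodule V: the rule am = (-1)^{|a||m|} ma
   determines it from the left one. *)
Definition rscale v k : V :=
  \sum_(a : bool) \sum_(b : bool)
    (-1) ^+ (a && b) *: (spart a k *: spart b v).

Lemma spart_sign a (e : bool) v :
  spart a ((-1) ^+ e *: v) = (-1) ^+ e *: spart a v.
Proof. by case: e; rewrite ?scale1r // expr1 !scaleN1r spartN. Qed.

Lemma homog_sign a (e : bool) v : homog a v -> homog a ((-1) ^+ e *: v).
Proof. by move=> /= hv; rewrite spart_sign hv. Qed.

Lemma scaler_sign (e : bool) k v :
  k *: ((-1) ^+ e *: v) = (-1) ^+ e *: (k *: v).
Proof. by case: e; rewrite ?scale1r // expr1 !scaleN1r scalerN. Qed.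

Lemma signZ_addb (e f : bool) v :
  (-1) ^+ e *: ((-1) ^+ f *: v) = (-1) ^+ (e (+) f) *: v.
Proof. by rewrite scalerA -signr_addb. Qed.

Lemma rscaleDl k : {morph rscale^~ k : u v / u + v}.
Proof.
move=> u v; rewrite /rscale -big_split; apply: eq_bigr => a _ /=.
by rewrite -big_split; apply: eq_bigr => b _ /=; rewrite spartD !scalerDr.
Qed.

Lemma rscaleDr v : {morph rscale v : k l / k + l}.
Proof.
move=> k l; rewrite /rscale -big_split; apply: eq_bigr => a _ /=.
rewrite -big_split; apply: eq_bigr => b _ /=.
by rewrite spartD scalerDl !scalerDr.
Qed.

Lemma rscale_homog a b k v : homog a k -> homog b v ->
  rscale v k = (-1) ^+ (a && b) *: (k *: v).
Proof.
move=> hk hv; rewrite /rscale !big_bool /= !(spart_homog _ hk) !(spart_homog _ hv).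
by case: (a) (b) => [] [] /=; rewrite ?(scale0r, scaler0, addr0, add0r).
Qed.

Lemma scale_rscale a b k v : homog a k -> homog b v ->
  k *: v = (-1) ^+ (a && b) *: rscale v k.
Proof. by move=> hk hv; rewrite (rscale_homog hk hv) signZ_addb addbb scale1r. Qed.

Lemma homog_rscale a b k v : homog a k -> homog b v -> homog (a (+) b) (rscale v k).
Proof.
by move=> hk hv; rewrite (rscale_homog hk hv); apply/homog_sign/homogZ.
Qed.

Lemma rscale1 v : rscale v 1 = v.
Proof.
elim/homog_ind: v => [u v hu hv|b v hv]; first by rewrite rscaleDl hu hv.
by rewrite (rscale_homog (@homog1 K) hv) !scale1r.
Qed.

Lemma rscale0l k : rscale 0 k = 0.
Proof. by apply: (addrI (rscale 0 k)); rewrite -rscaleDl !addr0. Qed.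

Lemma rscaleNl k : {morph rscale^~ k : v / - v}.
Proof.
by move=> v; apply: (addrI (rscale v k)); rewrite -rscaleDl !subrr rscale0l.
Qed.

Lemma rscale_sign (e : bool) v k :
  rscale ((-1) ^+ e *: v) k = (-1) ^+ e *: rscale v k.
Proof. by case: e; rewrite ?scale1r // expr1 !scaleN1r rscaleNl. Qed.

Lemma rscaleA v k l : rscale (rscale v k) l = rscale v (k * l).
Proof.
elim/homog_ind: v => [u v hu hv|c v hv]; first by rewrite !rscaleDl hu hv.
elim/homog_ind: k => [k k' hk hk'|a k hk].
  by rewrite mulrDl !rscaleDr rscaleDl hk hk'.
elim/homog_ind: l => [l l' hl hl'|b l hl]; first by rewrite mulrDr !rscaleDr hl hl'.
rewrite (rscale_homog hl (homog_rscale hk hv)) (rscale_homog hk hv).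
rewrite scaler_sign signZ_addb [l *: _]scalerA (smulC hl hk)
  -scalerA signZ_addb.
rewrite (rscale_homog (homogM hk hl) hv).
by congr (_ *: _); congr (_ ^+ _); case: (a) (b) (c) => [] [] [].
Qed.

Lemma scale_rscaleA k v l : k *: rscale v l = rscale (k *: v) l.
Proof.
elim/homog_ind: v => [u v hu hv|c v hv]; first by rewrite scalerDr !rscaleDl scalerDr hu hv.
elim/homog_ind: k => [k k' hk hk'|a k hk].
  by rewrite !scalerDl !rscaleDl hk hk'.
elim/homog_ind: l => [l l' hl hl'|b l hl]; first by rewrite !rscaleDr scalerDr hl hl'.
rewrite (rscale_homog hl hv) (rscale_homog hl (homogZ hk hv)).
rewrite scaler_sign [l *: (k *: v)]scalerA (smulC hl hk) -scalerA signZ_addb.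
rewrite [k *: (l *: v)]scalerA.
by congr (_ *: _); congr (_ ^+ _); case: (a) (b) (c) => [] [] [].
Qed.

Definition klinear (f : V -> V) : Prop :=
  {morph f : u v / u + v} /\ forall v k, f (rscale v k) = rscale (f v) k.

Definition klinearb : {pred V -> V} := fun f => `[< klinear f >].

Record sEnd := SEnd { sfun :> V -> V; sEndP : klinearb sfun }.

HB.instance Definition _ := [isSub for sfun].
HB.instance Definition _ := [Choice of sEnd by <:].

Lemma klinear_submod : submod_closed klinearb.
Proof.
split.
  apply/asboolP; split=> [u v|v k]; first by rewrite addr0.
  by apply: (addrI (rscale 0 k)); rewrite -rscaleDl !addr0.
move=> k f g /asboolP[fD fZ] /asboolP[gD gZ]; apply/asboolP; split.
  move=> u v; change (k *: f (u + v) + g (u + v) =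
    k *: f u + g u + (k *: f v + g v)).
  by rewrite fD gD scalerDr addrACA.
move=> v l; change (k *: f (rscale v l) + g (rscale v l) =
  rscale (k *: f v + g v) l).
by rewrite fZ gZ rscaleDl scale_rscaleA.
Qed.

HB.instance Definition _ :=
  GRing.isSubmodClosed.Build K (V -> V) klinearb klinear_submod.
HB.instance Definition _ := [SubChoice_isSubLmodule of sEnd by <:].


Lemma sEnd_ext (f g : sEnd) : (forall v, f v = g v) -> f = g.
Proof. by move=> fg; apply/val_inj/funext. Qed.

Lemma sEndD (f : sEnd) : {morph f : u v / u + v}.
Proof. by have /asboolP[] := sEndP f. Qed.

Lemma sEnd_rscale (f : sEnd) v k : f (rscale v k) = rscale (f v) k.
Proof. by have /asboolP[_] := sEndP f; apply. Qed.

Lemma sEnd0 (f : sEnd) : f 0 = 0.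
Proof. by apply: (addrI (f 0)); rewrite -sEndD !addr0. Qed.

Lemma sEndN (f : sEnd) : {morph f : v / - v}.
Proof. by move=> v; apply: (addrI (f v)); rewrite -sEndD !subrr sEnd0. Qed.

Lemma sEnd_sign (f : sEnd) (e : bool) v : f ((-1) ^+ e *: v) = (-1) ^+ e *: f v.
Proof. by case: e; rewrite ?scale1r // expr1 !scaleN1r sEndN. Qed.

Lemma sEnd_eqh (f g : sEnd) :
  (forall a v, homog a v -> f v = g v) -> f = g.
Proof.
move=> fg; apply: sEnd_ext; apply: homog_ind => [u v|a v]; last exact: fg.
by rewrite !sEndD => -> ->.
Qed.

Lemma add_sEndE (f g : sEnd) v : (f + g) v = f v + g v. Proof. by []. Qed.
Lemma opp_sEndE (f : sEnd) v : (- f) v = - f v. Proof. by []. Qed.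
Lemma zero_sEndE v : (0 : sEnd) v = 0. Proof. by []. Qed.
Lemma scale_sEndE k (f : sEnd) v : (k *: f) v = k *: f v. Proof. by []. Qed.

Lemma klinear_id : klinearb id. Proof. exact/asboolP. Qed.

Lemma klinear_comp (f g : sEnd) : klinearb (f \o g).
Proof.
by apply/asboolP; split=> [u v|v k] /=; rewrite ?sEndD // !sEnd_rscale.
Qed.

Let sone := SEnd klinear_id.
Let smul f g := SEnd (klinear_comp f g).

Let smulA : associative smul. Proof. by move=> f g h; exact: sEnd_ext. Qed.
Let smul1 : left_id sone smul. Proof. by move=> f; exact: sEnd_ext. Qed.
Let smulr1 : right_id sone smul. Proof. by move=> f; exact: sEnd_ext. Qed.
Let smulDl : left_distributive smul +%R.
Proof. by move=> f g h; exact: sEnd_ext. Qed.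
Let smulDr : right_distributive smul +%R.
Proof. by move=> f g h; apply: sEnd_ext => v; exact: (sEndD f). Qed.

HB.instance Definition _ :=
  GRing.Zmodule_isPzRing.Build sEnd smulA smul1 smulr1 smulDl smulDr.

Lemma mul_sEndE (f g : sEnd) v : (f * g) v = f (g v). Proof. by []. Qed.
Lemma one_sEndE v : (1 : sEnd) v = v. Proof. by []. Qed.

Definition end_part a (f : V -> V) (v : V) : V :=
  \sum_(b : bool) spart (a (+) b) (f (spart b v)).

Lemma end_part_homog a b (f : sEnd) v : homog b v ->
  end_part a f v = spart (a (+) b) (f v).
Proof.
move=> hv; rewrite /end_part big_bool /= !(spart_homog _ hv).
by case: b {hv} => /=; rewrite sEnd0 spart0 ?addr0 ?add0r.
Qed.

Lemma spart_rscale a b k v : homog b k ->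
  spart (a (+) b) (rscale v k) = rscale (spart a v) k.
Proof.
move=> hk; elim/homog_ind: v => [u v hu hv|c v hv].
  by rewrite rscaleDl !spartD rscaleDl hu hv.
rewrite (spart_homog _ (homog_rscale hk hv)) (spart_homog _ hv).
rewrite [a (+) b]addbC (can_eq (addKb b)).
case: eqP => // _; apply: (addrI (rscale 0 k)).
by rewrite -rscaleDl !addr0.
Qed.

Lemma klinear_end_part a (f : sEnd) : klinearb (end_part a f).
Proof.
have D : {morph end_part a f : u v / u + v}.
  move=> u v; rewrite /end_part -big_split; apply: eq_bigr => b _ /=.
  by rewrite spartD sEndD spartD.
apply/asboolP; split=> // v k.
elim/homog_ind: v => [u v hu hv|c v hv]; first by rewrite rscaleDl !D rscaleDl hu hv.
elim/homog_ind: k => [k l hk hl|b k hk]; first by rewrite !rscaleDr D hk hl.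
rewrite (end_part_homog _ _ (homog_rscale hk hv)) (end_part_homog _ _ hv).
by rewrite sEnd_rscale [b (+) c]addbC addbA spart_rscale.
Qed.

Let epart a (f : sEnd) := SEnd (klinear_end_part a f).

Let epartD a : {morph epart a : f g / f + g}.
Proof.
move=> f g; apply: sEnd_ext => v; change (end_part a (f + g) v =
  end_part a f v + end_part a g v).
by rewrite /end_part -big_split; apply: eq_bigr => b _; rewrite add_sEndE spartD.
Qed.

Let epartK a b f : epart a (epart b f) = if a == b then epart b f else 0.
Proof.
apply: (@sEnd_eqh _ _) => c v hv.
rewrite [LHS](end_part_homog _ (epart b f) hv) [sfun (epart b f) v](end_part_homog _ f hv).
have -> : (if a == b then epart b f else 0) v =
    if a == b then spart (b (+) c) (f v) else 0.
  by case: eqP => // _; rewrite [LHS](end_part_homog _ f hv).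
by rewrite spartK; case: (a) (b) (c) => [] [] [].
Qed.

Let epart_sum f : epart false f + epart true f = f.
Proof.
apply: (@sEnd_eqh _ _) => c v hv.
rewrite add_sEndE [X in X + _](end_part_homog _ f hv).
rewrite [X in _ + X](end_part_homog _ f hv).
by case: c hv => _ /=; rewrite ?spart_sum // addrC spart_sum.
Qed.

HB.instance Definition _ := isSuper.Build sEnd epartD epartK epart_sum.

Lemma spart_endE a b (f : sEnd) v : homog b v ->
  spart a f v = spart (a (+) b) (f v).
Proof. exact: end_part_homog. Qed.

Lemma homog_endP a (f : sEnd) :
  homog a f <-> forall b v, homog b v -> homog (a (+) b) (f v).
Proof.
split=> [hf b v hv|hf]; first by rewrite -hf (spart_endE _ _ hv); exact: homog_spart.
by apply: (@sEnd_eqh _ _) => b v hv; rewrite (spart_endE _ _ hv); exact: hf.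
Qed.

Let end_homogM a b (f g : sEnd) :
  homog a f -> homog b g -> homog (a (+) b) (f * g).
Proof.
move=> /homog_endP hf /homog_endP hg; apply/homog_endP => c v hv.
by rewrite -addbA; apply/hf/hg.
Qed.

HB.instance Definition _ := isSuperRing.Build sEnd end_homogM.

Let end_homogZ a b k (f : sEnd) :
  homog a k -> homog b f -> homog (a (+) b) (k *: f).
Proof.
move=> hk /homog_endP hf; apply/homog_endP => c v hv.
by rewrite -addbA; apply/homogZ/hf.
Qed.

HB.instance Definition _ := isSuperLmodule.Build K sEnd end_homogZ.

End Super.

Arguments sEnd {K} V.

Section PairSuper.
Variables (V1 V2 : superZmodType).

Let ppart a (v : V1 * V2) : V1 * V2 := (spart a v.1, spart a v.2).

Let ppartD a : {morph ppart a : u v / u + v}.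
Proof. by move=> u v; rewrite /ppart !spartD. Qed.

Let ppartK a b v : ppart a (ppart b v) = if a == b then ppart b v else 0.
Proof. by rewrite /ppart !spartK; case: eqP. Qed.

Let ppart_sum v : ppart false v + ppart true v = v.
Proof. by case: v => v1 v2; congr pair; exact: spart_sum. Qed.

HB.instance Definition _ := isSuper.Build (V1 * V2)%type ppartD ppartK ppart_sum.

Lemma spart_pair a (v : V1 * V2) : spart a v = (spart a v.1, spart a v.2).
Proof. by []. Qed.

Lemma homog_pair a (v : V1 * V2) : homog a v <-> homog a v.1 /\ homog a v.2.
Proof. by case: v => v1 v2; split=> [[]|[/= h1 h2]] //; rewrite spart_pair /= h1 h2. Qed.

End PairSuper.

Section PairSuperLmodule.
Variables (K : superComRingType) (V1 V2 : superLmodType K).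

Let phomogZ a b (k : K) (v : V1 * V2) :
  homog a k -> homog b v -> homog (a (+) b) (k *: v).
Proof.
by move=> hk /homog_pair[h1 h2]; apply/homog_pair; split; exact: homogZ.
Qed.

HB.instance Definition _ := isSuperLmodule.Build K (V1 * V2)%type phomogZ.

Lemma rscale_pair (v : V1 * V2) k : rscale v k = (rscale v.1 k, rscale v.2 k).
Proof.
case: v => v1 v2; rewrite /rscale !big_bool /=.
by congr pair.
Qed.

End PairSuperLmodule.

(* An A-supermodule regarded as a K-supermodule *)
Definition restr (K : superComRingType) (A : superExtType K)
  (M : superLmodType A) : Type := M.
Arguments restr {K A} M.

Section Restr.
Variables (K : superComRingType) (A : superExtType K) (M : superLmodType A).

HB.instance Definition _ := SuperZmodule.on (restr M).

Let rsc (k : K) (m : restr M) : restr M := (k%:A : A) *: (m : M).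

Let rscA k l m : rsc k (rsc l m) = rsc (k * l) m.
Proof. by rewrite /rsc scalerA -scalerAl mul1r scalerA. Qed.
Let rsc1 : left_id 1 rsc.
Proof. by move=> m; rewrite /rsc !scale1r. Qed.
Let rscDr : right_distributive rsc +%R.
Proof. by move=> k m n; exact: scalerDr. Qed.
Let rscDl m : {morph rsc^~ m : k l / k + l}.
Proof. by move=> k l; rewrite /rsc !scalerDl. Qed.

HB.instance Definition _ :=
  GRing.Zmodule_isLmodule.Build K (restr M) rscA rsc1 rscDr rscDl.

Lemma homog_in_alg a (k : K) : homog a k -> homog a (k%:A : A).
Proof. by move=> hk; have := homogZ hk (@homog1 A); rewrite addbF. Qed.

Let rsc_homog a b (k : K) (m : restr M) :
  homog a k -> homog b m -> homog (a (+) b) (k *: m).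
Proof. by move=> hk hm; exact: (homogZ (homog_in_alg hk) (hm : @homog M b m)). Qed.

HB.instance Definition _ := isSuperLmodule.Build K (restr M) rsc_homog.

Lemma rscale_restr (m : restr M) (k : K) :
  rscale m k = rscale (m : M) (k%:A : A) :> M.
Proof.
elim/homog_ind: k => [k l hk hl|a k hk].
  by rewrite rscaleDr scalerDl rscaleDr hk hl.
elim/homog_ind: m => [m n hm hn|b m hm].
  by rewrite rscaleDl (rscaleDl (V := M)) hm hn.
rewrite (rscale_homog hk hm) (rscale_homog (homog_in_alg hk) (hm : homog b (m : M))).
by case: (a && b); rewrite ?expr1 ?scaleN1r ?scale1r.
Qed.

End Restr.

Section Brackets.
Variable R : superRingType.

Definition scomm (x y : R) : R :=
  \sum_(a : bool) \sum_(b : bool)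
    (spart a x * spart b y - (-1) ^+ (a && b) * (spart b y * spart a x)).

Lemma scomm_homog a b (x y : R) : homog a x -> homog b y ->
  scomm x y = x * y - (-1) ^+ (a && b) * (y * x).
Proof.
move=> hx hy; rewrite /scomm !big_bool /= !(spart_homog _ hx) !(spart_homog _ hy).
by case: (a) (b) => [] [] /=; rewrite ?(mul0r, mulr0, subr0, oppr0, addr0, add0r).
Qed.

Lemma scommDl (z : R) : {morph scomm^~ z : x y / x + y}.
Proof.
move=> x y; rewrite /scomm -big_split; apply: eq_bigr => a _ /=.
rewrite -big_split; apply: eq_bigr => b _ /=.
by rewrite spartD mulrDl !mulrDr opprD addrACA.
Qed.

Lemma scommDr (z : R) : {morph scomm z : x y / x + y}.
Proof.
move=> x y; rewrite /scomm -big_split; apply: eq_bigr => a _ /=.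
rewrite -big_split; apply: eq_bigr => b _ /=.
by rewrite spartD mulrDl !mulrDr opprD addrACA.
Qed.

Definition invertible (x : R) : Prop := exists y, x * y = 1 /\ y * x = 1.

Definition rinv (x : R) : R := xget 0 [set y | x * y = 1 /\ y * x = 1].

End Brackets.

Definition zspan (V : zmodType) (G : set V) : set V :=
  smallest [set X : set V | X 0 /\ forall x y, X x -> X y -> X (x - y)] G.

Section Submodules.
Variables (K : superComRingType) (V : superLmodType K).

Definition graded_submodule (X : set V) : Prop :=
  [/\ X 0, (forall x y, X x -> X y -> X (x + y)),
      (forall (k : K) x, X x -> X (k *: x))
    & (forall a x, X x -> X (spart a x))].

Definition setsum (X Y : set V) : set V := [set x + y | x in X & y in Y].

Definition direct (X Y : set V) : Prop := X `&` Y = [set 0].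

Variable br : V -> V -> V.

Definition subalgebra (X : set V) : Prop :=
  graded_submodule X /\ (forall x y, X x -> X y -> X (br x y)).

Definition ideal (Z X : set V) : Prop :=
  [/\ graded_submodule X, X `<=` Z
    & forall z x, Z z -> X x -> X (br z x) /\ X (br x z)].

Definition semidirect (Z X Y : set V) : Prop :=
  [/\ Z = setsum X Y, direct X Y, ideal Z X & subalgebra Y].

Definition Der : set (sEnd V) :=
  zspan [set d : sEnd V | exists2 c, homog c d &
    forall a x y, homog a x ->
      d (br x y) = br (d x) y + (-1) ^+ (c && a) *: br x (d y)].

Definition locally_inner : set (sEnd V) :=
  [set d : sEnd V | Der d /\
    forall s : seq V, exists x, forall y, y \in s -> d y = br x y].

End Submodules.

Definition lie_iso (K : superComRingType) (V W : superLmodType K)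
    (brV : V -> V -> V) (brW : W -> W -> W) (X : set V) (Y : set W)
    (f : V -> W) : Prop :=
  [/\ set_bij X Y f,
      (forall x y, X x -> X y -> f (x + y) = f x + f y),
      (forall x (k : K), X x -> f (rscale x k) = rscale (f x) k),
      (forall a x, X x -> homog a x -> homog a (f x))
    & (forall x y, X x -> X y -> f (brV x y) = brW (f x) (f y))].

Record quadForm (K : superComRingType) (A : superExtType K)
    (M : superLmodType A) := QuadForm {
  qf :> M -> M -> A;
  qfDl : forall n, {morph qf^~ n : m m' / m + m'};
  qfDr : forall m, {morph qf m : n n' / n + n'};
  qfM : forall m (a : A) n, qf (rscale m a) n = qf m (a *: n);
  qfZr : forall m n (a : A), qf m (rscale n a) = qf m n * a;
  qf_homog : forall a b m n, homog a m -> homog b n -> homog (a (+) b) (qf m n);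
  qfC : forall a b m n, homog a m -> homog b n ->
    qf m n = (-1) ^+ (a && b) * qf n m
}.

Section OrthSum.
Variables (K : superComRingType) (A : superExtType K).
Variables (M1 M2 : superLmodType A) (q1 : quadForm M1) (q2 : quadForm M2).

Let qs (m n : M1 * M2) : A := q1 m.1 n.1 + q2 m.2 n.2.

Let qsDl n : {morph qs^~ n : m m' / m + m'}.
Proof. by move=> m m'; rewrite /qs /= !qfDl addrACA. Qed.
Let qsDr m : {morph qs m : n n' / n + n'}.
Proof. by move=> n n'; rewrite /qs /= !qfDr addrACA. Qed.
Let qsM m (a : A) n : qs (rscale m a) n = qs m (a *: n).
Proof. by rewrite /qs rscale_pair /= !qfM. Qed.
Let qsZr m n (a : A) : qs m (rscale n a) = qs m n * a.
Proof. by rewrite /qs rscale_pair /= !qfZr mulrDl. Qed.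
Let qs_homog a b m n : homog a m -> homog b n -> homog (a (+) b) (qs m n).
Proof.
by move=> /homog_pair[m1 m2] /homog_pair[n1 n2]; apply: homogD; exact: qf_homog.
Qed.
Let qsC a b m n : homog a m -> homog b n -> qs m n = (-1) ^+ (a && b) * qs n m.
Proof.
move=> /homog_pair[m1 m2] /homog_pair[n1 n2]; rewrite /qs mulrDr.
by rewrite (qfC q1 m1 n1) (qfC q2 m2 n2).
Qed.

Definition orth_sum : quadForm (M1 * M2)%type :=
  QuadForm qsDl qsDr qsM qsZr qs_homog qsC.

End OrthSum.

Section Bases.
Variables (K : superComRingType) (A : superExtType K) (M : superLmodType A).
Variables (I : choiceType) (b : I -> M).

Definition is_coord (m : M) (a : I -> A) : Prop :=
  finite_set [set i | a i != 0] /\ m = \sum_(i \in [set: I]) a i *: b i.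

Definition homog_basis : Prop :=
  (forall i, exists c, homog c (b i)) /\ forall m, exists! a, is_coord m a.

Definition coord (m : M) : I -> A := xget 0 (is_coord m).

Variable q : quadForm M.

Definition partner_of (i j : I) : Prop :=
  invertible (q (b i) (b j)) /\ forall k, k <> j -> q (b i) (b k) = 0.

Definition almost_diagonalizable : Prop := forall i, exists j, partner_of i j.

Definition invertibly_diagonalizable : Prop := forall i, partner_of i i.

Definition partner (i : I) : I := xget i (partner_of i).

End Bases.

Definition sum_basis (K : superComRingType) (A : superExtType K)
    (M1 M2 : superLmodType A) (I J : choiceType) (b1 : I -> M1) (b2 : J -> M2)
    (i : I + J) : M1 * M2 :=
  match i with inl i => (b1 i, 0) | inr j => (0, b2 j) end.

Section Endomorphisms.
Variables (K : superComRingType) (A : superExtType K) (M : superLmodType A).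
Notation End := (sEnd (restr M)).

Definition Alinear (f : End) : Prop :=
  forall (m : M) (a : A), f (rscale m a) = rscale (f m : M) a.

Let aid (a : A) (m : restr M) : restr M := a *: (m : M).

Let aid_klinear a : klinearb (aid a).
Proof.
apply/asboolP; split=> [u v|m k]; first exact: (@scalerDr A M).
by rewrite /aid !rscale_restr (@scale_rscaleA A M).
Qed.

Definition aId (a : A) : End := SEnd (aid_klinear a).

Lemma aIdE a m : aId a m = a *: (m : M). Proof. by []. Qed.

Variable q : quadForm M.

Definition osp : set End :=
  [set x | Alinear x /\ forall a b (m n : M), homog a m -> homog b n ->
     q (x m) n + (-1) ^+ (a && b) * q (x n) m = 0].

Definition Efun (m n : M) (p : restr M) : restr M :=
  rscale m (q n p) -
  \sum_(a : bool) \sum_(b : bool)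
     (-1) ^+ (a && b) *: (q m (spart b (p : M)) *: spart a n).

End Endomorphisms.

Definition endbr (K : superComRingType) (V : superLmodType K)
  (f g : sEnd V) : sEnd V := scomm f g.

Section EndLemmas.
Variables (K : superComRingType) (V : superLmodType K).

Lemma sEnd_scale a c (f : sEnd V) (k : K) v : homog a f -> homog c k ->
  f (k *: v) = (-1) ^+ (a && c) *: (k *: f v).
Proof.
move=> /homog_endP hf hk; elim/homog_ind: v => [u v hu hv|b v hv].
  by rewrite scalerDr !sEndD hu hv !scalerDr.
rewrite (scale_rscale hk hv) sEnd_sign sEnd_rscale (rscale_homog hk (hf _ _ hv)).
by rewrite signZ_addb; congr (_ *: _); congr (_ ^+ _); case: (a) (b) (c) => [] [] [].
Qed.

Lemma rscale_sEndE (f : sEnd V) (k : K) v : rscale f k v = f (k *: v).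
Proof.
elim/homog_ind: k => [k l hk hl|c k hk].
  by rewrite rscaleDr add_sEndE scalerDl sEndD hk hl.
elim/homog_ind: f => [f g hf hg|a f hf].
  by rewrite rscaleDl !add_sEndE hf hg.
rewrite (rscale_homog hk hf) (sEnd_scale _ hf hk) andbC.
by case: (c && a); rewrite ?expr1 ?scaleN1r ?scale1r.
Qed.

Lemma scomm_rscale (f g : sEnd V) (k : K) :
  scomm f (rscale g k) = rscale (scomm f g) k.
Proof.
elim/homog_ind: k => [k l hk hl|c k hk].
  by rewrite !rscaleDr scommDr hk hl.
elim/homog_ind: f => [f f' hf hf'|a f hf].
  by rewrite !scommDl rscaleDl hf hf'.
elim/homog_ind: g => [g g' hg hg'|b g hg].
  by rewrite rscaleDl !scommDr rscaleDl hg hg'.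
apply: sEnd_ext => v; rewrite (scomm_homog hf (homog_rscale hk hg)).
rewrite (scomm_homog hf hg) rscale_sEndE.
have sE (e : bool) (h : sEnd V) w : ((-1) ^+ e * h) w = (-1) ^+ e *: h w.
  by case: e; rewrite ?mul1r ?scale1r // expr1 mulN1r scaleN1r.
rewrite !add_sEndE !opp_sEndE !sE !mul_sEndE !rscale_sEndE; congr (_ - _).
rewrite (sEnd_scale _ hf hk) sEnd_sign signZ_addb.
by congr (_ *: _); congr (_ ^+ _); case: (a) (b) (c) => [] [] [].
Qed.

(* (-1)^{|f||v|} f(v), extended linearly *)
Definition sapp (f : sEnd V) (v : V) : V :=
  \sum_(a : bool) \sum_(b : bool) (-1) ^+ (a && b) *: spart a f (spart b v).

Lemma sappDl v : {morph sapp^~ v : f g / f + g}.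
Proof.
move=> f g; rewrite /sapp -big_split; apply: eq_bigr => a _.
by rewrite -big_split; apply: eq_bigr => b _; rewrite spartD add_sEndE scalerDr.
Qed.

Lemma sappDr f : {morph sapp f : u v / u + v}.
Proof.
move=> u v; rewrite /sapp -big_split; apply: eq_bigr => a _.
by rewrite -big_split; apply: eq_bigr => b _; rewrite spartD sEndD scalerDr.
Qed.

Lemma sapp_homog a b (f : sEnd V) v : homog a f -> homog b v ->
  sapp f v = (-1) ^+ (a && b) *: f v.
Proof.
move=> hf hv; rewrite /sapp !big_bool !(spart_homog _ hf) !(spart_homog _ hv).
by case: (a) (b) => [] [];
  rewrite ?eqxx /eq_op /= ?(zero_sEndE, sEnd0, scaler0, addr0, add0r).
Qed.

Lemma sapp_rscale (f : sEnd V) (k : K) v : sapp (rscale f k) v = rscale (sapp f v) k.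
Proof.
elim/homog_ind: k => [k l hk hl|c k hk].
  by rewrite !rscaleDr sappDl hk hl.
elim/homog_ind: f => [f f' hf hf'|a f hf].
  by rewrite rscaleDl !sappDl rscaleDl hf hf'.
elim/homog_ind: v => [v v' hv hv'|b v hv].
  by rewrite !sappDr rscaleDl hv hv'.
rewrite (sapp_homog (homog_rscale hk hf) hv) (sapp_homog hf hv) rscale_sEndE.
rewrite (scale_rscale hk hv) sEnd_sign sEnd_rscale rscale_sign signZ_addb.
by congr (_ *: _); congr (_ ^+ _); case: (a) (b) (c) => [] [] [].
Qed.

End EndLemmas.

Lemma rscale_ext (K : superComRingType) (A : superExtType K) (x : A) (k : K) :
  rscale x k = x * k%:A.
Proof.
elim/homog_ind: k => [k l hk hl|a k hk]; first by rewrite rscaleDr scalerDl mulrDr hk hl.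
elim/homog_ind: x => [x y hx hy|b x hx]; first by rewrite rscaleDl mulrDl hx hy.
rewrite (rscale_homog hk hx) (smulC hx (homog_in_alg A hk)) -scalerAl mul1r andbC.
by case: (b && a); rewrite ?expr1 ?scaleN1r ?scale1r ?mulN1r ?mul1r.
Qed.

Section EMaps.
Variables (K : superComRingType) (A : superExtType K) (M : superLmodType A).
Variable q : quadForm M.
Notation End := (sEnd (restr M)).
Implicit Types (m n p : M).

Lemma EfunDl n p : {morph (fun m => Efun q m n p : M) : m m' / m + m'}.
Proof.
move=> m m'; rewrite /Efun rscaleDl addrACA -opprD; congr (_ - _).
rewrite -big_split; apply: eq_bigr => a _ /=.
by rewrite -big_split; apply: eq_bigr => b _ /=; rewrite qfDl scalerDl scalerDr.
Qed.

Lemma EfunDm m p : {morph (fun n => Efun q m n p : M) : n n' / n + n'}.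
Proof.
move=> n n'; rewrite /Efun qfDl rscaleDr addrACA -opprD; congr (_ - _).
rewrite -big_split; apply: eq_bigr => a _ /=.
by rewrite -big_split; apply: eq_bigr => b _ /=; rewrite spartD !scalerDr.
Qed.

Lemma EfunDr m n : {morph (Efun q m n : M -> M) : p p' / p + p'}.
Proof.
move=> p p'; rewrite /Efun qfDr rscaleDr addrACA -opprD; congr (_ - _).
rewrite -big_split; apply: eq_bigr => a _ /=.
by rewrite -big_split; apply: eq_bigr => b _ /=; rewrite spartD qfDr scalerDl scalerDr.
Qed.

Lemma Efun_homog a b m n p : homog a n -> homog b p ->
  Efun q m n p = rscale m (q n p) - (-1) ^+ (a && b) *: (q m p *: n) :> M.
Proof.
move=> hn hp; rewrite /Efun; congr (_ - _).
have q0 : q m 0 = 0 by apply: (addrI (q m 0)); rewrite -qfDr !addr0.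
rewrite !big_bool /= !(spart_homog _ hn) !(spart_homog _ hp).
by case: (a) (b) => [] [] /=; rewrite ?(q0, scale0r, scaler0, addr0, add0r).
Qed.

Lemma Efun_rscale m n p (a : A) :
  Efun q m n (rscale p a) = rscale (Efun q m n p : M) a :> M.
Proof.
elim/homog_ind: a => [a a' ha ha'|d a ha]; first by rewrite !rscaleDr EfunDr ha ha'.
elim/homog_ind: p => [p p' hp hp'|b p hp].
  by rewrite rscaleDl !EfunDr rscaleDl hp hp'.
elim/homog_ind: n => [n n' hn hn'|c n hn]; first by rewrite !EfunDm rscaleDl hn hn'.
rewrite (Efun_homog _ hn (homog_rscale ha hp)) (Efun_homog _ hn hp).
rewrite rscaleDl !qfZr rscaleA; congr (_ + _).
rewrite rscaleNl; congr (- _).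
rewrite rscale_sign -scale_rscaleA (rscale_homog ha hn) scaler_sign signZ_addb.
rewrite scalerA.
by congr (_ *: _); congr (_ ^+ _); case: (b) (c) (d) => [] [] [].
Qed.

Lemma Efun_klinear m n : klinearb (Efun q m n).
Proof.
apply/asboolP; split; first exact: EfunDr.
by move=> p k; rewrite !rscale_restr; exact: Efun_rscale.
Qed.

Definition Emap m n : End := SEnd (Efun_klinear m n).

Lemma Efun_shift m n p (a : A) :
  Efun q m (rscale n a) p = Efun q m n (a *: p) :> M.
Proof.
elim/homog_ind: a => [a a' ha ha'|d a ha].
  by rewrite rscaleDr EfunDm scalerDl EfunDr ha ha'.
elim/homog_ind: p => [p p' hp hp'|b p hp].
  by rewrite EfunDr scalerDr EfunDr hp hp'.
elim/homog_ind: n => [n n' hn hn'|c n hn]; first by rewrite rscaleDl !EfunDm hn hn'.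
rewrite (Efun_homog _ (homog_rscale ha hn) hp) (Efun_homog _ hn (homogZ ha hp)).
rewrite qfM; congr (_ - _).
rewrite (scale_rscale ha hp) (rscale_homog ha hn) scaler_sign signZ_addb.
have -> : q m ((-1) ^+ (d && b) *: rscale p a) = (-1) ^+ (d && b) * (q m p * a).
  rewrite -qfZr; case: (d && b); rewrite ?expr1 ?scaleN1r ?mulN1r ?scale1r ?mul1r //.
  apply: (addrI (q m (rscale p a))); rewrite -qfDr !subrr.
  by apply: (addrI (q m 0)); rewrite -qfDr !addr0.
rewrite -scalerA signZ_addb scalerA.
by congr (_ *: _); congr (_ ^+ _); case: (b) (c) (d) => [] [] [].
Qed.

Lemma EmapDr m : {morph Emap m : n n' / n + n'}.
Proof. by move=> n n'; apply: sEnd_ext => p; exact: EfunDm. Qed.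

Lemma Emap_rscale m (n : restr M) (k : K) :
  Emap m (rscale n k : restr M) = rscale (Emap m n) k.
Proof.
apply: sEnd_ext => p; rewrite rscale_sEndE rscale_restr; exact: Efun_shift.
Qed.

Definition eosp : set End := zspan [set x | exists m n, x = Emap m n].

Record midalg := MidAlg {
  mid_set : set End;
  mid_subalgebra : subalgebra (@endbr _ _) mid_set;
  eosp_mid : eosp `<=` mid_set;
  mid_osp : mid_set `<=` osp q
}.

End EMaps.

Section MidType.
Variables (K : superComRingType) (A : superExtType K) (M : superLmodType A).
Variables (q : quadForm M) (E : midalg q).
Notation End := (sEnd (restr M)).

Definition midb : {pred End} := fun x => `[< mid_set E x >].

Record midtype := MidSub { mval :> End; mvalP : midb mval }.

HB.instance Definition _ := [isSub for mval].
HB.instance Definition _ := [Choice of midtype by <:].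

Let mid_submod : submod_closed midb.
Proof.
have [[E0 ED EZ _] _] := mid_subalgebra E.
split; first exact/asboolP.
by move=> k x y /asboolP Ex /asboolP Ey; apply/asboolP/ED => //; exact: EZ.
Qed.

HB.instance Definition _ := GRing.isSubmodClosed.Build K End midb mid_submod.
HB.instance Definition _ := [SubChoice_isSubLmodule of midtype by <:].

Lemma mvalE (x : midtype) : mid_set E x. Proof. by have /asboolP := mvalP x. Qed.

Definition toMid (x : End) (Ex : mid_set E x) : midtype := MidSub (asboolT Ex).

Let mpart a (x : midtype) : midtype :=
  toMid (let: And4 _ _ _ EP := proj1 (mid_subalgebra E) in EP a x (mvalE x)).

Let mpartD a : {morph mpart a : x y / x + y}.
Proof. by move=> x y; apply/val_inj/(@spartD End). Qed.
Let mpartK a b x : mpart a (mpart b x) = if a == b then mpart b x else 0.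
Proof. by apply/val_inj; rewrite /= spartK; case: eqP. Qed.
Let mpart_sum x : mpart false x + mpart true x = x.
Proof. exact/val_inj/(@spart_sum End). Qed.

HB.instance Definition _ := isSuper.Build midtype mpartD mpartK mpart_sum.

Lemma homog_mid a (x : midtype) : homog a x <-> homog a (x : End).
Proof. by split=> [/= {2}<-|/= hx] //; apply/val_inj. Qed.

Let mid_homogZ a b (k : K) (x : midtype) :
  homog a k -> homog b x -> homog (a (+) b) (k *: x).
Proof.
by move=> hk /homog_mid hx; apply/homog_mid; exact: (homogZ hk hx).
Qed.

HB.instance Definition _ := isSuperLmodule.Build K midtype mid_homogZ.

Lemma mval_rscale (x : midtype) (k : K) : mval (rscale x k) = rscale (mval x) k.
Proof.
elim/homog_ind: k => [k l hk hl|a k hk].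
  by rewrite !rscaleDr -hk -hl.
elim/homog_ind: x => [x y hx hy|b x hx].
  by rewrite rscaleDl [RHS]rscaleDl -hx -hy.
rewrite (rscale_homog hk hx).
by rewrite (rscale_homog hk (proj1 (homog_mid _ _) hx)).
Qed.

Definition midbr (x y : midtype) : midtype :=
  toMid (proj2 (mid_subalgebra E) x y (mvalE x) (mvalE y)).

Lemma Emap_mid (m n : M) : mid_set E (Emap q m n).
Proof. by apply: eosp_mid; apply: sub_gen_smallest; exists m, n. Qed.

Definition midE (m n : M) : midtype := toMid (Emap_mid m n).

Definition Einf : Type := (A * restr M * restr M * midtype)%type.

HB.instance Definition _ := SuperLmodule.copy Einf
  (A * restr M * restr M * midtype)%type.

Definition einf_br (u v : Einf) : Einf :=
  let: (a, m, n, x) := u in let: (a', m', n', x') := v in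
  (q m n' - q n m',
   a *: (m' : M) + x m' - rscale (m : M) a' - sapp x' m,
   - (a *: (n' : M)) + x n' + rscale (n : M) a' - sapp x' n,
   midE m n' + midE n m' + midbr x x').

Definition einf_mid (x : midtype) : Einf := (0, 0, 0, x).

End MidType.

Arguments Einf {K A M q} E.
Arguments einf_br {K A M q} E u v.

Section Derivations.
Variables (K : superComRingType) (A : superExtType K) (M : superLmodType A).
Variables (q : quadForm M) (E : midalg q).
Notation End := (sEnd (restr M)).

Lemma addr4ACA (V : zmodType) (a b c d a' b' c' d' : V) :
  a + a' + (b + b') + (c + c') + (d + d') = a + b + c + d + (a' + b' + c' + d').
Proof. by rewrite [RHS]addrACA [a + b + c + _]addrACA [a + b + _]addrACA. Qed.

Lemma einf_brDr (u : Einf E) : {morph einf_br E u : v w / v + w}.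
Proof.
move: u => [[[a m] n] x] [[[a1 m1] n1] x1] [[[a2 m2] n2] x2].
congr (_, _, _, _).
- by rewrite /= !qfDr opprD addrACA.
- rewrite /= (@scalerDr A M) (sEndD x) rscaleDr sappDl !opprD.
  exact: addr4ACA.
- rewrite /= (@scalerDr A M) (sEndD x) rscaleDr sappDl !opprD.
  exact: addr4ACA.
apply: val_inj => /=.
change (Emap q m (n1 + n2) + Emap q n (m1 + m2) + endbr (mval x) (mval x1 + mval x2) =
  (Emap q m n1 + Emap q n m1 + endbr (mval x) (mval x1)) +
  (Emap q m n2 + Emap q n m2 + endbr (mval x) (mval x2))).
rewrite !EmapDr /endbr scommDr.
by rewrite [X in X + _]addrACA [RHS]addrACA.
Qed.

Lemma einf_br_rscale (u v : Einf E) (k : K) :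
  einf_br E u (rscale v k) = rscale (einf_br E u v) k.
Proof.
move: u v => [[[a m] n] x] [[[a1 m1] n1] x1].
rewrite [RHS](@rscale_pair K (A * restr M * restr M)%type (midtype E)).
rewrite (@rscale_pair K (A * restr M)%type (restr M)) (@rscale_pair K A (restr M)).
rewrite [rscale (a1, m1, n1, x1) k](@rscale_pair K (A * restr M * restr M)%type (midtype E)).
rewrite (@rscale_pair K (A * restr M)%type (restr M)) (@rscale_pair K A (restr M)).
rewrite /=; congr (_, _, _, _).
- by rewrite rscale_ext !rscale_restr !qfZr mulrBl.
- rewrite mval_rscale sapp_rscale sEnd_rscale.
  rewrite !rscaleDl !rscaleNl; congr (_ + _ - _ - _).
    by rewrite !rscale_restr (@scale_rscaleA A M).
  by rewrite rscale_ext rscale_restr (@rscaleA A M).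
- rewrite mval_rscale sapp_rscale sEnd_rscale.
  rewrite !rscaleDl !rscaleNl; congr (- _ + _ + _ - _).
    by rewrite !rscale_restr (@scale_rscaleA A M).
  by rewrite rscale_ext rscale_restr (@rscaleA A M).
apply: val_inj; rewrite [RHS]mval_rscale.
change (Emap q m (rscale n1 k) + Emap q n (rscale m1 k) +
  endbr (mval x) (mval (rscale x1 k)) = 
  rscale (Emap q m n1 + Emap q n m1 + endbr (mval x) (mval x1)) k).
by rewrite mval_rscale !rscaleDl !Emap_rscale /endbr scomm_rscale.
Qed.

Lemma einf_br_klinear (u : Einf E) : klinearb (einf_br E u).
Proof.
by apply/asboolP; split; [exact: einf_brDr | exact: einf_br_rscale].
Qed.

Definition ad (u : Einf E) : sEnd (Einf E) := SEnd (einf_br_klinear u).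

Definition SE : set End :=
  zspan [set S : End | exists2 c, homog c S &
    [/\ forall a, exists b, endbr S (aId M a) = aId M b,
        forall a b (m n : M), homog a m -> homog b n ->
          endbr S (aId M (q m n)) =
          aId M (q (S m) n + (-1) ^+ (a && b) * q (S n) m)
      & forall x, mid_set E x -> mid_set E (endbr S x)]].

Definition TE : set End :=
  zspan [set T : End | exists2 c, homog c T &
    [/\ forall a, mid_set E (endbr T (aId M a)),
        forall a b (m n : M), homog a m -> homog b n ->
          endbr T (aId M (q m n)) =
          Emap q (T m) n + (-1) ^+ (a && b) *: Emap q (T n) m
      & forall x, mid_set E x -> exists b, endbr T x = aId M b]].

(* Coordinates of d_{S,T}: the elements of A and of E that [S, a Id] + [T, x]
   and [T, a Id] + [S, x] are identified with; see dST_E. *)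
Definition unId (f : End) : A := xget 0 [set b | aId M b = f].
Definition unMid (f : End) : midtype E := insubd 0 f.

Definition dST_fun (S T : End) (u : Einf E) : Einf E :=
  let: (a, m, n, x) := u in
  (unId (endbr S (aId M a) + endbr T (mval x)), (S + T) m, (S - T) n,
   unMid (endbr T (aId M a) + endbr S (mval x))).

End Derivations.

(* f as an element of End_K V; used only for f that are K-linear *)
Definition toEnd (K : superComRingType) (V : superLmodType K) (f : V -> V) :
  sEnd V := insubd 0 f.

Lemma toEndE (K : superComRingType) (V : superLmodType K) (f : V -> V) :
  klinearb f -> toEnd f = f :> (V -> V).
Proof. by move=> kf; rewrite /toEnd insubdK. Qed.

Arguments ad {K A M q} E u.

Section DST.
Variables (K : superComRingType) (A : superExtType K) (M : superLmodType A).
Variables (q : quadForm M) (E : midalg q).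
Notation End := (sEnd (restr M)).

Definition dST (S T : End) : sEnd (Einf E) := toEnd (@dST_fun K A M q E S T).

Definition DE : set (sEnd (Einf E)) := [set dST S T | S in SE E & T in TE E].

Definition d0 (P : set End) : set (sEnd (Einf E)) := [set dST S 0 | S in P].

Lemma aId_inj : (forall a : A, (forall m : M, a *: m = 0) -> a = 0) ->
  injective (aId M).
Proof.
move=> faith a b ab; apply/eqP; rewrite -subr_eq0; apply/eqP/faith => m.
have abm : a *: m = b *: m := congr1 (fun f : End => f m) ab.
by rewrite scalerBl abm subrr.
Qed.

Lemma aIdD (a b : A) : aId M (a + b) = aId M a + aId M b.
Proof. by apply: sEnd_ext => m; exact: (@scalerDl A M). Qed.

Lemma aIdN (a : A) : aId M (- a) = - aId M a.
Proof. by apply: sEnd_ext => m; exact: (@scaleNr A M). Qed.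

Lemma aId_rscale (a : A) (k : K) : aId M (rscale a k) = rscale (aId M a) k.
Proof.
apply: sEnd_ext => m; rewrite rscale_sEndE !aIdE rscale_ext.
by rewrite -scalerA.
Qed.

Lemma zspan_ind (V : zmodType) (G P : set V) : P 0 ->
  (forall x y, P x -> P y -> P (x - y)) -> G `<=` P -> zspan G `<=` P.
Proof. by move=> P0 PB GP; apply: smallest_sub. Qed.

Lemma endbrBl (S T x : End) : endbr (S - T) x = endbr S x - endbr T x.
Proof.
rewrite /endbr scommDl; congr (_ + _); apply: (addrI (scomm T x)).
rewrite -scommDl !subrr; apply: (addrI (scomm 0 x)).
by rewrite -scommDl !addr0.
Qed.

Lemma endbrDr (S x y : End) : endbr S (x + y) = endbr S x + endbr S y.
Proof. exact: scommDr. Qed.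

Lemma endbr_rscale (S x : End) (k : K) : endbr S (rscale x k) = rscale (endbr S x) k.
Proof. exact: scomm_rscale. Qed.

Lemma SE_E (S : End) : SE E S ->
  (forall a, exists b, endbr S (aId M a) = aId M b) /\
  (forall x, mid_set E x -> mid_set E (endbr S x)).
Proof.
have [[E0 ED EZ _] _] := mid_subalgebra E.
have endbr0l x : endbr (0 : End) x = 0 by rewrite -[X in endbr X _](subrr 0) endbrBl subrr.
move: S; apply: zspan_ind => [|S T [S1 S3] [T1 T3]|S [c _ [S1 _ S3]]] //.
  split=> [a|x Ex]; rewrite endbr0l //.
  by exists 0; apply: sEnd_ext => m; rewrite aIdE (@scale0r A M).
split=> [a|x Ex]; rewrite endbrBl.
  by have [b ->] := S1 a; have [b' ->] := T1 a; exists (b - b'); rewrite aIdD aIdN.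
by apply: ED; [exact: S3|rewrite -scaleN1r; apply: EZ; exact: T3].
Qed.

Lemma TE_E (T : End) : TE E T ->
  (forall a, mid_set E (endbr T (aId M a))) /\
  (forall x, mid_set E x -> exists b, endbr T x = aId M b).
Proof.
have [[E0 ED EZ _] _] := mid_subalgebra E.
have endbr0l x : endbr (0 : End) x = 0 by rewrite -[X in endbr X _](subrr 0) endbrBl subrr.
move: T; apply: zspan_ind => [|S T [S1 S3] [T1 T3]|S [c _ [S1 _ S3]]] //.
  split=> [a|x Ex]; rewrite endbr0l //.
  by exists 0; apply: sEnd_ext => m; rewrite aIdE (@scale0r A M).
split=> [a|x Ex]; rewrite endbrBl; last first.
  by have [b ->] := S3 x Ex; have [b' ->] := T3 x Ex; exists (b - b'); rewrite aIdD aIdN.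
by apply: ED; [exact: S1|rewrite -scaleN1r; apply: EZ; exact: T1].
Qed.

Lemma unMidE (f : End) : mid_set E f -> mval (unMid E f) = f.
Proof. by move=> Ef; rewrite /unMid insubdK //; exact/asboolP. Qed.

Lemma unIdE (f : End) : (exists b, f = aId M b) -> aId M (unId f) = f.
Proof. by move=> [b fb]; apply: (@xgetI _ 0 [set b | aId M b = f] b). Qed.

Lemma dST_funE (S T : End) (a : A) (m n : restr M) (x : midtype E) :
  SE E S -> TE E T ->
  let: (a', m', n', x') := dST_fun S T (a, m, n, x) : Einf E in
  [/\ aId M a' = endbr S (aId M a) + endbr T (mval x), m' = S m + T m,
      n' = S n - T n & mval x' = endbr T (aId M a) + endbr S (mval x)].
Proof.
have [[_ ED _ _] _] := mid_subalgebra E.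
move=> /SE_E[S1 S3] /TE_E[T1 T3]; split=> //.
  apply: unIdE; have [b ->] := S1 a; have [b' ->] := T3 _ (mvalE x).
  by exists (b + b'); rewrite aIdD.
by apply: unMidE; apply: ED; [exact: T1 | apply/S3/mvalE].
Qed.

Hypothesis faithful : forall a : A, (forall m : M, a *: m = 0) -> a = 0.

Lemma dST_klinear (S T : End) : SE E S -> TE E T ->
  klinearb (dST_fun S T : Einf E -> Einf E).
Proof.
move=> hS hT; apply/asboolP; split.
  move=> [[[a m] n] x] [[[a1 m1] n1] x1].
  have [e1 _ _ e4] := dST_funE a m n x hS hT.
  have [f1 _ _ f4] := dST_funE a1 m1 n1 x1 hS hT.
  have [g1 _ _ g4] := dST_funE (a + a1) (m + m1) (n + n1) (x + x1) hS hT.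
  congr (_, _, _, _); [|exact: sEndD|exact: sEndD|].
    apply: (aId_inj faithful); rewrite g1 [RHS]aIdD e1 f1 aIdD.
    by rewrite endbrDr (endbrDr T x x1) addrACA.
  apply: val_inj; rewrite [LHS]g4 aIdD endbrDr (endbrDr S x x1).
  by rewrite addrACA -e4 -f4.
move=> [[[a m] n] x] k.
have rE (u : Einf E) : rscale u k =
    (rscale u.1.1.1 k, rscale u.1.1.2 k, rscale u.1.2 k, rscale u.2 k).
  rewrite [LHS](@rscale_pair K (A * restr M * restr M)%type (midtype E)).
  by rewrite (@rscale_pair K (A * restr M)%type (restr M)) (@rscale_pair K A (restr M)).
rewrite !rE.
have [e1 _ _ e4] := dST_funE a m n x hS hT.
have [g1 _ _ g4] :=
  dST_funE (rscale a k) (rscale m k) (rscale n k) (rscale x k) hS hT.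
congr (_, _, _, _); [|exact: sEnd_rscale|exact: sEnd_rscale|].
  apply: (aId_inj faithful); rewrite g1 [RHS]aId_rscale e1.
  by rewrite aId_rscale mval_rscale !endbr_rscale rscaleDl.
apply: val_inj; rewrite [LHS]g4 [RHS]mval_rscale e4.
by rewrite aId_rscale mval_rscale !endbr_rscale rscaleDl.
Qed.

Lemma dST_E (S T : End) (a : A) (m n : restr M) (x : midtype E) :
  SE E S -> TE E T ->
  let: (a', m', n', x') := dST S T (a, m, n, x) : Einf E in
  [/\ aId M a' = endbr S (aId M a) + endbr T (mval x), m' = S m + T m,
      n' = S n - T n & mval x' = endbr T (aId M a) + endbr S (mval x)].
Proof.
by move=> hS hT; rewrite /dST (toEndE (dST_klinear hS hT)); exact: dST_funE.
Qed.

End DST.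

Arguments DE {K A M q} E.
Arguments d0 {K A M q} E P.

Section Extension.
Variables (K : superComRingType) (A : superExtType K) (N R : superLmodType A).
Variables (I J : choiceType) (n : I -> N) (r : J -> R) (qN : quadForm N).

(* q(n_i, n_i_) *)
Definition diag_entry (i : I) : A := qN (n i) (n (partner n qN i)).

(* rinv 2 is the element 1/2 *)
Definition ext_fun (D : sEnd A) (u : restr (N * R)%type) : restr (N * R)%type :=
  (\sum_(i \in [set: I])
     (rinv (2%:R : A) * D (diag_entry i) * rinv (diag_entry i) * coord n u.1 i
      + D (coord n u.1 i)) *: n i,
   \sum_(j \in [set: J]) D (coord r u.2 j) *: r j).

(* Delta_M, for M = N (+) R; it is ext_fun D by extE *)
Definition ext (D : sEnd A) : sEnd (restr (N * R)%type) := toEnd (ext_fun D).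

Definition DerM : set (sEnd (restr (N * R)%type)) :=
  [set ext D | D in Der (V := A) *%R].

Definition EndAR : set (sEnd (restr (N * R)%type)) :=
  [set S | exists f : sEnd (restr R),
     Alinear f /\ forall u : N * R, S u = (0, f u.2)].

End Extension.

Arguments EndAR {K A} N R.

Section Coordinates.
Variables (K : superComRingType) (A : superExtType K) (M : superLmodType A).
Variables (I : choiceType) (b : I -> M).

Lemma fsum_fset (V : zmodType) (a : I -> A) (F : I -> V) :
    finite_set [set i | a i != 0] ->
    (forall i, a i = 0 -> F i = 0) ->
  \sum_(i \in [set: I]) F i =
  \sum_(i <- fset_set [set i | a i != 0]) F i.
Proof.
move=> fa Fa; apply: fsbigTE => i; rewrite in_fset_set // => ni.
apply: Fa; apply/eqP; apply: contraNT ni => ai.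
by rewrite in_setE.
Qed.

Lemma fsum_coordD (F : I -> A -> M) (a a' : I -> A) :
    finite_set [set i | a i != 0] -> finite_set [set i | a' i != 0] ->
    (forall i, {morph F i : x y / x + y}) ->
  finite_set [set i | a i + a' i != 0] /\
  \sum_(i \in [set: I]) F i (a i + a' i) =
  \sum_(i \in [set: I]) F i (a i) + \sum_(i \in [set: I]) F i (a' i).
Proof.
move=> fa fa' FD.
have F0 i : F i 0 = 0 by apply: (addrI (F i 0)); rewrite -FD !addr0.
have sub : [set i | a i + a' i != 0] `<=` [set i | a i != 0] `|` [set i | a' i != 0].
  move=> i /= h; case: (eqVneq (a i) 0) => [ai|]; [right|by left].
  by move: h; rewrite ai add0r.
have fU : finite_set ([set i | a i != 0] `|` [set i | a' i != 0]) by rewrite finite_setU.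
split; first exact: sub_finite_set fU.
have S (G : I -> M) : (forall i, a i = 0 -> a' i = 0 -> G i = 0) ->
    \sum_(i \in [set: I]) G i =
    \sum_(i <- fset_set ([set i | a i != 0] `|` [set i | a' i != 0])) G i.
  move=> G0; apply: fsbigTE => i; rewrite in_fset_set // => ni.
  by apply: G0; apply/eqP; apply: contraNT ni => h; rewrite in_setE; [left|right].
rewrite !S => [|i ai a'i|i ai a'i|i ai a'i]; rewrite ?ai ?a'i ?addr0 ?F0 //.
by rewrite -big_split; apply: eq_bigr => i _; exact: FD.
Qed.

Lemma fsum_morph (f : M -> M) (F : I -> M) (a : I -> A) :
    finite_set [set i | a i != 0] -> (forall i, a i = 0 -> F i = 0) ->
    {morph f : x y / x + y} ->
  f (\sum_(i \in [set: I]) F i) = \sum_(i \in [set: I]) f (F i).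
Proof.
move=> fa Fa fD; have f0 : f 0 = 0 by apply: (addrI (f 0)); rewrite -fD !addr0.
have fFa i : a i = 0 -> f (F i) = 0 by move=> /Fa ->.
rewrite (fsum_fset fa Fa) (fsum_fset fa fFa).
exact: (big_morph f fD f0).
Qed.

Hypothesis hb : homog_basis b.

Lemma coordP m : is_coord b m (coord b m).
Proof. by apply: xgetPex; have [a [ha _]] := hb.2 m; exists a. Qed.

Lemma coord_unique m a : is_coord b m a -> coord b m = a.
Proof.
by move=> ha; have [c [_ hc]] := hb.2 m; rewrite -(hc _ ha) -(hc _ (coordP m)).
Qed.

Lemma coordD m m' : coord b (m + m') = fun i => coord b m i + coord b m' i.
Proof.
have [[f1 e1] [f2 e2]] := (coordP m, coordP m').
have FD i : {morph (fun x : A => x *: b i) : x y / x + y}.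
  by move=> x y; exact: scalerDl.
have [f s] := fsum_coordD f1 f2 FD.
by apply: coord_unique; split=> //; rewrite s -e1 -e2.
Qed.

Lemma basis_degree : exists c : I -> bool, forall i, homog (c i) (b i).
Proof. by have [c hc] := choice hb.1; exists c. Qed.

Lemma coord_rscale c (d : bool) m (k : A) : (forall i, homog (c i) (b i)) ->
  homog d k ->
  coord b (rscale m k) = fun i => (-1) ^+ (d && c i) * (coord b m i * k).
Proof.
move=> hc hk; have [f e] := coordP m; apply: coord_unique; split.
  apply: sub_finite_set f => i /=; apply: contraNN => /eqP ->.
  by rewrite mul0r mulr0.
rewrite {1}e (fsum_morph (f := fun x => rscale x k) f); last 2 first.
- by move=> i ->; rewrite scale0r.
- exact: rscaleDl.
apply: eq_fsbigr => i _.
by rewrite -scale_rscaleA (rscale_homog hk (hc i)) scaler_sign -!scalerA.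
Qed.

Lemma ext_sum_klinear (w : I -> A) (D : sEnd A) :
  klinearb (fun m : restr M =>
    (\sum_(i \in [set: I]) (w i * coord b m i + D (coord b m i)) *: b i : restr M)).
Proof.
pose F i (x : A) : M := (w i * x + D x) *: b i.
have FD i : {morph F i : x y / x + y}.
  by move=> x y; rewrite /F mulrDr sEndD addrACA; exact: scalerDl.
have F0 i x : x = 0 -> F i x = 0.
  by move=> ->; apply: (addrI (F i 0)); rewrite -FD !addr0.
have D1 : {morph (fun m : M => \sum_(i \in [set: I]) F i (coord b m i)) :
    x y / x + y}.
  move=> m m'; rewrite coordD.
  by have [_ ->] := fsum_coordD (coordP m).1 (coordP m').1 FD.
apply/asboolP; split=> [m m'|m k]; first exact: D1.
elim/homog_ind: k => [k l hk hl|d k hk].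
  rewrite !rscaleDr [LHS]D1; congr (_ + _); [exact: hk|exact: hl].
have [c hc] := basis_degree.
rewrite !rscale_restr (coord_rscale m hc (homog_in_alg A hk)).
rewrite (fsum_morph (f := fun x => rscale x (k%:A : A)) (coordP m).1); last 2 first.
- by move=> i; exact: F0.
- exact: rscaleDl.
apply: eq_fsbigr => i _.
rewrite -scale_rscaleA (rscale_homog (homog_in_alg A hk) (hc i)).
rewrite scaler_sign scalerA.
have -> : D ((-1) ^+ (d && c i) * (coord b m i * k%:A)) =
    (-1) ^+ (d && c i) * (D (coord b m i) * k%:A).
  rewrite -!rscale_ext -sEnd_rscale.
  by case: (d && c i); rewrite ?expr1 ?mulN1r ?mul1r // sEndN.
have -> : w i * ((-1) ^+ (d && c i) * (coord b m i * k%:A)) =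
    (-1) ^+ (d && c i) * (w i * coord b m i * k%:A).
  by case: (d && c i); rewrite ?expr1 ?mulN1r ?mul1r ?mulrN mulrA.
by rewrite -mulrDr -mulrDl -scalerA.
Qed.

End Coordinates.

Lemma extE (K : superComRingType) (A : superExtType K) (N R : superLmodType A)
    (I J : choiceType) (n : I -> N) (r : J -> R) (qN : quadForm N) (D : sEnd A) :
  homog_basis n -> homog_basis r ->
  ext n r qN D = ext_fun n r qN D :> (restr (N * R)%type -> restr (N * R)%type).
Proof.
move=> hn hr; apply: toEndE; apply/asboolP.
have /asboolP[D1 Z1] := ext_sum_klinear hn
  (fun i => rinv (2%:R : A) * D (diag_entry n qN i) * rinv (diag_entry n qN i)) D.
have /asboolP[D2 Z2] := ext_sum_klinear hr (fun=> 0) D.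
have e2 (x : R) : \sum_(j \in [set: J]) D (coord r x j) *: r j =
    \sum_(j \in [set: J]) (0 * coord r x j + D (coord r x j)) *: r j.
  by apply: eq_fsbigr => j _; rewrite mul0r add0r.
split=> [u v|u k]; rewrite /ext_fun !e2.
  by congr pair; [exact: D1|exact: D2].
rewrite rscale_restr !rscale_pair rscale_restr rscale_pair.
by congr pair; rewrite -!rscale_restr; [exact: Z1|exact: Z2].
Qed.

(* The set of all sums of summable families of elements of X *)
Definition sum_closure (K : superComRingType) (V : superLmodType K)
    (X : set (sEnd V)) : set (sEnd V) :=
  [set y | exists (I : choiceType) (x : I -> sEnd V),
    [/\ forall i, X (x i), forall v, finite_set [set i | x i v != 0]
      & forall v, y v = \sum_(i \in [set: I]) x i v]].

(* Main.v *)
Require Import Defs.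
From mathcomp Require Import all_boot all_order all_algebra.
From mathcomp Require Import finmap all_classical.

Set Implicit Arguments.
Unset Strict Implicit.
Unset Printing Implicit Defensive.

Import GRing.Theory.
Local Open Scope classical_set_scope.
Local Open Scope ring_scope.

(** An element of E_infinity is a quadruple (a, m, n, x).  Together A and E act
    on the two copies of M, by P = a + x and by Q = x - a, and the Jacobi
    identity amounts to the symmetry of the triple product
    q(m,n) + E_{m,n} in its outer arguments, and to the invariance of q and of
    the E_{m,n} ([einf_jacobi]).

    The element 1 of A acts as 0 on A (+) E, as 1 on the first copy of M and as
    -1 on the second.  After subtracting an inner derivation from a derivation
    d, the image of 1 lies in A (+) E, and comparing components of
    d [1, y] = [d 1, y] + [1, d y] shows that d 1 = 0 and that d preserves the
    grading.  Let U and V be the restrictions of d to the copies of M, and let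
    S = (U + V)/2, T = (U - V)/2.  Evaluating d on the brackets gives
    d = d_{S,T}, where S satisfies the conditions defining S_E, and where T maps
    E into A and A into E by commutation ([graded_der_ST]).  Such a T is a
    multiplication by an element of A: let e, e' be the basis vectors of the
    summand of rank 2 and g a third one.  The operator [T, E_{e,g}] is a scalar,
    and it maps e' into the span of e and g, so it is 0; applied to e, and with
    the roles of e and e' exchanged, this shows that T multiplies g by the
    coordinate of T e on e and by that of T e' on e'.  With E_{e,e'} in place of
    E_{e,g} it follows that e and e' are multiplied by the same scalar.  Finally
    [T, a E_{e,g}] = [T, a] E_{e,g} is a scalar that vanishes on e', which yields
    [T, a] = 0 ([T_scalar]).  Multiplications are inner, so d is the sum of an
    inner derivation and of some d_{S,0} ([Der_setsum]).

    An S in S_E induces a derivation Delta of A, and Delta_M is built so that it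
    is a derivation of q inducing the same Delta: its weights w solve
    Delta u = 2 w u for the entries u of the Gram matrix ([ext_q]).  The
    difference S - Delta_M is A-linear and therefore in osp(q) ([SE_char]).  An
    inner d_{S,0} has S in E, as one sees at 1 and at the copies of M
    ([ad_dS]); so complements of E in S_E yield complements of the inner
    derivations ([semidirect_Der]).

    For the three special algebras, osp(q) is first split into End_A R and the
    operators killing the radical R ([osp_split]).  An operator S of the second
    kind is the sum of the summable family of the E_{m_i, n_i'}, where n_i' is
    dual to the basis vector n_i of N and m_i is S n_i with its component in N
    halved ([osp_trunc]).  Hence it is in eosp(q) in finite rank, in the closure
    of eosp(q) always, and, as a truncation suffices on finitely many vectors,
    d_{S,0} is locally inner if E = eosp(q) ([osp_N_locally_inner]). *)

(** * Signs and identities in abelian groups *)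

(** Koszul signs, for elements of any abelian group: one notation for the
    factors [(-1) ^+ e] of all the rings and modules below, which [zmod] can
    interpret. *)
Definition sgn (V : zmodType) (e : bool) (v : V) : V := if e then - v else v.

(** Expressions in an abelian group.  Two of them have the same value as soon
    as every variable occurs in both equally often, counted with signs; this
    disposes of the sign computations below, once the identity has been
    expanded into additive form. *)
Inductive zexp :=
  Zzero | Zvar of nat | Zadd of zexp & zexp | Zopp of zexp | Zsgn of bool & zexp.

Fixpoint zeval (V : zmodType) (env : seq V) (e : zexp) : V :=
  match e with
  | Zzero => 0
  | Zvar i => nth 0 env i
  | Zadd e f => zeval env e + zeval env f
  | Zopp e => - zeval env e
  | Zsgn b e => sgn b (zeval env e)
  end.

Fixpoint zcount (s : bool) (e : zexp) (i : nat) : nat :=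
  match e with
  | Zzero => 0%N
  | Zvar j => if s then 0%N else (i == j : nat)
  | Zadd e f => (zcount s e i + zcount s f i)%N
  | Zopp e => zcount (~~ s) e i
  | Zsgn b e => zcount (b (+) s) e i
  end.

Fixpoint zwf (n : nat) (e : zexp) : bool :=
  match e with
  | Zzero => true
  | Zvar j => (j < n)%N
  | Zadd e f => zwf n e && zwf n f
  | Zopp e => zwf n e
  | Zsgn b e => zwf n e
  end.

Lemma zevalE (V : zmodType) (env : seq V) (e : zexp) : zwf (size env) e ->
  zeval env e = \sum_(i < size env)
    (nth 0 env i *+ zcount false e i - nth 0 env i *+ zcount true e i).
Proof.
have flip f : \sum_(i < size env)
    (nth 0 env i *+ zcount true f i - nth 0 env i *+ zcount false f i) =
    - \sum_(i < size env)
    (nth 0 env i *+ zcount false f i - nth 0 env i *+ zcount true f i).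
  by rewrite -sumrN; apply: eq_bigr => i _; rewrite opprB.
elim: e => [|j|e IHe f IHf|e IHe|[] e IHe] /=.
- by rewrite big1 // => i _; rewrite subrr.
- move=> jn; rewrite (bigD1 (Ordinal jn)) //= eqxx big1 ?addr0 ?subr0 // => i ij.
  by rewrite mulr0n subr0 (negPf (_ : (i : nat) != j)).
- move=> /andP[/IHe -> /IHf ->]; rewrite -big_split; apply: eq_bigr => i _ /=.
  by rewrite !mulrnDr opprD addrACA.
- by move=> /IHe ->; rewrite flip.
- by move=> /IHe ->; rewrite flip.
- by move=> /IHe ->.
Qed.

Lemma zevalP (V : zmodType) (env : seq V) (e f : zexp) :
  (let n := size env in
   [&& zwf n e, zwf n f & all (fun i => zcount false e i + zcount true f i ==
     zcount false f i + zcount true e i)%N (iota 0 n)]) ->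
  zeval env e = zeval env f.
Proof.
case/and3P=> we wf /allP ef; rewrite !zevalE //; apply: eq_bigr => i _.
have /eqP efi : (zcount false e i + zcount true f i ==
  zcount false f i + zcount true e i)%N.
  by apply: ef; rewrite mem_iota add0n ltn_ord.
apply/eqP; rewrite subr_eq addrAC -mulrnDr -efi mulrnDr addrK //.
Qed.

(* Atoms are compared up to conversion, since the same operation may occur
   through different instances. *)
Ltac zmod_mem x env :=
  match env with
  | cons ?y ?env' => match constr:(Set) with
      | _ => let _ := match constr:(Set) with _ => unify x y end in constr:(true)
      | _ => zmod_mem x env' end
  | _ => constr:(false)
  end.
Ltac zmod_idx x env :=
  match env with
  | cons ?y ?env' => match constr:(Set) with
      | _ => let _ := match constr:(Set) with _ => unify x y end in constr:(0%N)
      | _ => let i := zmod_idx x env' in constr:(i.+1) end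
  end.
Ltac zmod_env t env :=
  match t with
  | @GRing.add _ ?x ?y => let env := zmod_env x env in zmod_env y env
  | @GRing.opp _ ?x => zmod_env x env
  | @GRing.zero _ => env
  | @sgn _ _ ?x => zmod_env x env
  | _ => match zmod_mem t env with
         | true => env
         | false => constr:(cons t env) end
  end.
Ltac zmod_quote t env :=
  match t with
  | @GRing.add _ ?x ?y =>
      let e := zmod_quote x env in let f := zmod_quote y env in constr:(Zadd e f)
  | @GRing.opp _ ?x => let e := zmod_quote x env in constr:(Zopp e)
  | @GRing.zero _ => constr:(Zzero)
  | @sgn _ ?b ?x => let e := zmod_quote x env in constr:(Zsgn b e)
  | _ => let i := zmod_idx t env in constr:(Zvar i)
  end.
(* Boolean variables in the signs are settled by cases, after the two sides
   have been quoted. *)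
Ltac zmod :=
  match goal with |- @eq ?T ?x ?y =>
    let env := zmod_env x (@nil T) in
    let env := zmod_env y env in
    let e := zmod_quote x env in
    let f := zmod_quote y env in
    apply: (@zevalP _ env e f)
  end;
  repeat (match goal with |- context [Zsgn ?e _] =>
    match e with context [?b] => is_var b;
      match type of b with bool => case: (b) end end end);
  vm_compute; (reflexivity || fail 1 "not an identity of abelian groups").

Section Signs.
Variable V : zmodType.
Implicit Types (e f : bool) (v : V).

Lemma sgn0 e : sgn e 0 = 0 :> V. Proof. by case: e; rewrite /= ?oppr0. Qed.
Lemma sgnD e : {morph @sgn V e : u v / u + v}.
Proof. by case: e => u v //=; rewrite /sgn opprD. Qed.
Lemma sgnN e : {morph @sgn V e : v / - v}. Proof. by case: e. Qed.
Lemma sgn_sgn e f v : sgn e (sgn f v) = sgn (e (+) f) v.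
Proof. by case: e f => [] [] //=; rewrite /sgn opprK. Qed.
Lemma sgnK e : involutive (@sgn V e).
Proof. by move=> v; rewrite sgn_sgn addbb. Qed.
Lemma sgn_morph (W : zmodType) (f : V -> W) e v :
  {morph f : x y / x + y} -> f (sgn e v) = sgn e (f v).
Proof.
move=> fD; have f0 : f 0 = 0 by apply: (addrI (f 0)); rewrite -fD !addr0.
by case: e => //=; apply: (addrI (f v)); rewrite -fD !subrr f0.
Qed.
End Signs.

Lemma sgnZE (R : pzRingType) (V : lmodType R) (e : bool) (v : V) : (-1) ^+ e *: v = sgn e v.
Proof. by case: e; rewrite ?scale1r // expr1 scaleN1r. Qed.
Lemma sgnME (R : pzRingType) (e : bool) (x : R) : (-1) ^+ e * x = sgn e x.
Proof. by case: e; rewrite ?mul1r // expr1 mulN1r. Qed.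
Lemma sgnMl (R : pzRingType) e (x y : R) : sgn e x * y = sgn e (x * y).
Proof. by case: e; rewrite /= ?mulNr. Qed.
Lemma sgnMr (R : pzRingType) e (x y : R) : x * sgn e y = sgn e (x * y).
Proof. by case: e; rewrite /= ?mulrN. Qed.
Lemma sgn_scale (R : pzRingType) (V : lmodType R) e (k : R) (v : V) :
  k *: sgn e v = sgn e (k *: v).
Proof. by case: e; rewrite /= ?scalerN. Qed.
Lemma homog_sgn (V : superZmodType) a e (v : V) : homog a v -> homog a (sgn e v).
Proof. by case: e => //; exact: homogN. Qed.
Lemma spart_sgn (V : superZmodType) a e (v : V) : spart a (sgn e v) = sgn e (spart a v).
Proof. by apply: sgn_morph; exact: spartD. Qed.

Lemma homogB (V : superZmodType) a (u v : V) : homog a u -> homog a v -> homog a (u - v).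
Proof. by move=> hu hv; apply: homogD => //; exact: homogN. Qed.

(** * The supercommutator *)

Section SuperRings.
Variable R : superRingType.
Implicit Types x y z : R.

Lemma scommE a b x y : homog a x -> homog b y ->
  scomm x y = x * y - sgn (a && b) (y * x).
Proof. by move=> hx hy; rewrite (scomm_homog hx hy) sgnME. Qed.

Lemma scomm0l x : scomm 0 x = 0.
Proof. by apply: (addrI (scomm 0 x)); rewrite -scommDl !addr0. Qed.
Lemma scomm0r x : scomm x 0 = 0.
Proof. by apply: (addrI (scomm x 0)); rewrite -scommDr !addr0. Qed.
Lemma scommNl x y : scomm (- x) y = - scomm x y.
Proof. by apply: (addrI (scomm x y)); rewrite -scommDl !subrr scomm0l. Qed.
Lemma scommNr x y : scomm x (- y) = - scomm x y.
Proof. by apply: (addrI (scomm x y)); rewrite -scommDr !subrr scomm0r. Qed.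
Lemma scommBl x y z : scomm (x - y) z = scomm x z - scomm y z.
Proof. by rewrite scommDl scommNl. Qed.
Lemma scommBr x y z : scomm z (x - y) = scomm z x - scomm z y.
Proof. by rewrite scommDr scommNr. Qed.
Lemma scomm_sgnl e x y : scomm (sgn e x) y = sgn e (scomm x y).
Proof. exact: (sgn_morph e x (scommDl y)). Qed.
Lemma scomm_sgnr e x y : scomm x (sgn e y) = sgn e (scomm x y).
Proof. exact: (sgn_morph e y (scommDr x)). Qed.

Lemma homog_scomm a b x y : homog a x -> homog b y -> homog (a (+) b) (scomm x y).
Proof.
move=> hx hy; rewrite (scommE hx hy); apply: homogB; first exact: homogM.
by apply: homog_sgn; rewrite addbC; exact: homogM.
Qed.

Lemma scommC a b x y : homog a x -> homog b y ->
  scomm x y = - sgn (a && b) (scomm y x).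
Proof.
move=> hx hy; rewrite (scommE hx hy) (scommE hy hx).
by case: (a) (b) => [] []; zmod.
Qed.

Lemma scomm_jacobi a b x y z : homog a x -> homog b y ->
  scomm x (scomm y z) = scomm (scomm x y) z + sgn (a && b) (scomm y (scomm x z)).
Proof.
move=> hx hy; elim/homog_ind: z => [z z' hz hz'|c z hz].
  by rewrite !scommDr hz hz' sgnD addrACA.
rewrite (scommE hx (homog_scomm hy hz)) (scommE (homog_scomm hx hy) hz).
rewrite (scommE hy (homog_scomm hx hz)) (scommE hx hy) (scommE hx hz) (scommE hy hz).
rewrite !(mulrDl, mulrDr, mulrN, mulNr, sgnMl, sgnMr, mulrA).
by case: (a) (b) (c) => [] [] [] /=; zmod.
Qed.

Lemma scommMr a b x y z : homog a x -> homog b y ->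
  scomm x (y * z) = scomm x y * z + sgn (a && b) (y * scomm x z).
Proof.
move=> hx hy; elim/homog_ind: z => [z z' hz hz'|c z hz].
  by rewrite !(mulrDr, scommDr) hz hz' sgnD; zmod.
rewrite (scommE hx (homogM hy hz)) (scommE hx hy) (scommE hx hz).
by rewrite mulrBl mulrBr sgnMl sgnMr !mulrA; zmod.
Qed.

Lemma invertible_inj x y z : invertible x -> x * y = x * z -> y = z.
Proof.
by case=> w [_ wx] xyz; rewrite -(mul1r y) -(mul1r z) -wx -!mulrA xyz.
Qed.

Lemma rinvP x : invertible x -> x * rinv x = 1 /\ rinv x * x = 1.
Proof. by move=> ix; exact: (xgetPex 0 ix). Qed.

(** The odd part of the inverse of an even unit is killed by that unit. *)
Lemma homog_rinv x : homog false x -> invertible x -> homog false (rinv x).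
Proof.
move=> hx ix; have [xV _] := rinvP ix.
have h0 := homog_spart false (rinv x); have h1 := homog_spart true (rinv x).
have xV1 : x * spart true (rinv x) = 0.
  have /(congr1 (spart true)) := xV; rewrite -{1}(spart_sum (rinv x)) mulrDr spartD.
  rewrite (spart_homog _ (homogM hx h0)) (spart_homog _ (homogM hx h1)).
  by rewrite (spart_homog _ (@homog1 R)) /= add0r.
have /= e1 : spart true (rinv x) = 0 by apply: (invertible_inj ix); rewrite mulr0.
by rewrite /= -{2}(spart_sum (rinv x)) e1 addr0.
Qed.

End SuperRings.

(** * Super endomorphisms *)

Section SuperEnd.
Variables (K : superComRingType) (V : superLmodType K).
Implicit Types (f g : sEnd V) (v : V).

Lemma sEndB f u v : f (u - v) = f u - f v.
Proof. by rewrite sEndD sEndN. Qed.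
Lemma sEnd_sgn f e v : f (sgn e v) = sgn e (f v).
Proof. by apply: sgn_morph; exact: sEndD. Qed.
Lemma sgn_sEndE e f v : (sgn e f) v = sgn e (f v).
Proof. by case: e. Qed.

Lemma homog_app a b f v : homog a f -> homog b v -> homog (a (+) b) (f v).
Proof. by move=> /homog_endP hf hv; exact: hf. Qed.

Lemma scomm_app a b f g v : homog a f -> homog b g ->
  scomm f g v = f (g v) - sgn (a && b) (g (f v)).
Proof. by move=> hf hg; rewrite (scommE hf hg) add_sEndE opp_sEndE sgn_sEndE. Qed.

Lemma scaleMl (k : K) f g : (k *: f) * g = k *: (f * g).
Proof. exact: sEnd_ext. Qed.

Lemma scommZl (k : K) f g : scomm (k *: f) g = k *: scomm f g.
Proof.
elim/homog_ind: k => [k l hk hl|c k hk]; first by rewrite !scalerDl scommDl hk hl.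
elim/homog_ind: f => [f f' hf hf'|a f hf].
  by rewrite scalerDr !scommDl hf hf' scalerDr.
elim/homog_ind: g => [g g' hg hg'|b g hg].
  by rewrite !scommDr scalerDr hg hg'.
rewrite (scommE (homogZ hk hf) hg) (scommE hf hg) scaleMl scalerBr; congr (_ - _).
have -> : g * (k *: f) = sgn (b && c) (k *: (g * f)).
  apply: sEnd_ext => v; rewrite sgn_sEndE [LHS](sEnd_scale _ hg hk) sgnZE //.
by rewrite sgn_scale sgn_sgn; case: (a) (b) (c) => [] [] [].
Qed.

End SuperEnd.

(** * Spans and derivations *)

Section Spans.
Variable V : zmodType.
Implicit Types (G : set V) (x y : V).

Lemma zspan_gen G x : G x -> zspan G x.
Proof. exact: sub_gen_smallest. Qed.

Lemma zspan0 G : zspan G 0.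
Proof. by move=> X [[X0 _] _]. Qed.

Lemma zspanB G x y : zspan G x -> zspan G y -> zspan G (x - y).
Proof. by move=> Gx Gy X GX; have [[_ XB] _] := GX; exact: XB (Gx X GX) (Gy X GX). Qed.

Lemma zspanN G x : zspan G x -> zspan G (- x).
Proof. by move=> Gx; rewrite -sub0r; apply: zspanB => //; exact: zspan0. Qed.

Lemma zspanD G x y : zspan G x -> zspan G y -> zspan G (x + y).
Proof. by move=> Gx Gy; rewrite -[y]opprK; apply: zspanB => //; exact: zspanN. Qed.

End Spans.

(** A span of homogeneous elements subject to conditions [G c] that are
    additive in each degree is graded, and membership is tested on homogeneous
    parts.  Algebras of derivations and the space S_E are spans of this kind. *)
Lemma zspan_homogP (V : superZmodType) (G : bool -> set V) :
  (forall c, G c 0) -> (forall c x y, G c x -> G c y -> G c (x - y)) ->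
  forall x, zspan [set x | exists2 c, homog c x & G c x] x <->
            forall c, G c (spart c x).
Proof.
move=> G0 GB x; split=> [|Gx]; last first.
  rewrite -(spart_sum x); apply: zspanD; apply: zspan_gen.
    by exists false; [exact: homog_spart|].
  by exists true; [exact: homog_spart|].
move: x; apply: zspan_ind => [c|x y Gx Gy c|x [c hx Gx] d].
- by rewrite spart0.
- by rewrite spartD spartN; exact: GB.
by rewrite (spart_homog _ hx); case: eqP => [->|].
Qed.

Section LieSuper.
Variables (K : superComRingType) (L : superLmodType K) (br : L -> L -> L).
Implicit Types (d D : sEnd L) (u v w : L).

(** The Leibniz rule with the signs of a map of degree [c]. *)
Definition hder (c : bool) : set (sEnd L) := [set d |
  forall a x y, homog a x -> d (br x y) = br (d x) y + sgn (c && a) (br x (d y))].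

Hypothesis brDl : forall w, {morph br^~ w : u v / u + v}.
Hypothesis brDr : forall w, {morph br w : u v / u + v}.

Let br0l u : br 0 u = 0.
Proof. by apply: (addrI (br 0 u)); rewrite -brDl !addr0. Qed.
Let br0r u : br u 0 = 0.
Proof. by apply: (addrI (br u 0)); rewrite -brDr !addr0. Qed.
Let brNl u v : br (- u) v = - br u v.
Proof. by apply: (addrI (br u v)); rewrite -brDl !subrr br0l. Qed.
Let brNr u v : br u (- v) = - br u v.
Proof. by apply: (addrI (br u v)); rewrite -brDr !subrr br0r. Qed.
Let brsl e u v : br (sgn e u) v = sgn e (br u v).
Proof. by case: e => /=. Qed.
Let brsr e u v : br u (sgn e v) = sgn e (br u v).
Proof. by case: e => /=. Qed.

Lemma DerP d : Der br d <-> forall c, hder c (spart c d).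
Proof.
rewrite -(@zspan_homogP (sEnd L) hder).
- rewrite /Der; split; apply: zspan_ind.
  + exact: zspan0.
  + exact: zspanB.
  + move=> e [c hc he]; apply: zspan_gen; exists c => // a x y hx.
    by rewrite (he a x y hx) sgnZE.
  + exact: zspan0.
  + exact: zspanB.
  + move=> e [c hc he]; apply: zspan_gen; exists c => // a x y hx.
    by rewrite (he a x y hx) sgnZE.
- by move=> c a x y hx; rewrite /= br0l br0r sgn0 addr0.
- move=> c d1 d2 h1 h2 a x y hx.
  rewrite !add_sEndE !opp_sEndE (h1 a x y hx) (h2 a x y hx) brDl brDr brNl brNr sgnD sgnN.
  by zmod.
Qed.

Lemma Der_homog c d : homog c d -> Der br d -> hder c d.
Proof.
by move=> hc dd; have := (DerP d).1 dd c; rewrite (spart_homog _ hc) eqxx.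
Qed.

Lemma hder_Der c d : homog c d -> hder c d -> Der br d.
Proof.
move=> hc hd; apply: zspan_gen; exists c => // a x y hx.
by rewrite (hd a x y hx) sgnZE.
Qed.

Lemma Der_spart c d : Der br d -> Der br (spart c d).
Proof. by move=> /(DerP d).1 dd; apply: (hder_Der _ (dd c)); exact: homog_spart. Qed.

Hypothesis brZ : forall (k : K) u v, br (k *: u) v = k *: br u v.
Hypothesis br_homog : forall a b u v, homog a u -> homog b v ->
  homog (a (+) b) (br u v).
Hypothesis br_rscale : forall u v (k : K), br u (rscale v k) = rscale (br u v) k.

Let brZr a c (k : K) u v : homog a u -> homog c k ->
  br u (k *: v) = sgn (a && c) (k *: br u v).
Proof.
move=> hu hk; elim/homog_ind: v => [v v' hv hv'|b v hv].
  by rewrite scalerDr !brDr hv hv' scalerDr sgnD.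
rewrite (scale_rscale hk hv) sgnZE brsr br_rscale.
rewrite (rscale_homog hk (br_homog hu hv)) sgnZE sgn_sgn.
by case: (a) (b) (c) => [] [] [].
Qed.

Lemma hderZ a c (k : K) d : homog a k -> homog c d -> hder c d -> hder (a (+) c) (k *: d).
Proof.
move=> hk hd dd b x y hx; rewrite !scale_sEndE (dd b x y hx) brZ (brZr _ hx hk).
by rewrite scalerDr sgn_scale sgn_sgn; case: (a) (b) (c) => [] [] [].
Qed.

Lemma DerZ (k : K) d : Der br d -> Der br (k *: d).
Proof.
move=> dd; rewrite -(spart_sum k) -(spart_sum d) scalerDl !scalerDr.
have D a c : Der br (spart a k *: spart c d).
  apply: (@hder_Der (a (+) c)); first by apply: homogZ; exact: homog_spart.
  by apply: hderZ; [exact: homog_spart..|move: dd => /(DerP _).1 dd; exact: dd].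
by apply: zspanD; apply: zspanD; exact: D.
Qed.

Lemma hder_scomm a b d D : homog a d -> homog b D -> hder a d -> hder b D ->
  hder (a (+) b) (scomm d D).
Proof.
move=> ha hb hd hD c x y hx; rewrite !(scomm_app _ ha hb).
rewrite (hD c x y hx) (hd c x y hx) !sEndD !sEnd_sgn.
rewrite (hd _ _ y (homog_app hb hx)) (hd c x (D y) hx).
rewrite (hD _ _ y (homog_app ha hx)) (hD c x (d y) hx).
rewrite !(brDl, brDr, brNl, brNr, brsl, brsr, sgnD, sgnN, sgn_sgn).
by case: (a) (b) (c) => [] [] [] /=; zmod.
Qed.

Lemma Der_scomm d D : Der br d -> Der br D -> Der br (scomm d D).
Proof.
move=> /(DerP _).1 hd /(DerP _).1 hD; rewrite -(spart_sum d) -(spart_sum D) scommDl !scommDr.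
have C a b : Der br (scomm (spart a d) (spart b D)).
  apply: (@hder_Der (a (+) b)); first by apply: homog_scomm; exact: homog_spart.
  by apply: hder_scomm; rewrite ?hd ?hD //; exact: homog_spart.
by apply: zspanD; apply: zspanD; exact: C.
Qed.

Hypothesis jacobi : forall a b u v w, homog a u -> homog b v ->
  br u (br v w) = br (br u v) w + sgn (a && b) (br v (br u w)).

Variable ad : L -> sEnd L.
Hypothesis adE : forall u v, ad u v = br u v.

Lemma adD : {morph ad : u v / u + v}.
Proof. by move=> u v; apply: sEnd_ext => w; rewrite add_sEndE !adE brDl. Qed.

Lemma adZ (k : K) u : ad (k *: u) = k *: ad u.
Proof. by apply: sEnd_ext => w; rewrite scale_sEndE !adE brZ. Qed.

Lemma ad_homog a u : homog a u -> homog a (ad u).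
Proof. by move=> hu; apply/homog_endP => b v hv; rewrite adE; exact: br_homog. Qed.

Lemma ad_spart a u : ad (spart a u) = spart a (ad u).
Proof.
rewrite -{2}(spart_sum u) adD spartD.
rewrite !(spart_homog _ (ad_homog (homog_spart _ _))).
by case: a; rewrite /= ?addr0 ?add0r.
Qed.

Lemma ad_Der u : Der br (ad u).
Proof.
apply/DerP => c; rewrite -ad_spart => a v w hv; rewrite !adE.
by apply: jacobi => //; exact: homog_spart.
Qed.

Lemma scomm_ad D u : Der br D -> scomm D (ad u) = ad (D u).
Proof.
move=> /(DerP _).1 hD; elim/homog_ind: u => [u v hu hv|a u hu].
  by rewrite adD scommDr hu hv sEndD adD.
rewrite -(spart_sum D) scommDl add_sEndE adD.
have C c : scomm (spart c D) (ad u) = ad (spart c D u).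
  apply: sEnd_ext => w; rewrite (scomm_app _ (homog_spart _ _) (ad_homog hu)) !adE.
  by rewrite (hD c a u w hu) addrK.
by rewrite !C.
Qed.

(** The homogeneous parts of [D, d] and [d, D] differ by signs. *)
Lemma scomm_swap (P : set (sEnd L)) (d D : sEnd L) :
  (forall x y, P x -> P y -> P (x + y)) -> (forall e x, P x -> P (sgn e x)) ->
  (forall a b, P (scomm (spart a d) (spart b D))) -> P (scomm D d).
Proof.
move=> PD PS H; rewrite -(spart_sum d) -(spart_sum D) scommDl !scommDr.
have C a b : P (scomm (spart a D) (spart b d)).
  rewrite (scommC (homog_spart _ _) (homog_spart _ _)) -[- _]/(sgn true _) sgn_sgn.
  by apply: PS.
by apply: (PD); apply: (PD); exact: C.
Qed.

Lemma ad_ideal : ideal (@endbr _ L) (Der br) (range ad).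
Proof.
split.
- split.
  + by exists 0 => //; apply: sEnd_ext => v; rewrite adE br0l.
  + by move=> _ _ [u _ <-] [v _ <-]; exists (u + v); rewrite ?adD.
  + by move=> k _ [u _ <-]; exists (k *: u); rewrite ?adZ.
  + by move=> a _ [u _ <-]; exists (spart a u); rewrite ?ad_spart.
- by move=> _ [u _ <-]; exact: ad_Der.
move=> D _ hD [u _ <-]; split; first by rewrite /endbr scomm_ad //; exists (D u).
apply: (@scomm_swap (range ad)) => [_ _ [x _ <-] [y _ <-]|e _ [x _ <-]|a b].
- by exists (x + y); rewrite ?adD.
- exists (sgn e x) => //; case: e => //=.
  by apply: sEnd_ext => w; rewrite opp_sEndE !adE brNl.
- by rewrite -ad_spart scomm_ad; [eexists|exact: Der_spart].
Qed.

(** If [d] agrees with the bracket by [x] at [y] and at [D y], then [D, d]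
    agrees with the bracket by [D x] at [y]. *)
Lemma locally_inner_ideal : ideal (@endbr _ L) (Der br) (locally_inner br).
Proof.
have liD d d' : locally_inner br d -> locally_inner br d' -> locally_inner br (d + d').
  move=> [dd hd] [dd' hd']; split; first exact: zspanD.
  move=> s; have [x hx] := hd s; have [y hy] := hd' s; exists (x + y) => z zs.
  by rewrite add_sEndE hx // hy // brDl.
have liS e d : locally_inner br d -> locally_inner br (sgn e d).
  move=> [dd hd]; split; first by case: e => //=; exact: zspanN.
  move=> s; have [x hx] := hd s; exists (sgn e x) => z zs.
  by rewrite sgn_sEndE hx // brsl.
have liP_on b d (s : seq L) : locally_inner br d ->
    exists2 x, homog b x & forall y, y \in s -> spart b d y = br x y.
  (* An x that serves the homogeneous parts of the elements of s can be replaced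
     by its own homogeneous parts. *)
  move=> [_ hd].
  have [x hx] := hd ([seq spart false y | y <- s] ++ [seq spart true y | y <- s]).
  exists (spart b x) => [|y ys]; first exact: homog_spart.
  rewrite -(spart_sum y) sEndD brDr.
  have C c : spart b d (spart c y) = br (spart b x) (spart c y).
    rewrite (spart_endE _ _ (homog_spart c y)) hx; last first.
      by rewrite mem_cat; case: c; rewrite map_f ?orbT.
    rewrite -[in LHS](spart_sum x) brDl spartD.
    rewrite !(spart_homog _ (br_homog (homog_spart _ _) (homog_spart _ _))).
    by case: (b) (c) => [] []; rewrite /= ?addr0 ?add0r.
  by rewrite !C.
have liP a d : locally_inner br d -> locally_inner br (spart a d).
  move=> hd; split; first by apply: Der_spart; case: hd.
  by move=> s; have [x _ hx] := liP_on a d s hd; exists x.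
have liC d D : Der br D -> locally_inner br d -> locally_inner br (scomm D d).
  move=> hD hd; rewrite -(spart_sum d) -(spart_sum D) scommDl !scommDr.
  have C a b : locally_inner br (scomm (spart a D) (spart b d)).
    split; first by apply: Der_scomm; apply: Der_spart => //; case: hd.
    move=> s; have [x hx xs] := liP_on b d (s ++ map (spart a D) s) hd.
    exists (spart a D x) => y ys.
    rewrite (scomm_app _ (homog_spart _ _) (homog_spart _ _)).
    rewrite !xs ?mem_cat ?ys ?map_f ?orbT //.
    move: hD => /(DerP _).1 hD; by rewrite (hD a b x y hx) addrK.
  by apply: (liD); apply: (liD); exact: C.
split.
- split=> //.
  + split; first exact: zspan0.
    by move=> s; exists 0 => y _; rewrite br0l.
  + move=> k d [dd hd]; split; first exact: DerZ.
    by move=> s; have [x hx] := hd s; exists (k *: x) => y ys; rewrite scale_sEndE hx // brZ.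
- by move=> d [].
move=> D d hD hd; split; first exact: liC.
apply: (@scomm_swap (locally_inner br)) => // a b.
by apply: liC; [exact: Der_spart|exact: liP].
Qed.

End LieSuper.

(** * Quadratic forms and the operators they define *)

Section QuadForms.
Variables (K : superComRingType) (A : superExtType K) (M : superLmodType A).
Variable q : quadForm M.
Notation End := (sEnd (restr M)).
Notation "a %:A'" := (aId M a) (at level 2, format "a %:A'").
Implicit Types (a b : A) (m n p : restr M) (f g : End).

Lemma smulCE (c d : bool) a b : homog c a -> homog d b -> a * b = sgn (c && d) (b * a).
Proof. by move=> ha hb; rewrite (smulC ha hb) sgnME. Qed.

Lemma aId_sgn (e : bool) a : (sgn e a)%:A' = sgn e a%:A'.
Proof. by apply: sgn_morph; exact: aIdD. Qed.

Lemma aId0 : 0%:A' = 0.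
Proof. by apply: (addrI 0%:A'); rewrite -aIdD !addr0. Qed.

Lemma aIdB a b : (a - b)%:A' = a%:A' - b%:A'.
Proof. by rewrite aIdD aIdN. Qed.

Lemma aIdM a b : (a * b)%:A' = a%:A' * b%:A'.
Proof. by apply: sEnd_ext => m; rewrite mul_sEndE !aIdE scalerA. Qed.

Lemma aId_app a b m : a%:A' (b%:A' m) = (a * b)%:A' m.
Proof. by rewrite aIdM. Qed.

Lemma aId1 : 1%:A' = 1.
Proof. by apply: sEnd_ext => m; rewrite aIdE (@scale1r A M). Qed.

Lemma aIdZ (k : K) a : (k *: a)%:A' = k *: a%:A'.
Proof.
apply: sEnd_ext => m; rewrite scale_sEndE !aIdE [RHS](@scalerA A M) -scalerAl.
by rewrite mul1r.
Qed.

Lemma homog_aId c a : homog c a -> homog c a%:A'.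
Proof. by move=> ha; apply/homog_endP => d m hm; exact: (@homogZ A M). Qed.

Lemma rscale0r m : rscale (m : M) (0 : A) = 0.
Proof. by apply: (addrI (rscale (m : M) 0)); rewrite -rscaleDr !addr0. Qed.

Lemma rscale_aId (c d : bool) a m : homog c a -> homog d m ->
  rscale (m : M) a = sgn (c && d) (a%:A' m).
Proof. by move=> ha hm; rewrite (@rscale_homog A M _ _ _ _ ha hm) sgnZE. Qed.

Lemma scale_aId (k : K) m : k *: m = (k%:A)%:A' m. Proof. by []. Qed.

Lemma aId_sapp (c d : bool) f m : homog c f -> homog d m -> sapp f m = sgn (c && d) (f m).
Proof. by move=> hf hm; rewrite (sapp_homog hf hm) sgnZE. Qed.

Lemma Alinear_spart c f : Alinear f -> Alinear (spart c f : End).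
Proof.
move=> fA m a; elim/(@homog_ind A): a => [a b ha hb|d a ha].
  by rewrite !rscaleDr sEndD ha hb.
elim/(@homog_ind M): m => [m n hm hn|e m hm].
  by rewrite rscaleDl !sEndD [RHS]rscaleDl hm hn.
rewrite (@spart_endE _ (restr M) _ _ _ _ (homog_rscale ha hm)) fA.
rewrite (@spart_endE _ (restr M) _ _ _ _ hm).
rewrite -(@spart_rscale A M _ _ _ (f m) ha); congr (spart _ _).
by case: (c) (d) (e) => [] [] [].
Qed.

(** Together with the converse below: the right [A]-linear operators are those
    that supercommute with the multiplications by [A]. *)
Lemma Alinear_scomm f a : Alinear f -> scomm f a%:A' = 0.
Proof.
move=> fA; rewrite -(spart_sum f) scommDl.
have C c : scomm (spart c f) a%:A' = 0.
  elim/(@homog_ind A): a => [a b ha hb|d a ha].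
    by rewrite aIdD scommDr ha hb addr0.
  apply: sEnd_eqh => e m hm.
  rewrite (scomm_app _ (homog_spart _ _) (homog_aId ha)).
  have := Alinear_spart c fA m a; rewrite (rscale_aId ha hm).
  rewrite (rscale_aId ha (homog_app (homog_spart c f) hm)) sEnd_sgn => e1.
  have -> : spart c f (a%:A' m) = sgn (d && e) (sgn (d && (c (+) e)) (a%:A' (spart c f m))).
    by rewrite -e1 sgnK.
  rewrite zero_sEndE; zmod.
by rewrite !C addr0.
Qed.

Lemma scomm_Alinear f : (forall a, scomm f a%:A' = 0) -> Alinear f.
Proof.
move=> fA m a.
elim/(@homog_ind A): a => [a b ha hb|d a ha].
  by rewrite !rscaleDr sEndD ha hb.
have [f0 f1] : (scomm (spart false f) a%:A' = 0) /\ (scomm (spart true f) a%:A' = 0).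
  have e : scomm (spart false f) a%:A' + scomm (spart true f) a%:A' = 0.
    by rewrite -scommDl spart_sum.
  have h c := homog_scomm (homog_spart c f) (homog_aId ha).
  have := congr1 (spart (d (+) false)) e; have := congr1 (spart (d (+) true)) e.
  rewrite !spartD !(spart_homog _ (h _)) !spart0.
  by case: (d) => /=; rewrite ?addr0 ?add0r => -> ->.
elim/(@homog_ind M): m => [m n hm hn|e m hm].
  by rewrite rscaleDl !sEndD [RHS]rscaleDl hm hn.
rewrite (rscale_aId ha hm) sEnd_sgn -(spart_sum f) !add_sEndE.
rewrite rscaleDl !(rscale_aId ha (homog_app (homog_spart _ f) hm)).
have E c : scomm (spart c f) a%:A' = 0 ->
    spart c f (a%:A' m) = sgn (c && d) (a%:A' (spart c f m)).
  move=> /(congr1 (fun g : End => g m)).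
  rewrite (scomm_app _ (homog_spart _ _) (homog_aId ha)) zero_sEndE => /eqP.
  by rewrite subr_eq0 => /eqP.
by rewrite (E false f0) (E true f1); zmod.
Qed.

Lemma AlinearE (c d : bool) f a m : Alinear f -> homog c f -> homog d a ->
  f (a%:A' m) = sgn (c && d) (a%:A' (f m)).
Proof.
move=> fA hf ha; have /(congr1 (fun g : End => g m)) := Alinear_scomm a fA.
rewrite (scomm_app _ hf (homog_aId ha)) zero_sEndE => /eqP.
by rewrite subr_eq0 => /eqP.
Qed.

(** ** The form *)

Lemma qDl m m' n : q (m + m') n = q m n + q m' n. Proof. exact: qfDl. Qed.
Lemma qDr m n n' : q m (n + n') = q m n + q m n'. Proof. exact: qfDr. Qed.
Lemma q0l n : q (0 : restr M) n = 0.
Proof. by apply: (addrI (q (0 : restr M) n)); rewrite -qDl !addr0. Qed.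
Lemma q0r n : q n (0 : restr M) = 0.
Proof. by apply: (addrI (q n (0 : restr M))); rewrite -qDr !addr0. Qed.
Lemma qNl m n : q (- m) n = - q m n.
Proof. by apply: (addrI (q m n)); rewrite -qDl !subrr q0l. Qed.
Lemma qNr m n : q m (- n) = - q m n.
Proof. by apply: (addrI (q m n)); rewrite -qDr !subrr q0r. Qed.
Lemma qsl e m n : q (sgn e m) n = sgn e (q m n).
Proof. by case: e; rewrite //= qNl. Qed.
Lemma qsr e m n : q m (sgn e n) = sgn e (q m n).
Proof. by case: e; rewrite //= qNr. Qed.
Lemma qC (c d : bool) m n : homog c m -> homog d n -> q m n = sgn (c && d) (q n m).
Proof. by move=> hm hn; rewrite (qfC q hm hn) sgnME. Qed.
Lemma q_homog (c d : bool) m n : homog c m -> homog d n -> homog (c (+) d) (q m n).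
Proof. exact: qf_homog. Qed.

Lemma qar (c d : bool) a m n : homog c a -> homog d m ->
  q m (a%:A' n) = sgn (c && d) (a * q m n).
Proof.
move=> ha hm; elim/(@homog_ind (restr M)): n => [n n' hn hn'|e n hn].
  by rewrite sEndD !qDr hn hn' mulrDr sgnD.
have -> : a%:A' n = sgn (c && e) (rscale (n : M) a).
  by rewrite (rscale_aId ha hn) sgnK.
rewrite qsr qfZr (smulCE (q_homog hm hn) ha) sgn_sgn; zmod.
Qed.

Lemma qal a m n : q (a%:A' m) n = a * q m n.
Proof.
elim/(@homog_ind A): a => [a b ha hb|c a ha].
  by rewrite aIdD add_sEndE qDl ha hb mulrDl.
elim/(@homog_ind (restr M)): m => [m m' hm hm'|d m hm].
  by rewrite sEndD !qDl hm hm' mulrDr.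
have -> : a%:A' m = sgn (c && d) (rscale (m : M) a).
  by rewrite (rscale_aId ha hm) sgnK.
by rewrite qsl qfM (qar _ ha hm) sgnK.
Qed.

Lemma qZl (k : K) m n : q (k *: m) n = k *: q m n.
Proof. by rewrite [LHS]qal -scalerAl mul1r. Qed.

(** ** The operators E_{m,n} *)

Notation E := (Emap q).

Lemma EDl m m' n : E (m + m') n = E m n + E m' n.
Proof. by apply: sEnd_ext => p; exact: EfunDl. Qed.
Lemma EDr m n n' : E m (n + n') = E m n + E m n'. Proof. exact: EmapDr. Qed.
Lemma E0l n : E (0 : restr M) n = 0.
Proof. by apply: (addrI (E (0 : restr M) n)); rewrite -EDl !addr0. Qed.
Lemma E0r n : E n (0 : restr M) = 0.
Proof. by apply: (addrI (E n (0 : restr M))); rewrite -EDr !addr0. Qed.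
Lemma ENl m n : E (- m) n = - E m n.
Proof. by apply: (addrI (E m n)); rewrite -EDl !subrr E0l. Qed.
Lemma ENr m n : E m (- n) = - E m n.
Proof. by apply: (addrI (E m n)); rewrite -EDr !subrr E0r. Qed.
Lemma Esl e m n : E (sgn e m) n = sgn e (E m n).
Proof. by case: e; rewrite //= ENl. Qed.
Lemma Esr e m n : E m (sgn e n) = sgn e (E m n).
Proof. by case: e; rewrite //= ENr. Qed.

Lemma EmapE (c d e : bool) m n p : homog c m -> homog d n -> homog e p ->
  E m n p = sgn (c && (d (+) e)) ((q n p)%:A' m) - sgn (d && e) ((q m p)%:A' n).
Proof.
move=> hm hn hp; rewrite [LHS](Efun_homog q m hn hp) sgnZE; congr (_ - _).
by rewrite (rscale_aId (q_homog hn hp) hm) andbC.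
Qed.

Lemma E_homog (c d : bool) m n : homog c m -> homog d n -> homog (c (+) d) (E m n).
Proof.
move=> hm hn; apply/homog_endP => e p hp; rewrite (EmapE hm hn hp).
apply: homogB; apply: homog_sgn.
  have := homog_app (homog_aId (q_homog hn hp)) hm.
  by case: (c) (d) (e) => [] [] [].
have := homog_app (homog_aId (q_homog hm hp)) hn.
by case: (c) (d) (e) => [] [] [].
Qed.

Lemma EC (c d : bool) m n : homog c m -> homog d n -> E m n = - sgn (c && d) (E n m).
Proof.
move=> hm hn; apply: sEnd_eqh => e p hp.
rewrite opp_sEndE sgn_sEndE (EmapE hm hn hp) (EmapE hn hm hp).
by zmod.
Qed.

Lemma Eal a m n : E (a%:A' m) n = a%:A' * E m n.
Proof.
elim/(@homog_ind A): a => [a b ha hb|c a ha].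
  by rewrite !aIdD mulrDl -ha -hb add_sEndE EDl.
elim/(@homog_ind (restr M)): m => [m m' hm hm'|d m hm].
  by rewrite sEndD !EDl hm hm' mulrDr.
elim/(@homog_ind (restr M)): n => [n n' hn hn'|e n hn].
  by rewrite !EDr hn hn' mulrDr.
apply: sEnd_eqh => g p hp; rewrite mul_sEndE (EmapE (homog_app (homog_aId ha) hm) hn hp).
rewrite (EmapE hm hn hp) sEndB !sEnd_sgn qal aIdM mul_sEndE; congr (_ - _).
rewrite -!mul_sEndE -!aIdM (smulCE (q_homog hn hp) ha) aId_sgn sgn_sEndE sgn_sgn.
by zmod.
Qed.

Lemma Ear (c d : bool) a m n : homog c a -> homog d m ->
  E m (a%:A' n) = sgn (c && d) (a%:A' * E m n).
Proof.
move=> ha hm; elim/(@homog_ind (restr M)): n => [n n' hn hn'|e n hn].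
  by rewrite sEndD !EDr hn hn' mulrDr sgnD.
rewrite (EC hm (homog_app (homog_aId ha) hn)) Eal (EC hn hm) mulrN sgnMr sgnN opprK.
by rewrite sgn_sgn; zmod.
Qed.

Lemma E_Alinear m n : Alinear (E m n). Proof. by move=> p a; exact: Efun_rscale. Qed.

(** The triple product of the Jordan pair (M, M) *)
Definition Ftri m n : End := locked ((q m n)%:A' + E m n).

Lemma FtriE m n : Ftri m n = (q m n)%:A' + E m n.
Proof. by rewrite /Ftri -lock. Qed.

(** The outer arguments of the triple product may be exchanged; this is what
    the Jacobi identity needs for two elements of the same copy of [M]. *)
Lemma Ftri_sym (c d e : bool) m n p : homog c m -> homog d n -> homog e p ->
  Ftri m n p = sgn (c && d (+) d && e (+) c && e) (Ftri p n m).
Proof.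
move=> hm hn hp; rewrite !FtriE !add_sEndE (EmapE hm hn hp) (EmapE hp hn hm).
rewrite (qC hm hn) (qC hm hp) (qC hn hp) !aId_sgn !sgn_sEndE.
by rewrite !sgnD !sgnN !sgn_sgn; zmod.
Qed.

End QuadForms.
Arguments homog_aId {K A M c a}.

(** * The Lie superalgebra E_infinity *)

Section Einf.
Variables (K : superComRingType) (A : superExtType K) (M : superLmodType A).
Variables (q : quadForm M) (E : midalg q).
Notation End := (sEnd (restr M)).
Notation "a %:A'" := (aId M a) (at level 2, format "a %:A'").
Implicit Types (u v w : Einf E) (x y : midtype E) (m n : restr M) (a : A).

Definition cA u : A := u.1.1.1.
Definition cM u : restr M := u.1.1.2.
Definition cN u : restr M := u.1.2.
Definition cE u : End := mval u.2.
Definition mkE a m n x : Einf E := (a, m, n, x).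

Lemma einf_ext u v :
  cA u = cA v -> cM u = cM v -> cN u = cN v -> cE u = cE v -> u = v.
Proof.
case: u v => [[[a m] n] x] [[[a' m'] n'] x']; rewrite /cA /cM /cN /cE /=.
by move=> -> -> -> /val_inj ->.
Qed.

Lemma cAD u v : cA (u + v) = cA u + cA v. Proof. by []. Qed.
Lemma cMD u v : cM (u + v) = cM u + cM v. Proof. by []. Qed.
Lemma cND u v : cN (u + v) = cN u + cN v. Proof. by []. Qed.
Lemma cED u v : cE (u + v) = cE u + cE v. Proof. by []. Qed.
Lemma cAN u : cA (- u) = - cA u. Proof. by []. Qed.
Lemma cMN u : cM (- u) = - cM u. Proof. by []. Qed.
Lemma cNN u : cN (- u) = - cN u. Proof. by []. Qed.
Lemma cEN u : cE (- u) = - cE u. Proof. by []. Qed.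
Lemma cAs e u : cA (sgn e u) = sgn e (cA u). Proof. by case: e. Qed.
Lemma cMs e u : cM (sgn e u) = sgn e (cM u). Proof. by case: e. Qed.
Lemma cNs e u : cN (sgn e u) = sgn e (cN u). Proof. by case: e. Qed.
Lemma cEs e u : cE (sgn e u) = sgn e (cE u). Proof. by case: e. Qed.
Definition cDE := (cAD, cMD, cND, cED, cAN, cMN, cNN, cEN, cAs, cMs, cNs, cEs).

Lemma einf_homogP (c : bool) u : homog c u <->
  [/\ homog c (cA u), homog c (cM u), homog c (cN u) & homog c (cE u)].
Proof.
split=> [/homog_pair[/homog_pair[/homog_pair[ha hm] hn] hx]|[ha hm hn hx]].
  by split=> //; exact/homog_mid.
apply/homog_pair; split; last exact/homog_mid.
by apply/homog_pair; split=> //; apply/homog_pair.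
Qed.

Lemma mid_Alinear (f : End) : mid_set E f -> Alinear f.
Proof. by move=> /mid_osp[]. Qed.

Lemma mid_skew (f : End) (c d e : bool) m n : mid_set E f ->
  homog c f -> homog d m -> homog e n -> q (f m) n = - sgn (c && d) (q m (f n)).
Proof.
move=> /mid_osp[_ fo] hf hm hn; have /eqP := fo _ _ _ _ hm hn.
rewrite sgnME addr_eq0 => /eqP ->; rewrite (qC q (homog_app hf hn) hm).
by zmod.
Qed.

Lemma mid_scomm (f g : End) : mid_set E f -> mid_set E g -> mid_set E (scomm f g).
Proof. exact: (mid_subalgebra E).2. Qed.

Lemma midD (f g : End) : mid_set E f -> mid_set E g -> mid_set E (f + g).
Proof. by have [[_ H _ _] _] := mid_subalgebra E; exact: H. Qed.
Lemma midZ (k : K) (f : End) : mid_set E f -> mid_set E (k *: f).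
Proof. by have [[_ _ H _] _] := mid_subalgebra E; exact: H. Qed.
Lemma mid0 : mid_set E 0.
Proof. by have [[H _ _ _] _] := mid_subalgebra E. Qed.
Lemma midN (f : End) : mid_set E f -> mid_set E (- f).
Proof. by move=> /(midZ (-1)); rewrite scaleN1r. Qed.
Lemma mid_sgn e (f : End) : mid_set E f -> mid_set E (sgn e f).
Proof. by case: e => //; exact: midN. Qed.
Lemma mid_spart (c : bool) (f : End) : mid_set E f -> mid_set E (spart c f).
Proof. by have [[_ _ _ H] _] := mid_subalgebra E; exact: H. Qed.

Lemma cE_mid u : mid_set E (cE u). Proof. exact: mvalE. Qed.

(** The operators by which an element of [A] and [E] acts on the first and on
    the second copy of [M]; in these terms the bracket of homogeneous elements
    is the uniform expression of [brM] and [brN]. *)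
Definition Pop u : End := locked ((cA u)%:A' + cE u).
Definition Qop u : End := locked (cE u - (cA u)%:A').

Lemma PopE u : Pop u = (cA u)%:A' + cE u. Proof. by rewrite /Pop -lock. Qed.
Lemma QopE u : Qop u = cE u - (cA u)%:A'. Proof. by rewrite /Qop -lock. Qed.

Lemma Pop_homog (c : bool) u : homog c u -> homog c (Pop u).
Proof. by move=> /einf_homogP[ha _ _ hx]; rewrite PopE; apply: homogD => //; exact: homog_aId. Qed.
Lemma Qop_homog (c : bool) u : homog c u -> homog c (Qop u).
Proof. by move=> /einf_homogP[ha _ _ hx]; rewrite QopE; apply: homogB => //; exact: homog_aId. Qed.

Lemma brA u v : cA (einf_br E u v) = q (cM u) (cN v) - q (cN u) (cM v).
Proof. by case: u v => [[[a m] n] x] [[[a' m'] n'] x']. Qed.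

Lemma brM (c d : bool) u v : homog c u -> homog d v ->
  cM (einf_br E u v) = Pop u (cM v) - sgn (c && d) (Pop v (cM u)).
Proof.
case: u v => [[[a m] n] x] [[[a' m'] n'] x'].
move=> /einf_homogP[_ hm _ _] /einf_homogP[ha _ _ hx].
rewrite !PopE !add_sEndE /cM /cA /cE /= in ha hm hx *.
rewrite (rscale_aId ha hm) (aId_sapp hx hm) aIdE.
by rewrite [d && c]andbC; zmod.
Qed.

Lemma brN (c d : bool) u v : homog c u -> homog d v ->
  cN (einf_br E u v) = Qop u (cN v) - sgn (c && d) (Qop v (cN u)).
Proof.
case: u v => [[[a m] n] x] [[[a' m'] n'] x'].
move=> /einf_homogP[_ _ hn _] /einf_homogP[ha _ _ hx].
rewrite !QopE !add_sEndE !opp_sEndE /cN /cA /cE /= in ha hn hx *.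
rewrite (rscale_aId ha hn) (aId_sapp hx hn) aIdE.
by rewrite [d && c]andbC; zmod.
Qed.

Lemma brE u v : cE (einf_br E u v) =
  Emap q (cM u) (cN v) + Emap q (cN u) (cM v) + scomm (cE u) (cE v).
Proof. by case: u v => [[[a m] n] x] [[[a' m'] n'] x']. Qed.

Lemma brM_raw u v : cM (einf_br E u v) =
  (cA u)%:A' (cM v) + cE u (cM v) - rscale (cM u : M) (cA v) - sapp (cE v) (cM u).
Proof. by case: u v => [[[a m] n] x] [[[a' m'] n'] x']. Qed.

Lemma brN_raw u v : cN (einf_br E u v) =
  - (cA u)%:A' (cN v) + cE u (cN v) + rscale (cN u : M) (cA v) - sapp (cE v) (cN u).
Proof. by case: u v => [[[a m] n] x] [[[a' m'] n'] x']. Qed.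

Lemma einf_brDl w : {morph (einf_br E)^~ w : u v / u + v}.
Proof.
move=> u v; apply: einf_ext; rewrite ?cDE.
- by rewrite !brA !cDE !qDl; zmod.
- by rewrite !brM_raw !cDE aIdD !add_sEndE (@rscaleDl A M) sappDr; zmod.
- by rewrite !brN_raw !cDE aIdD !add_sEndE (@rscaleDl A M) sappDr; zmod.
- by rewrite !brE !cDE !EDl scommDl; zmod.
Qed.

Lemma einf_br_homog (c d : bool) u v : homog c u -> homog d v ->
  homog (c (+) d) (einf_br E u v).
Proof.
move=> hu hv; have [ha hm hn hx] := (einf_homogP c u).1 hu.
have [ha' hm' hn' hx'] := (einf_homogP d v).1 hv.
have hP := Pop_homog hu; have hQ := Qop_homog hu.
have hP' := Pop_homog hv; have hQ' := Qop_homog hv.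
apply/einf_homogP; split.
- by rewrite brA; apply: homogB; exact: q_homog.
- rewrite (brM hu hv); apply: homogB; first exact: homog_app.
  by rewrite addbC; apply/homog_sgn/homog_app.
- rewrite (brN hu hv); apply: homogB; first exact: homog_app.
  by rewrite addbC; apply/homog_sgn/homog_app.
- rewrite brE; apply: homogD; last exact: homog_scomm.
  by apply: homogD; exact: E_homog.
Qed.

Lemma einf_brC (c d : bool) u v : homog c u -> homog d v ->
  einf_br E u v = - sgn (c && d) (einf_br E v u).
Proof.
move=> hu hv; have [ha hm hn hx] := (einf_homogP c u).1 hu.
have [ha' hm' hn' hx'] := (einf_homogP d v).1 hv.
apply: einf_ext; rewrite ?cDE.
- by rewrite !brA (qC q hm hn') (qC q hn hm'); zmod.
- by rewrite (brM hu hv) (brM hv hu); zmod.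
- by rewrite (brN hu hv) (brN hv hu); zmod.
- by rewrite !brE (EC q hm hn') (EC q hn hm') (scommC hx hx'); zmod.
Qed.

Lemma einf_brs u e v : einf_br E u (sgn e v) = sgn e (einf_br E u v).
Proof. by apply: sgn_morph; exact: einf_brDr. Qed.

Lemma einf_brZ (k : K) u v : einf_br E (k *: u) v = k *: einf_br E u v.
Proof.
elim/homog_ind: k => [k l hk hl|a k hk].
  by rewrite !scalerDl einf_brDl hk hl.
elim/homog_ind: u => [u u' hu hu'|b u hu].
  by rewrite scalerDr !einf_brDl hu hu' scalerDr.
elim/homog_ind: v => [v v' hv hv'|c v hv].
  by rewrite !einf_brDr scalerDr hv hv'.
rewrite (einf_brC (homogZ hk hu) hv) (einf_brC hu hv).
rewrite (scale_rscale hk hu) sgnZE einf_brs einf_br_rscale.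
rewrite (rscale_homog hk (einf_br_homog hv hu)) sgnZE !sgn_sgn scalerN sgn_scale.
by zmod.
Qed.

(** The representations of A (+) E on the two copies of M are conjugate under
    the form. *)
Lemma q_Pop (c d e : bool) u m n : homog c u -> homog d m -> homog e n ->
  q (Pop u m) n = - sgn (c && d) (q m (Qop u n)).
Proof.
move=> /einf_homogP[ha _ _ hx] hm hn; rewrite !PopE !QopE !add_sEndE opp_sEndE.
rewrite qDl qDr qNr qal (mid_skew (cE_mid u) hx hm hn) (qar q _ ha hm); zmod.
Qed.

Lemma q_Qop (c d e : bool) u m n : homog c u -> homog d m -> homog e n ->
  q (Qop u m) n = - sgn (c && d) (q m (Pop u n)).
Proof.
move=> /einf_homogP[ha _ _ hx] hm hn; rewrite !PopE !QopE !add_sEndE opp_sEndE.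
rewrite qDl qDr qNl qal (mid_skew (cE_mid u) hx hm hn) (qar q _ ha hm); zmod.
Qed.

Lemma mid_scommE (c d e : bool) (f : End) m n :
  mid_set E f -> homog c f -> homog d m -> homog e n ->
  scomm f (Emap q m n) = Emap q (f m) n + sgn (c && d) (Emap q m (f n)).
Proof.
move=> Ef hf hm hn; apply: sEnd_eqh => g p hp; have fA := mid_Alinear Ef.
rewrite (scomm_app _ hf (E_homog q hm hn)) add_sEndE sgn_sEndE.
rewrite (EmapE q hm hn hp) (EmapE q (homog_app hf hm) hn hp).
rewrite (EmapE q hm (homog_app hf hn) hp) (EmapE q hm hn (homog_app hf hp)).
rewrite sEndB !sEnd_sgn (AlinearE _ fA hf (q_homog q hn hp)).
rewrite (AlinearE _ fA hf (q_homog q hm hp)).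
rewrite (mid_skew Ef hf hm hp) (mid_skew Ef hf hn hp).
rewrite !aIdN !aId_sgn !opp_sEndE !sgn_sEndE.
by zmod.
Qed.

Lemma scomm_Pop (c d e : bool) u m n : homog c u -> homog d m -> homog e n ->
  scomm (cE u) (Emap q m n) =
  Emap q (Pop u m) n + sgn (c && d) (Emap q m (Qop u n)).
Proof.
move=> /einf_homogP[ha _ _ hx] hm hn; rewrite (mid_scommE (cE_mid u) hx hm hn).
rewrite !PopE !QopE !add_sEndE opp_sEndE EDl EDr ENr Eal (Ear q _ ha hm); zmod.
Qed.

Lemma scomm_Qop (c d e : bool) u m n : homog c u -> homog d m -> homog e n ->
  scomm (cE u) (Emap q m n) =
  Emap q (Qop u m) n + sgn (c && d) (Emap q m (Pop u n)).
Proof.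
move=> /einf_homogP[ha _ _ hx] hm hn; rewrite (mid_scommE (cE_mid u) hx hm hn).
rewrite !PopE !QopE !add_sEndE opp_sEndE EDl EDr ENl Eal (Ear q _ ha hm); zmod.
Qed.

Lemma aId_scomm (c d : bool) a a' : homog c a -> homog d a' -> scomm a%:A' a'%:A' = 0.
Proof.
move=> ha ha'; rewrite (scommE (homog_aId ha) (homog_aId ha')) -!aIdM.
by rewrite (smulCE ha ha') aId_sgn; zmod.
Qed.

Lemma scomm_PP (c d : bool) u v : homog c u -> homog d v ->
  scomm (cE u) (cE v) = scomm (Pop u) (Pop v) /\
  scomm (cE u) (cE v) = scomm (Qop u) (Qop v).
Proof.
move=> /einf_homogP[ha _ _ hx] /einf_homogP[ha' _ _ hx'].
have e1 := Alinear_scomm (cA v) (mid_Alinear (cE_mid u)).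
have e2 : scomm (cA u)%:A' (cE v) = 0.
  rewrite (scommC (homog_aId ha) hx').
  by rewrite (Alinear_scomm (cA u) (mid_Alinear (cE_mid v))) sgn0 oppr0.
have e3 := aId_scomm ha ha'.
by rewrite !PopE !QopE !scommDl !scommDr !scommNl !scommNr e1 e2 e3; split; zmod.
Qed.

(** [Pop] and [Qop] are representations, up to the triple products coming from
    the two copies of [M]. *)
Lemma Pop_br (c d : bool) u v : homog c u -> homog d v ->
  Pop (einf_br E u v) = Ftri q (cM u) (cN v) - sgn (c && d) (Ftri q (cM v) (cN u)) +
     scomm (Pop u) (Pop v).
Proof.
move=> hu hv; have [ha hm hn hx] := (einf_homogP c u).1 hu.
have [ha' hm' hn' hx'] := (einf_homogP d v).1 hv.
rewrite -(scomm_PP hu hv).1 !PopE brA brE aIdB !FtriE.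
by rewrite (qC q hn hm') (EC q hn hm') aId_sgn sgnD; zmod.
Qed.

Lemma Qop_br (c d : bool) u v : homog c u -> homog d v ->
  Qop (einf_br E u v) = Ftri q (cN u) (cM v) - sgn (c && d) (Ftri q (cN v) (cM u)) +
     scomm (Qop u) (Qop v).
Proof.
move=> hu hv; have [ha hm hn hx] := (einf_homogP c u).1 hu.
have [ha' hm' hn' hx'] := (einf_homogP d v).1 hv.
rewrite -(scomm_PP hu hv).2 !QopE brA brE aIdB !FtriE.
by rewrite (qC q hm hn') (EC q hm hn') aId_sgn sgnD; zmod.
Qed.

(** In the two copies of [M] the identity comes from the symmetry of the triple
    product; in [A] and [E] it comes from the invariance of the form and of the
    operators E_{m,n} under [Pop] and [Qop]. *)
Lemma einf_jacobi (c d : bool) u v w : homog c u -> homog d v ->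
  einf_br E u (einf_br E v w) =
  einf_br E (einf_br E u v) w + sgn (c && d) (einf_br E v (einf_br E u w)).
Proof.
move=> hu hv; elim/homog_ind: w => [w w' hw hw'|e w hw].
  by rewrite !einf_brDr hw hw' sgnD addrACA.
have [ha hm hn hx] := (einf_homogP c u).1 hu.
have [ha' hm' hn' hx'] := (einf_homogP d v).1 hv.
have [ha'' hm'' hn'' hx''] := (einf_homogP e w).1 hw.
have huv := einf_br_homog hu hv; have hvw := einf_br_homog hv hw.
have huw := einf_br_homog hu hw.
have hP := Pop_homog hu; have hQ := Qop_homog hu.
have hP' := Pop_homog hv; have hQ' := Qop_homog hv.
have hP'' := Pop_homog hw; have hQ'' := Qop_homog hw.
apply: einf_ext; rewrite ?cDE.
- rewrite !brA (brM hv hw) (brM hu hw) (brM hu hv) (brN hv hw) (brN hu hw) (brN hu hv).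
  rewrite !(qDl, qDr, qNl, qNr, qsl, qsr).
  rewrite (q_Pop hu hm' hn'') (q_Pop hv hm hn'') (q_Qop hu hn' hm'') (q_Qop hv hn hm'').
  rewrite (qC q hm (homog_app hQ'' hn')) (q_Qop hw hn' hm).
  rewrite (qC q hn (homog_app hP'' hm')) (q_Pop hw hm' hn).
  rewrite (qC q hm' (homog_app hQ'' hn)) (q_Qop hw hn hm').
  rewrite (qC q hn' (homog_app hP'' hm)) (q_Pop hw hm hn').
  by zmod.
- rewrite (brM hu hvw) (brM hv huw) (brM huv hw) (brM hv hw) (brM hu hw) (brM hu hv).
  rewrite (Pop_br hv hw) (Pop_br hu hw) (Pop_br hu hv).
  rewrite !(add_sEndE, opp_sEndE, sgn_sEndE, sEndD, sEndN, sEnd_sgn).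
  rewrite (scomm_app _ hP hP') (scomm_app _ hP hP'') (scomm_app _ hP' hP'').
  rewrite (Ftri_sym q hm hn' hm'') (Ftri_sym q hm' hn hm'') (Ftri_sym q hm hn'' hm').
  by zmod.
- rewrite (brN hu hvw) (brN hv huw) (brN huv hw) (brN hv hw) (brN hu hw) (brN hu hv).
  rewrite (Qop_br hv hw) (Qop_br hu hw) (Qop_br hu hv).
  rewrite !(add_sEndE, opp_sEndE, sgn_sEndE, sEndD, sEndN, sEnd_sgn).
  rewrite (scomm_app _ hQ hQ') (scomm_app _ hQ hQ'') (scomm_app _ hQ' hQ'').
  rewrite (Ftri_sym q hn hm' hn'') (Ftri_sym q hn' hm hn'') (Ftri_sym q hn hm'' hn').
  by zmod.
- rewrite !brE !(scommDl, scommDr).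
  rewrite (brM hv hw) (brM hu hw) (brM hu hv) (brN hv hw) (brN hu hw) (brN hu hv).
  rewrite !(EDl, EDr, ENl, ENr, Esl, Esr).
  rewrite (scomm_jacobi _ hx hx').
  rewrite (scomm_Pop hu hm' hn'') (scomm_Qop hu hn' hm'').
  rewrite (scomm_Pop hv hm hn'') (scomm_Qop hv hn hm'').
  rewrite (scommC (E_homog q hm hn') hx'') (scommC (E_homog q hn hm') hx'').
  rewrite (scomm_Pop hw hm hn') (scomm_Qop hw hn hm').
  rewrite (EC q hm (homog_app hQ'' hn')) (EC q hn (homog_app hP'' hm')).
  rewrite (EC q hm' (homog_app hQ'' hn)) (EC q hn' (homog_app hP'' hm)).
  rewrite (EC q (homog_app hP'' hm) hn') (EC q (homog_app hQ'' hn) hm').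
  by zmod.
Qed.

End Einf.

(** * The derivations d_{S,0} *)

Section SDerivations.
Variables (K : superComRingType) (A : superExtType K) (M : superLmodType A).
Variables (q : quadForm M) (E : midalg q).
Hypothesis faithful : forall a : A, (forall m : M, a *: m = 0) -> a = 0.
Notation End := (sEnd (restr M)).
Notation "a %:A'" := (aId M a) (at level 2, format "a %:A'").
Implicit Types (u v w : Einf E) (x y : midtype E) (m n : restr M) (a b : A).
Implicit Types (S T : End).

Let aId_inj' : injective (aId M) := aId_inj faithful.

Lemma spart_aId (c : bool) a : spart c a%:A' = (spart c a)%:A'.
Proof.
rewrite -{1}(spart_sum a) aIdD spartD !(spart_homog _ (homog_aId (homog_spart _ a))).
by case: c; rewrite /= ?addr0 ?add0r.
Qed.

Lemma homog_aId_inv (c : bool) a : homog c a%:A' -> homog c a.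
Proof. by rewrite /= spart_aId => /aId_inj'. Qed.

(** [S] is a derivation of the form, relative to the derivation that it
    induces on [A]. *)
Definition leibq S : Prop :=
  forall (c d : bool) m n, homog c m -> homog d n ->
    scomm S (q m n)%:A' = (q (S m) n + sgn (c && d) (q (S n) m))%:A'.

(** The conditions defining the generators of S_E.  They are linear in [S], so
    that S_E consists of the operators that satisfy them. *)
Definition hSE S : Prop :=
  [/\ forall a, exists b, scomm S a%:A' = b%:A', leibq S
    & forall f, mid_set E f -> mid_set E (scomm S f)].

Lemma hSE0 : hSE 0.
Proof.
split=> [a|c d m n _ _|f _]; rewrite scomm0l; last exact: mid0.
  by exists 0; rewrite aId0.
by rewrite !q0l sgn0 addr0 aId0.
Qed.

Lemma hSEB S T : hSE S -> hSE T -> hSE (S - T).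
Proof.
move=> [S1 S2 S3] [T1 T2 T3]; split=> [a|c d m n hm hn|f Ef].
- have [b eb] := S1 a; have [b' eb'] := T1 a; exists (b - b').
  by rewrite scommBl eb eb' aIdB.
- rewrite scommBl (S2 _ _ _ _ hm hn) (T2 _ _ _ _ hm hn) -aIdB; congr (aId _ _).
  by rewrite !add_sEndE !opp_sEndE !qDl !qNl; zmod.
- by rewrite scommBl; apply: midD; [exact: S3|apply: midN; exact: T3].
Qed.

Lemma hSED S T : hSE S -> hSE T -> hSE (S + T).
Proof.
move=> hS hT; rewrite -[T]opprK; apply: hSEB => //.
by rewrite -sub0r; apply: hSEB => //; exact: hSE0.
Qed.

Lemma SEP S : SE E S <-> forall c : bool, hSE (spart c S).
Proof.
rewrite -(@zspan_homogP End (fun=> hSE)).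
- rewrite /SE; split; apply: zspan_ind.
  + exact: zspan0.
  + exact: zspanB.
  + move=> x [c hc [x1 x2 x3]]; apply: zspan_gen; exists c => //; split=> //.
    by move=> a b m n hm hn; rewrite -sgnME; exact: x2.
  + exact: zspan0.
  + exact: zspanB.
  + move=> x [c hc [x1 x2 x3]]; apply: zspan_gen; exists c => //; split=> //.
    by move=> a b m n hm hn; rewrite sgnME; exact: x2.
- by move=> c; exact: hSE0.
- by move=> c S1 S2; exact: hSEB.
Qed.

Lemma SE_hSE S : SE E S -> hSE S.
Proof. by move=> /SEP hS; rewrite -(spart_sum S); apply: hSED. Qed.

Lemma SE_spart (c : bool) S : SE E S -> SE E (spart c S).
Proof.
move=> /SEP hS; apply/SEP => d; rewrite spartK.
by case: eqP => // _; exact: hSE0.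
Qed.

Lemma SE_D S T : SE E S -> SE E T -> SE E (S + T).
Proof. exact: zspanD. Qed.

Lemma mid_SE : mid_set E `<=` SE E.
Proof.
move=> f Ef; apply/SEP => e; have Ee := mid_spart e Ef; have fA := mid_Alinear Ee.
split=> [a|c d m n hm hn|g Eg]; last exact: mid_scomm.
- by exists 0; rewrite (Alinear_scomm a fA) aId0.
- rewrite (Alinear_scomm _ fA) -(aId0 M); congr (aId _ _).
  by have [_ /(_ c d m n hm hn)] := mid_osp Ee; rewrite sgnME.
Qed.

Lemma SE_q (c d e : bool) S m n : leibq S -> homog c S -> homog d m -> homog e n ->
  scomm S (q m n)%:A' = (q (S m) n + sgn (c && d) (q m (S n)))%:A'.
Proof.
move=> S2 hS hm hn; rewrite (S2 _ _ _ _ hm hn); congr (aId _ (_ + _)).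
by rewrite (qC q (homog_app hS hn) hm); zmod.
Qed.

Lemma app_aId (c d : bool) S a m : homog c S -> homog d a ->
  S (a%:A' m) = scomm S a%:A' m + sgn (c && d) (a%:A' (S m)).
Proof. by move=> hS ha; rewrite (scomm_app _ hS (homog_aId ha)) subrK. Qed.

(** [S] acts on the operators E_{m,n} as a derivation because it does so on the
    form. *)
Lemma SE_Emap (c d e : bool) S m n : leibq S -> homog c S -> homog d m -> homog e n ->
  scomm S (Emap q m n) = Emap q (S m) n + sgn (c && d) (Emap q m (S n)).
Proof.
move=> S2 hS hm hn; apply: sEnd_eqh => g p hp.
rewrite (scomm_app _ hS (E_homog q hm hn)) add_sEndE sgn_sEndE.
rewrite (EmapE q hm hn hp) (EmapE q (homog_app hS hm) hn hp).
rewrite (EmapE q hm (homog_app hS hn) hp) (EmapE q hm hn (homog_app hS hp)).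
rewrite sEndB !sEnd_sgn (app_aId _ hS (q_homog q hn hp)).
rewrite (app_aId _ hS (q_homog q hm hp)).
rewrite (SE_q S2 hS hn hp) (SE_q S2 hS hm hp).
rewrite !aIdD !aId_sgn !add_sEndE !sgn_sEndE.
by zmod.
Qed.

Fact dS_sig S : {d : sEnd (Einf E) | d = dST E S 0}.
Proof. by exists (dST E S 0). Qed.

(** The derivation d_{S,0}, sealed: it is used through its four components
    only. *)
Definition dS S : sEnd (Einf E) := sval (dS_sig S).
Notation d_ S := (dS S).

Lemma dS_dST S : dST E S 0 = dS S. Proof. by rewrite /dS; case: (dS_sig S). Qed.

Lemma dSE S u : SE E S ->
  [/\ (cA (d_ S u))%:A' = scomm S (cA u)%:A', cM (d_ S u) = S (cM u),
      cN (d_ S u) = S (cN u) & cE (d_ S u) = scomm S (cE u)].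
Proof.
move=> hS; rewrite -dS_dST; case: u => [[[a m] n] x].
have L (w : Einf E) (P : A -> restr M -> restr M -> midtype E -> Prop) :
    (let: (a', m', n', x') := w in P a' m' n' x') -> P w.1.1.1 w.1.1.2 w.1.2 w.2.
  by case: w => [[[]]].
have hT : TE E 0 by exact: zspan0.
have [ea em en ex] := L _ (fun a' m' n' x' =>
  [/\ a'%:A' = endbr S a%:A' + endbr 0 (mval x), m' = S m + (0 : End) m,
      n' = S n - (0 : End) n & mval x' = endbr 0 a%:A' + endbr S (mval x)])
  (dST_E faithful a m n x hS hT).
split.
- by rewrite [LHS]ea /endbr scomm0l addr0.
- by rewrite [LHS]em zero_sEndE addr0.
- by rewrite [LHS]en zero_sEndE subr0.
- by rewrite [LHS]ex /endbr scomm0l add0r.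
Qed.

Lemma cA_dS S u : SE E S -> (cA (d_ S u))%:A' = scomm S (cA u)%:A'.
Proof. by move=> /(dSE u)[]. Qed.
Lemma cM_dS S u : SE E S -> cM (d_ S u) = S (cM u).
Proof. by move=> /(dSE u)[]. Qed.
Lemma cN_dS S u : SE E S -> cN (d_ S u) = S (cN u).
Proof. by move=> /(dSE u)[]. Qed.
Lemma cE_dS S u : SE E S -> cE (d_ S u) = scomm S (cE u).
Proof. by move=> /(dSE u)[]. Qed.

Lemma Pop_dS S u : SE E S -> Pop (d_ S u) = scomm S (Pop u).
Proof. by move=> hS; rewrite !PopE cA_dS // cE_dS // scommDr. Qed.
Lemma Qop_dS S u : SE E S -> Qop (d_ S u) = scomm S (Qop u).
Proof. by move=> hS; rewrite !QopE cA_dS // cE_dS // scommBr. Qed.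

Lemma dS_ext S (d : sEnd (Einf E)) : SE E S ->
  (forall u, [/\ (cA (d u))%:A' = scomm S (cA u)%:A', cM (d u) = S (cM u),
      cN (d u) = S (cN u) & cE (d u) = scomm S (cE u)]) -> d_ S = d.
Proof.
move=> hS hd; apply: sEnd_ext => u; have [ea em en ex] := hd u.
apply: einf_ext.
- by apply: aId_inj'; rewrite ea cA_dS.
- by rewrite em cM_dS.
- by rewrite en cN_dS.
- by rewrite ex cE_dS.
Qed.

Lemma homog_dS (c : bool) S : SE E S -> homog c S -> homog c (d_ S).
Proof.
move=> hS hc; apply/homog_endP => d u /einf_homogP[ha hm hn hx].
apply/einf_homogP; rewrite cM_dS // cN_dS // cE_dS //; split.
- apply: homog_aId_inv; rewrite cA_dS //.
  by apply: homog_scomm => //; exact: homog_aId.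
- exact: homog_app.
- exact: homog_app.
- exact: homog_scomm.
Qed.

Lemma dSD S T : SE E S -> SE E T -> d_ (S + T) = d_ S + d_ T.
Proof.
move=> hS hT; apply: dS_ext => [|u]; first exact: SE_D.
have [e1 e2 e3 e4] := dSE u hS; have [f1 f2 f3 f4] := dSE u hT.
rewrite add_sEndE; move: (d_ S u) (d_ T u) e1 e2 e3 e4 f1 f2 f3 f4.
move=> v w e1 e2 e3 e4 f1 f2 f3 f4.
by rewrite !cDE aIdD e1 e2 e3 e4 f1 f2 f3 f4 !scommDl.
Qed.

Lemma dS_spart (c : bool) S : SE E S -> spart c (d_ S) = d_ (spart c S).
Proof.
move=> hS; rewrite -{1}(spart_sum S) dSD; try exact: SE_spart.
rewrite spartD.
rewrite !(spart_homog _ (homog_dS (SE_spart _ hS) (homog_spart _ S))).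
by case: c; rewrite /= ?addr0 ?add0r.
Qed.

Lemma dSZ (k : K) S : SE E S -> SE E (k *: S) -> d_ (k *: S) = k *: d_ S.
Proof.
move=> hS hkS; apply: dS_ext => // u; rewrite !scale_sEndE.
split.
- by rewrite -[cA _]/(k *: cA (d_ S u)) aIdZ cA_dS // scommZl.
- by rewrite -[LHS]/(k *: cM (d_ S u)) cM_dS.
- by rewrite -[LHS]/(k *: cN (d_ S u)) cN_dS.
- by rewrite -[LHS]/(k *: cE (d_ S u)) cE_dS // scommZl.
Qed.

Lemma dS_scomm S T : SE E S -> SE E T -> SE E (scomm S T) ->
  d_ (scomm S T) = scomm (d_ S) (d_ T).
Proof.
move=> hS hT hST; apply: dS_ext => // u.
pose P (S0 : End) (d : sEnd (Einf E)) := [/\ (cA (d u))%:A' = scomm S0 (cA u)%:A',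
  cM (d u) = S0 (cM u), cN (d u) = S0 (cN u) & cE (d u) = scomm S0 (cE u)].
have PD S1 S2 d1 d2 : P S1 d1 -> P S2 d2 -> P (S1 + S2) (d1 + d2).
  move=> [e1 e2 e3 e4] [f1 f2 f3 f4]; rewrite /P !add_sEndE !cDE aIdD.
  by rewrite e1 e2 e3 e4 f1 f2 f3 f4 !scommDl.
suff H (a b : bool) : P (scomm (spart a S) (spart b T)) (scomm (d_ (spart a S)) (d_ (spart b T))).
  have eS : d_ S = d_ (spart false S) + d_ (spart true S).
    by rewrite -dSD; [rewrite spart_sum|exact: SE_spart|exact: SE_spart].
  have eT : d_ T = d_ (spart false T) + d_ (spart true T).
    by rewrite -dSD; [rewrite spart_sum|exact: SE_spart|exact: SE_spart].
  have eST : scomm S T = scomm (spart false S) (spart false T) +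
      scomm (spart false S) (spart true T) +
      (scomm (spart true S) (spart false T) + scomm (spart true S) (spart true T)).
    by rewrite -!scommDr -scommDl !spart_sum.
  change (P (scomm S T) (scomm (d_ S) (d_ T))).
  rewrite eST eS eT scommDl !scommDr.
  by apply: (PD); apply: (PD); exact: H.
have [Sa Tb] := (SE_spart a hS, SE_spart b hT).
have [ha hb] := (homog_spart a S, homog_spart b T).
have J f : scomm (scomm (spart a S) (spart b T)) f =
    scomm (spart a S) (scomm (spart b T) f) -
    sgn (a && b) (scomm (spart b T) (scomm (spart a S) f)).
  by rewrite (scomm_jacobi f ha hb) addrK.
have [a1 b1 c1 d1] := dSE (d_ (spart b T) u) Sa.
have [a2 b2 c2 d2] := dSE u Tb.
have [a3 b3 c3 d3] := dSE (d_ (spart a S) u) Tb.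
have [a4 b4 c4 d4] := dSE u Sa.
rewrite /P (scomm_app _ (homog_dS Sa ha) (homog_dS Tb hb)).
move: (d_ (spart a S) (d_ (spart b T) u)) (d_ (spart b T) (d_ (spart a S) u))
  a1 b1 c1 d1 a3 b3 c3 d3.
move: (d_ (spart a S) u) (d_ (spart b T) u) a2 b2 c2 d2 a4 b4 c4 d4.
move=> uS uT a2 b2 c2 d2 a4 b4 c4 d4 uST uTS a1 b1 c1 d1 a3 b3 c3 d3.
rewrite !cDE; split.
- by rewrite J aIdB aId_sgn a1 a2 a3 a4.
- by rewrite b1 b2 b3 b4 (scomm_app _ ha hb).
- by rewrite c1 c2 c3 c4 (scomm_app _ ha hb).
- by rewrite J d1 d2 d3 d4.
Qed.

(** [Pop] and [Qop] turn d_{S,0} into the bracket with [S], so that in the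
    copies of [M] the Leibniz rule is that of the commutator. *)
Lemma hder_dS (c : bool) S : SE E S -> homog c S -> hder (einf_br E) c (d_ S).
Proof.
move=> hS hc a u v hu; elim/homog_ind: v => [v v' hv hv'|b v hv].
  by rewrite !(einf_brDr, sEndD) hv hv' sgnD addrACA.
have [hau hm hn hx] := (einf_homogP a u).1 hu.
have [hav hm' hn' hx'] := (einf_homogP b v).1 hv.
have hdu := homog_app (homog_dS hS hc) hu.
have hdv := homog_app (homog_dS hS hc) hv.
have [_ S2 _] := SE_hSE hS.
apply: einf_ext; rewrite !cDE.
- apply: aId_inj'; rewrite cA_dS // !brA !cM_dS // !cN_dS //.
  rewrite !(aIdD, aIdN, aId_sgn, scommDr, scommNr).
  rewrite (SE_q S2 hc hm hn') (SE_q S2 hc hn hm') !(aIdD, aId_sgn).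
  by zmod.
- rewrite cM_dS // (brM hu hv) (brM hdu hv) (brM hu hdv) !Pop_dS // !cM_dS //.
  rewrite (scomm_app _ hc (Pop_homog hu)) (scomm_app _ hc (Pop_homog hv)).
  by rewrite sEndB sEnd_sgn; zmod.
- rewrite cN_dS // (brN hu hv) (brN hdu hv) (brN hu hdv) !Qop_dS // !cN_dS //.
  rewrite (scomm_app _ hc (Qop_homog hu)) (scomm_app _ hc (Qop_homog hv)).
  by rewrite sEndB sEnd_sgn; zmod.
- rewrite cE_dS // !brE !cM_dS // !cN_dS // !cE_dS // !scommDr.
  rewrite (SE_Emap S2 hc hm hn') (SE_Emap S2 hc hn hm') (scomm_jacobi _ hc hx).
  by zmod.
Qed.

Lemma dS_Der S : SE E S -> Der (einf_br E) (d_ S).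
Proof.
move=> hS; rewrite -(spart_sum (d_ S)) !dS_spart //; apply: zspanD.
  apply: (hder_Der (homog_dS (SE_spart _ hS) (homog_spart _ _))).
  by apply: hder_dS; [exact: SE_spart|exact: homog_spart].
apply: (hder_Der (homog_dS (SE_spart _ hS) (homog_spart _ _))).
by apply: hder_dS; [exact: SE_spart|exact: homog_spart].
Qed.

Lemma dS_mid x : d_ (mval x) = ad E (einf_mid x).
Proof.
have Sx : SE E (mval x) by apply: mid_SE; exact: mvalE.
apply: dS_ext => // u; rewrite -[ad E _ u]/(einf_br E (einf_mid x) u).
have s0 (f : End) : sapp f 0 = 0.
  by apply: (addrI (sapp f 0)); rewrite -sappDr !addr0.
rewrite brA brM_raw brN_raw brE /einf_mid /cA /cM /cN /cE /=.
rewrite !q0l subr0 aId0 (Alinear_scomm _ (mid_Alinear (mvalE x))).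
rewrite (@rscale0l A M) s0 !E0l !add0r !subr0 addr0.
split=> //; last by rewrite (@scale0r A M) oppr0 add0r.
by rewrite (@scale0r A M) add0r.
Qed.

Lemma sub_d0 (X : set End) : X `<=` SE E -> DE E `&` d0 E X = d0 E X.
Proof.
move=> XS; apply/seteqP; split=> [d []//|d [S XS0 <-]]; split; last by exists S.
by exists S; [exact: XS|exists 0 => //; exact: zspan0].
Qed.

End SDerivations.

(** * Homogeneous bases *)

Section Bases.
Variables (K : superComRingType) (A : superExtType K) (M : superLmodType A).
Notation End := (sEnd (restr M)).
Notation "a %:A'" := (aId M a) (at level 2, format "a %:A'").

(** A homogeneous basis given with its coordinate functions, so that a vector
    can be expanded over any finite set containing its support. *)
Record hbasis (X : choiceType) (B : X -> restr M) (dg : X -> bool)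
    (co : X -> restr M -> A) : Prop := HBasis {
  hb_homog : forall k, homog (dg k) (B k);
  hb_coD : forall k, {morph co k : m n / m + n};
  hb_co : forall k l a, co k (a%:A' (B l)) = if k == l then a else 0;
  hb_sum : forall m, exists F : seq X, [/\ uniq F,
    (forall k, k \notin F -> co k m = 0) & m = \sum_(k <- F) (co k m)%:A' (B k)]
}.

Variables (X : choiceType) (B : X -> restr M) (dg : X -> bool).
Variable (co : X -> restr M -> A).
Hypothesis hB : hbasis B dg co.
Implicit Types (k l : X) (m n : restr M) (f g : End) (a : A).

Lemma co0 k : co k 0 = 0.
Proof. by apply: (addrI (co k 0)); rewrite -(hb_coD hB) !addr0. Qed.
Lemma coN k m : co k (- m) = - co k m.
Proof. by apply: (addrI (co k m)); rewrite -(hb_coD hB) !subrr co0. Qed.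
Lemma coB k m n : co k (m - n) = co k m - co k n.
Proof. by rewrite (hb_coD hB) coN. Qed.
Lemma co_sgn k e m : co k (sgn e m) = sgn e (co k m).
Proof. exact: (sgn_morph e m (hb_coD hB k)). Qed.

Lemma co_eq0 m : (forall k, co k m = 0) -> m = 0.
Proof.
move=> m0; have [F [_ _ ->]] := hb_sum hB m; rewrite big1 // => k _.
by rewrite m0 aId0 zero_sEndE.
Qed.

Lemma hb_ind (P : restr M -> Prop) : P 0 -> (forall m n, P m -> P n -> P (m + n)) ->
  (forall a k, P (a%:A' (B k))) -> forall m, P m.
Proof.
move=> P0 PD PB m; have [F [_ _ ->]] := hb_sum hB m.
by apply: big_ind => // k _; exact: PB.
Qed.

Lemma hb_ext f g : (forall c a k, homog c a -> f (a%:A' (B k)) = g (a%:A' (B k))) -> f = g.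
Proof.
move=> fg; apply: sEnd_ext; apply: hb_ind => [|m n fm fn|a k].
- by rewrite !sEnd0.
- by rewrite !sEndD fm fn.
elim/(@homog_ind A): a => [a b ha hb|c a ha]; last exact: fg ha.
by rewrite aIdD add_sEndE !sEndD ha hb.
Qed.

Lemma co_basis k l : co k (B l) = if k == l then 1 else 0.
Proof. by rewrite -(hb_co hB k l 1) aId1. Qed.

Lemma co_aId k a m : co k (a%:A' m) = a * co k m.
Proof.
elim/hb_ind: m => [|m n hm hn|b l].
- by rewrite sEnd0 co0 mulr0.
- by rewrite sEndD !(hb_coD hB) hm hn mulrDr.
- by rewrite -mul_sEndE -aIdM !(hb_co hB); case: eqP; rewrite ?mulr0.
Qed.

Lemma hb_faithful k a : (forall m : M, a *: m = 0) -> a = 0.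
Proof.
move=> am; have : a%:A' (B k) = 0 by rewrite aIdE am.
by move=> /(congr1 (co k)); rewrite (hb_co hB) eqxx co0.
Qed.

Lemma Alinear_basis0 f : Alinear f -> (forall k, f (B k) = 0) -> f = 0.
Proof.
move=> fA fB; have fk k : forall c, spart c f (B k) = 0.
  move=> c; rewrite (spart_endE _ _ (hb_homog hB k)) fB //; exact: spart0.
rewrite -(spart_sum f); suff H c : spart c f = 0 by rewrite !H addr0.
apply: hb_ext => d a k ha.
rewrite (AlinearE _ (Alinear_spart c fA) (homog_spart c f) ha) fk sEnd0 sgn0.
by [].
Qed.

Variable q : quadForm M.

Lemma q_co o m : dg o = false -> (forall k, k != o -> q (B o) (B k) = 0) ->
  q (B o) m = co o m * q (B o) (B o).
Proof.
move=> do0 qo; elim/hb_ind: m => [|m n hm hn|a k].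
- by rewrite co0 q0r mul0r.
- by rewrite qDr (hb_coD hB) mulrDl hm hn.
elim/(@homog_ind A): a => [a b ha hb|c a ha].
  by rewrite aIdD add_sEndE qDr (hb_coD hB) mulrDl ha hb.
rewrite (qar q _ ha (hb_homog hB o)) do0 andbF /= (hb_co hB) eq_sym.
by case: (eqVneq k o) => [->|/qo ->] //; rewrite mulr0 mul0r.
Qed.

(** ** Operators commuting with E up to scalars are scalars *)

Variables (t : bool) (T : End).
Hypothesis hT : homog t T.
Hypothesis TA : forall a, Alinear (scomm T a%:A').
Hypothesis TE : forall m n, exists b, scomm T (Emap q m n) = b%:A'.

(** What the argument needs to know about each of the two basis vectors of the
    invertibly diagonalizable summand. *)
Record axis (o : X) : Prop := Axis {
  axis_even : dg o = false;
  axis_inv : invertible (q (B o) (B o));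
  axis_orth : forall k, k != o -> q (B o) (B k) = 0;
  axis_T : scomm T (q (B o) (B o))%:A' = Emap q (T (B o)) (B o) + Emap q (T (B o)) (B o)
}.

Lemma axis_homog o : axis o -> homog false (B o).
Proof. by case=> d0 _ _ _; rewrite -d0; exact: (hb_homog hB). Qed.

Lemma axis_orthC o k : axis o -> k != o -> q (B k) (B o) = 0.
Proof.
move=> ao ko; rewrite (qC q (hb_homog hB k) (axis_homog ao)).
by rewrite (axis_orth ao ko) sgn0.
Qed.

Lemma axis_u o : axis o -> homog false (q (B o) (B o)).
Proof. by move=> ao; have h := axis_homog ao; exact: (q_homog q h h). Qed.

Lemma axis_cancel o a b : axis o -> a * q (B o) (B o) = b * q (B o) (B o) -> a = b.
Proof.
move=> ao; have [v [uv _]] := axis_inv ao => /(congr1 (fun x => x * v)).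
by rewrite -!mulrA uv !mulr1.
Qed.

Lemma central0 u a : homog false u -> u * a = a * u.
Proof.
move=> hu; elim/(@homog_ind A): a => [a b ha hb|c a ha].
  by rewrite mulrDr mulrDl ha hb.
by rewrite (smulCE hu ha).
Qed.

(** The scalar [T, E_{o,g}] is 0, since E_{o,g} kills [B o'] and maps into the
    span of [B o] and [B g].  Applying this commutator to [B o] then determines
    [T (B g)] up to a multiple of [B o]; exchanging [o] and [o'] excludes that
    multiple. *)
Lemma axis_step o o' (g : X) : axis o -> axis o' -> o != o' -> g != o -> g != o' ->
  [/\ scomm T (Emap q (B o) (B g)) = 0, co o (T (B o')) = 0,
      co g (T (B g)) = co o (T (B o))
    & forall k, k != g -> k != o -> co k (T (B g)) = 0].
Proof.
move=> ao ao' oo' go go'; set u := q (B o) (B o); have hu := axis_u ao.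
have [[ho ho'] hg] := (axis_homog ao, axis_homog ao', hb_homog hB g).
have hE : homog (dg g) (Emap q (B o) (B g)) := E_homog q ho hg.
have [b eb] := TE (B o) (B g).
have app p : T (Emap q (B o) (B g) p) - sgn (t && dg g) (Emap q (B o) (B g) (T p)) =
    b%:A' p by rewrite -eb (scomm_app _ hT hE).
have qo m := q_co m (axis_even ao) (axis_orth ao).
have EE c p : homog c p -> Emap q (B o) (B g) p =
    (q (B g) p)%:A' (B o) - sgn (dg g && c) ((co o p * u)%:A' (B g)).
  by move=> hp; rewrite (EmapE q ho hg hp) -qo.
have hTo : homog t (T (B o)) by have := homog_app hT ho; rewrite addbF.
have hTo' : homog t (T (B o')) by have := homog_app hT ho'; rewrite addbF.
have hTg := homog_app hT hg.
have E2 : Emap q (B o) (B g) (B o') = 0.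
  rewrite (EE _ _ ho') (axis_orthC ao' go') co_basis (negPf oo') mul0r aId0.
  by rewrite !zero_sEndE sgn0 subr0.
have b0 : b = 0.
  have /(congr1 (co o')) := app (B o'); rewrite E2 sEnd0 sub0r (EE _ _ hTo').
  rewrite coN co_sgn coB co_sgn !(hb_co hB) eq_sym (negPf oo') [o' == g]eq_sym.
  by rewrite (negPf go') eqxx sgn0 subr0 sgn0 oppr0 => <-.
have TE0 : scomm T (Emap q (B o) (B g)) = 0 by rewrite eb b0 aId0.
have app0 p : T (Emap q (B o) (B g) p) = sgn (t && dg g) (Emap q (B o) (B g) (T p)).
  by apply/eqP; rewrite -subr_eq0 app b0 aId0 zero_sEndE.
have Eo : Emap q (B o) (B g) (B o) = - u%:A' (B g).
  rewrite (EE _ _ ho) (axis_orthC ao go) co_basis eqxx mul1r aId0 zero_sEndE.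
  by rewrite sub0r andbF.
have Tu : T (u%:A' (B g)) = (co o (T (B o)) * u)%:A' (B g)
    - sgn (t && dg g) ((q (B g) (T (B o)))%:A' (B o)).
  have /eqP := app0 (B o); rewrite Eo sEndN (EE _ _ hTo) eqr_oppLR => /eqP ->.
  by case: (dg g); zmod.
have rho : scomm T u%:A' (B g) = - ((q (T (B o)) (B g))%:A' (B o) +
    (q (T (B o)) (B g))%:A' (B o)).
  rewrite axis_T // add_sEndE (EmapE q hTo ho hg) (axis_orth ao go) aId0 zero_sEndE.
  by rewrite sgn0 sub0r opprD.
have Tg : u%:A' (T (B g)) = (co o (T (B o)) * u)%:A' (B g)
    - sgn (t && dg g) ((q (B g) (T (B o)))%:A' (B o))
    + ((q (T (B o)) (B g))%:A' (B o) + (q (T (B o)) (B g))%:A' (B o)).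
  have := app_aId (B g) hT hu; rewrite Tu rho andbF -[sgn false _]/(u%:A' _) => ->.
  by zmod.
split=> //.
- have := app0 (B o'); rewrite E2 sEnd0 (EE _ _ hTo') => /(congr1 (co g)).
  rewrite co0 co_sgn coB co_sgn !(hb_co hB) (negPf go) eqxx sub0r => /esym e0.
  apply: (axis_cancel ao); rewrite mul0r; move: e0.
  case: (t && dg g); case: (dg g && t); rewrite /sgn ?opprK //.
  + by move=> /eqP; rewrite oppr_eq0 => /eqP.
  + by move=> /eqP; rewrite oppr_eq0 => /eqP.
- apply: (axis_cancel ao); rewrite -/u -(central0 _ hu) -co_aId Tg.
  rewrite !(hb_coD hB) coN co_sgn !(hb_co hB) (negPf go) eqxx sgn0; zmod.
- move=> k kg ko; apply: (axis_cancel ao); rewrite -/u -(central0 _ hu) -co_aId Tg.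
  rewrite !(hb_coD hB) coN co_sgn !(hb_co hB) (negPf ko) (negPf kg) sgn0 mul0r; zmod.
Qed.

(** The same argument with E_{o,o'}, whose commutator with [T] vanishes on a
    third basis vector [g]. *)
Lemma axis_pair o o' (g : X) : axis o -> axis o' -> o != o' -> g != o -> g != o' ->
  [/\ scomm T (Emap q (B o) (B o')) = 0, T (B o) = (co o (T (B o)))%:A' (B o)
    & forall k, k != o -> k != o' -> T (B k) = (co o (T (B o)))%:A' (B k)].
Proof.
move=> ao ao' oo' go go'; have o'o : o' != o by rewrite eq_sym.
have [[ho ho'] hg] := (axis_homog ao, axis_homog ao', hb_homog hB g).
set u := q (B o) (B o); set u' := q (B o') (B o').
have hu := axis_u ao; have hu' := axis_u ao'.
have hE : homog false (Emap q (B o) (B o')) := E_homog q ho ho'.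
have EE p : Emap q (B o) (B o') p =
    (co o' p * u')%:A' (B o) - (co o p * u)%:A' (B o').
  elim/(@homog_ind (restr M)): p => [p p' hp hp'|c p hp].
    by rewrite sEndD !(hb_coD hB) !mulrDl !aIdD !add_sEndE hp hp'; zmod.
  rewrite (EmapE q ho ho' hp) (q_co p (axis_even ao) (axis_orth ao)).
  by rewrite (q_co p (axis_even ao') (axis_orth ao')).
have [b eb] := TE (B o) (B o').
have app p : T (Emap q (B o) (B o') p) - Emap q (B o) (B o') (T p) = b%:A' p.
  by rewrite -eb (scomm_app _ hT hE) andbF.
have b0 : b = 0.
  have /(congr1 (co g)) := app (B g); rewrite !EE !co_basis.
  rewrite ![_ == g]eq_sym (negPf go) (negPf go') !mul0r aId0 !zero_sEndE subr0 sEnd0.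
  by rewrite sub0r coN coB !(hb_co hB) (negPf go) (negPf go') eqxx subr0 oppr0.
have TE0 : scomm T (Emap q (B o) (B o')) = 0 by rewrite eb b0 aId0.
have app0 p : T (Emap q (B o) (B o') p) = Emap q (B o) (B o') (T p).
  by apply/eqP; rewrite -subr_eq0 app b0 aId0 zero_sEndE.
have [_ co1 eg _] := axis_step ao ao' oo' go go'.
have [_ co2 eg' _] := axis_step ao' ao o'o go' go.
have hTo' : homog t (T (B o')) by have := homog_app hT ho'; rewrite addbF.
split=> //.
- apply/eqP; rewrite -subr_eq0; apply/eqP/co_eq0 => k.
  have Eo' : Emap q (B o) (B o') (B o') = u'%:A' (B o).
    by rewrite EE !co_basis eqxx (negPf oo') mul1r mul0r aId0 zero_sEndE subr0.
  have rho : scomm T u'%:A' (B o) = 0.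
    rewrite axis_T // add_sEndE (EmapE q hTo' ho' ho) (axis_orth ao' oo') aId0 zero_sEndE.
    rewrite (qC q hTo' ho) (q_co _ (axis_even ao) (axis_orth ao)) co1 mul0r !sgn0 aId0.
    by rewrite zero_sEndE sgn0 subr0 addr0.
  have := app_aId (B o) hT hu'; rewrite -Eo' app0 EE co1 mul0r aId0 zero_sEndE subr0.
  rewrite rho add0r andbF -[sgn false _]/(u'%:A' _) => e.
  apply: (axis_cancel ao'); rewrite -/u' mul0r coB co_aId mulrBl.
  have ek : co k (T (B o)) * u' = co k ((co o' (T (B o')) * u')%:A' (B o)).
    by rewrite -(central0 _ hu') -co_aId -e.
  rewrite ek -eg' eg (hb_co hB) co_basis.
  by case: eqP => _; rewrite ?mulr0 ?mul0r ?mulr1 subrr.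
- move=> k ko ko'; apply/eqP; rewrite -subr_eq0; apply/eqP/co_eq0 => l.
  have [_ _ ek zk] := axis_step ao ao' oo' ko ko'.
  have [_ _ ek' zk'] := axis_step ao' ao o'o ko' ko.
  rewrite coB (hb_co hB); case: (eqVneq l k) => [->|lk]; first by rewrite ek subrr.
  rewrite subr0; case: (eqVneq l o) => [->|lo]; last by rewrite zk.
  by rewrite zk' // eq_sym.
Qed.

(** [T] acts on all basis vectors by one scalar, and it remains to see that it
    supercommutes with [A]: this is the purpose of [kill]. *)
Lemma T_scalar o o' (g : X) : axis o -> axis o' -> o != o' -> g != o -> g != o' ->
  exists2 a, homog t a & T = a%:A'.
Proof.
move=> ao ao' oo' go go'; have o'o : o' != o by rewrite eq_sym.
have [E0 To Tk] := axis_pair ao ao' oo' go go'.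
have [E0' To' Tk'] := axis_pair ao' ao o'o go' go.
have [[ho ho'] hg] := (axis_homog ao, axis_homog ao', hb_homog hB g).
have [_ _ eg _] := axis_step ao ao' oo' go go'.
have [_ _ eg' _] := axis_step ao' ao o'o go' go.
pose al := co o (T (B o)); have eal : co o' (T (B o')) = al by rewrite -eg' eg.
have TB k : T (B k) = al%:A' (B k).
  case: (eqVneq k o) => [->|ko]; first exact: To.
  by case: (eqVneq k o') => [->|ko']; [rewrite {1}To' eal|exact: Tk].
have hTo : homog t (T (B o)) by have := homog_app hT ho; rewrite addbF.
have hal : homog t al.
  have [uV _] := rinvP (axis_inv ao).
  have -> : al = q (B o) (T (B o)) * rinv (q (B o) (B o)).
    by rewrite (q_co _ (axis_even ao) (axis_orth ao)) -mulrA uV mulr1.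
  rewrite -[t]addbF; apply: homogM; first exact: (q_homog q ho hTo).
  by apply: homog_rinv; [exact: axis_u|exact: axis_inv].
exists al => //.
(* [T, a E] = [T, a] E is again a scalar, and it vanishes on a basis vector. *)
have kill c a i k l : homog c a -> axis i -> k != i -> l != i -> l != k ->
    q (B k) (B l) = 0 -> scomm T (Emap q (B i) (B k)) = 0 -> scomm T a%:A' (B k) = 0.
  move=> ha ai ki li lk qkl Eik; have [b eb] := TE (a%:A' (B i)) (B k).
  have app p : scomm T a%:A' (Emap q (B i) (B k) p) = b%:A' p.
    rewrite -eb Eal (scommMr _ hT (homog_aId ha)) Eik mulr0 sgn0 addr0.
    by rewrite mul_sEndE.
  have hi := axis_homog ai; have hk := hb_homog hB k.
  have b0 : b = 0.
    have /(congr1 (co l)) := app (B l); rewrite (EmapE q hi hk (hb_homog hB l)).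
    rewrite qkl (axis_orth ai li) aId0 !zero_sEndE !sgn0 subr0 sEnd0 co0.
    by rewrite (hb_co hB) eqxx => <-.
  have := app (B i); rewrite b0 aId0 zero_sEndE (EmapE q hi hk hi) (axis_orthC ai ki).
  rewrite aId0 zero_sEndE sgn0 sub0r andbF -[sgn false _]/(_%:A' _) sEndN => /eqP.
  rewrite oppr_eq0 => /eqP.
  rewrite (AlinearE _ (TA a) (homog_scomm hT (homog_aId ha)) (axis_u ai)) andbF.
  rewrite -[sgn false _]/(_%:A' _) => /(congr1 ((rinv (q (B i) (B i)))%:A' : End)).
  rewrite sEnd0 -mul_sEndE -aIdM; have [_ ->] := rinvP (axis_inv ai).
  by rewrite aId1.
have rho c a : homog c a -> scomm T a%:A' = 0.
  move=> ha; apply: Alinear_basis0 => // k.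
  case: (eqVneq k o) => [->|ko].
    by apply: (kill c a o' o g) => //; rewrite ?(axis_orth ao go).
  case: (eqVneq k o') => [->|ko'].
    by apply: (kill c a o o' g) => //; rewrite ?(axis_orth ao' go').
  have [Ek _ _ _] := axis_step ao ao' oo' ko ko'.
  by apply: (kill c a o k o') => //; rewrite ?(axis_orthC ao' ko') // eq_sym.
apply: hb_ext => c a k ha; rewrite (app_aId _ hT ha) (rho _ _ ha) zero_sEndE add0r TB.
rewrite -!mul_sEndE -!aIdM (smulCE ha hal) aId_sgn sgn_sEndE.
by zmod.
Qed.

End Bases.

(** * Every derivation is inner up to some d_{S,0} *)

Section Half.
Variables (K : superComRingType) (V : lmodType K).
Hypothesis half : invertible (2%:R : K).

Definition hlf : K := rinv (2%:R : K).

Lemma hlfD (v : V) : hlf *: (v + v) = v.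
Proof.
have [_ h2] := rinvP half; rewrite -mulr2n -scaler_nat scalerA.
by rewrite /hlf h2 scale1r.
Qed.

Lemma twice_inj (v w : V) : v + v = w + w -> v = w.
Proof. by move=> vw; rewrite -(hlfD v) vw hlfD. Qed.

Lemma twice0 (v : V) : v + v = 0 -> v = 0.
Proof. by move=> v0; apply: twice_inj; rewrite v0 addr0. Qed.

Lemma hlf_sum (v w : V) : hlf *: (v + w) + hlf *: (v - w) = v.
Proof. by rewrite -scalerDr addrACA subrr addr0 hlfD. Qed.

Lemma hlf_diff (v w : V) : hlf *: (v + w) - hlf *: (v - w) = w.
Proof.
rewrite -scalerBr (_ : v + w - (v - w) = w + w) ?hlfD //; zmod.
Qed.

Lemma homog_hlf : homog false hlf.
Proof.
by apply: homog_rinv => //; have h := @homog1 K; exact: homogD.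
Qed.
End Half.

Section Decomposition.
Variables (K : superComRingType) (A : superExtType K) (M : superLmodType A).
Variables (q : quadForm M) (E : midalg q).
Hypothesis half : invertible (2%:R : K).
Hypothesis faithful : forall a : A, (forall m : M, a *: m = 0) -> a = 0.
Notation End := (sEnd (restr M)).
Notation "a %:A'" := (aId M a) (at level 2, format "a %:A'").
Implicit Types (u v w : Einf E) (x y : midtype E) (m n : restr M) (a b : A).

Lemma aId_Alinear a : Alinear a%:A'.
Proof. by move=> m b; exact: (@scale_rscaleA A M). Qed.

Lemma scomm_aId_Alinear a (f : End) : Alinear f -> scomm a%:A' f = 0.
Proof.
move=> fA; elim/(@homog_ind A): a => [a b ha hb|c a ha].
  by rewrite aIdD scommDl ha hb addr0.
rewrite -(spart_sum f) scommDr.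
have H e : scomm a%:A' (spart e f) = 0.
  rewrite (scommC (homog_aId ha) (homog_spart e f)).
  by rewrite (Alinear_scomm a (Alinear_spart e fA)) sgn0 oppr0.
by rewrite !H addr0.
Qed.

Definition inA a : Einf E := mkE a 0 0 0.
Definition inM m : Einf E := mkE 0 m 0 0.
Definition inN n : Einf E := mkE 0 0 n 0.
Definition inX x : Einf E := mkE 0 0 0 x.
(** The element 1 of [A]: its adjoint action grades [Einf E], with degree 0 on
    [A] and [E], and degrees 1 and -1 on the two copies of [M]. *)
Definition zeta : Einf E := inA 1.

Lemma cE_mk a m n x : cE (mkE a m n x) = mval x. Proof. by []. Qed.
Lemma mval0 : mval (0 : midtype E) = 0. Proof. by []. Qed.

Lemma einf_split u : u = inA (cA u) + inM (cM u) + inN (cN u) + inX u.2.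
Proof.
apply: einf_ext; rewrite !cDE.
- by rewrite /= !addr0.
- by rewrite /= add0r !addr0.
- by rewrite /= !add0r addr0.
- by rewrite !cE_mk !mval0 !add0r.
Qed.

Lemma rscale_einf u (k : K) : rscale u k =
  mkE (rscale (cA u) k) (rscale (cM u) k) (rscale (cN u) k) (rscale u.2 k).
Proof.
rewrite [LHS](@rscale_pair K (A * restr M * restr M)%type (midtype E)).
by rewrite (@rscale_pair K (A * restr M)%type (restr M)) (@rscale_pair K A (restr M)).
Qed.

Lemma homog_mk (c : bool) a m n x : homog c a -> homog c m -> homog c n -> homog c x ->
  homog c (mkE a m n x).
Proof. by move=> ha hm hn /homog_mid hx; apply/einf_homogP. Qed.

Lemma homog_inA (c : bool) a : homog c a -> homog c (inA a).
Proof. by move=> ha; apply: homog_mk => //; exact: homog0. Qed.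
Lemma homog_inM (c : bool) m : homog c m -> homog c (inM m).
Proof. by move=> ha; apply: homog_mk => //; exact: homog0. Qed.
Lemma homog_inN (c : bool) m : homog c m -> homog c (inN m).
Proof. by move=> ha; apply: homog_mk => //; exact: homog0. Qed.
Lemma homog_zeta : homog false zeta.
Proof. apply: homog_inA; exact: homog1. Qed.

Let sapp0r (f : End) : sapp f 0 = 0.
Proof. by apply: (addrI (sapp f 0)); rewrite -sappDr !addr0. Qed.
Let sapp0l m : sapp (0 : End) m = 0.
Proof. by apply: (addrI (sapp 0 m)); rewrite -sappDl !addr0. Qed.
Let rs0r m : rscale (m : M) (0 : A) = 0.
Proof. by apply: (addrI (rscale (m : M) 0)); rewrite -rscaleDr !addr0. Qed.
Let rs0l a : rscale (0 : M) a = 0. Proof. exact: rscale0l. Qed.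

Lemma Pop_mk a m n x : Pop (mkE a m n x) = a%:A' + mval x. Proof. exact: PopE. Qed.
Lemma Qop_mk a m n x : Qop (mkE a m n x) = mval x - a%:A'. Proof. exact: QopE. Qed.
Lemma cA_mk a m n x : cA (mkE a m n x) = a. Proof. by []. Qed.
Lemma cM_mk a m n x : cM (mkE a m n x) = m. Proof. by []. Qed.
Lemma cN_mk a m n x : cN (mkE a m n x) = n. Proof. by []. Qed.
Definition mkDE := (cA_mk, cM_mk, cN_mk, cE_mk, mval0).

Lemma PopD u v : Pop (u + v) = Pop u + Pop v.
Proof. by rewrite !PopE !cDE aIdD addrACA. Qed.
Lemma QopD u v : Qop (u + v) = Qop u + Qop v.
Proof. by rewrite !QopE !cDE aIdD opprD addrACA. Qed.

Lemma br_inM u m : [/\ cA (einf_br E u (inM m)) = - q (cN u) m,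
  cM (einf_br E u (inM m)) = Pop u m, cN (einf_br E u (inM m)) = 0 &
  cE (einf_br E u (inM m)) = Emap q (cN u) m].
Proof.
rewrite brA brM_raw brN_raw brE /inM !mkDE q0r sub0r rs0r sapp0l !subr0 PopE add_sEndE.
by rewrite !sEnd0 rs0r sapp0l oppr0 !addr0 E0r scomm0r add0r addr0.
Qed.

Lemma br_inN u n : [/\ cA (einf_br E u (inN n)) = q (cM u) n,
  cM (einf_br E u (inN n)) = 0, cN (einf_br E u (inN n)) = Qop u n &
  cE (einf_br E u (inN n)) = Emap q (cM u) n].
Proof.
rewrite brA brM_raw brN_raw brE /inN !mkDE q0r subr0 rs0r sapp0l !subr0 QopE add_sEndE.
rewrite !sEnd0 rs0r sapp0l !subr0 addr0 opp_sEndE E0r scomm0r !addr0.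
by rewrite [- _ + _]addrC.
Qed.

Lemma br_zeta u : einf_br E zeta u = mkE 0 (cM u) (- cN u) 0.
Proof.
apply: einf_ext; rewrite ?brA ?brM_raw ?brN_raw ?brE /zeta /inA !mkDE.
- by rewrite !q0l subr0.
- by rewrite aId1 rs0l sapp0r zero_sEndE !subr0 addr0.
- by rewrite aId1 rs0l sapp0r zero_sEndE !addr0 subr0.
- by rewrite !E0l scomm0l !addr0.
Qed.

Definition L0 u : Prop := cM u = 0 /\ cN u = 0.

Lemma L0_inA a : L0 (inA a). Proof. by []. Qed.
Lemma L0_inX x : L0 (inX x). Proof. by []. Qed.

Lemma L0_spart (e : bool) u : L0 u -> L0 (spart e u).
Proof.
move=> [um un]; split.
  by rewrite -[LHS]/(spart e (cM u)) um spart0.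
by rewrite -[LHS]/(spart e (cN u)) un spart0.
Qed.

Lemma br_L0M u m : L0 u -> einf_br E u (inM m) = inM (Pop u m).
Proof.
move=> [_ un]; have [e1 e2 e3 e4] := br_inM u m.
apply: einf_ext; rewrite ?e1 ?e2 ?e3 ?e4 /inM !mkDE ?un ?q0l ?oppr0 ?E0l //.
Qed.

Lemma br_L0N u n : L0 u -> einf_br E u (inN n) = inN (Qop u n).
Proof.
move=> [um _]; have [e1 e2 e3 e4] := br_inN u n.
apply: einf_ext; rewrite ?e1 ?e2 ?e3 ?e4 /inN !mkDE ?um ?q0l ?E0l //.
Qed.

(** ** Derivations mapping 1 into A (+) E *)

Section Graded.
Variables (c : bool) (d : sEnd (Einf E)).
Hypothesis (hc : homog c d) (hd : hder (einf_br E) c d) (dz : L0 (d zeta)).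

Let dzeta u : d (einf_br E zeta u) = einf_br E (d zeta) u + einf_br E zeta (d u).
Proof. by rewrite (hd u homog_zeta) andbF. Qed.

(* Up to the bracket with d zeta, d commutes with the grading; comparing the
   components of d [zeta, y] for y in a copy of M shows that d zeta kills M and
   that d y stays in that copy. *)
Let dM m : cA (d (inM m)) = 0 /\ cN (d (inM m)) = 0 /\ cE (d (inM m)) = 0 /\
  Pop (d zeta) m = 0.
Proof.
have := dzeta (inM m); rewrite !br_zeta (br_L0M _ dz).
rewrite /inM !mkDE oppr0 -/(inM m).
move: (d (inM m)) => w e.
have := congr1 (@cM _ _ _ _ _) e; rewrite !cDE !mkDE => /esym/eqP.
rewrite -subr_eq0 addrK => /eqP ->.
have := congr1 (@cA _ _ _ _ _) e; rewrite !cDE !mkDE addr0 => ->.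
have := congr1 (@cE _ _ _ _ _) e; rewrite !cDE !mkDE addr0 => ->.
have := congr1 (@cN _ _ _ _ _) e; rewrite !cDE !mkDE add0r => eN.
by split=> //; split=> //; apply: (twice0 half); rewrite {1}eN addNr.
Qed.

Let dN n : cA (d (inN n)) = 0 /\ cM (d (inN n)) = 0 /\ cE (d (inN n)) = 0 /\
  Qop (d zeta) n = 0.
Proof.
have := dzeta (inN n); rewrite !br_zeta (br_L0N _ dz).
have -> : mkE 0 (cM (inN n)) (- cN (inN n)) 0 = - inN n :> Einf E.
  by apply: einf_ext; rewrite !cDE /inN !mkDE ?oppr0.
rewrite sEndN; move: (d (inN n)) => w e.
have := congr1 (@cN _ _ _ _ _) e; rewrite !cDE !mkDE => /esym/eqP.
rewrite -subr_eq0 opprK addrNK => /eqP ->.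
have := congr1 (@cA _ _ _ _ _) e; rewrite !cDE !mkDE addr0 => /eqP; rewrite oppr_eq0 => /eqP ->.
have := congr1 (@cE _ _ _ _ _) e; rewrite !cDE !mkDE addr0 => /eqP; rewrite oppr_eq0 => /eqP ->.
have := congr1 (@cM _ _ _ _ _) e; rewrite !cDE !mkDE add0r => eM.
by split=> //; split=> //; apply: (twice0 half); rewrite -{1}eM addNr.
Qed.

Let dz0 : d zeta = 0.
Proof.
have [zm zn] := dz.
have P0 : Pop (d zeta) = 0 by apply: sEnd_ext => m; have [_ [_ []]] := dM m.
have Q0 : Qop (d zeta) = 0 by apply: sEnd_ext => m; have [_ [_ []]] := dN m.
have za : cA (d zeta) = 0.
  apply: (aId_inj faithful); rewrite aId0; apply: (twice0 half).
  have := congr2 (fun f g => f - g) P0 Q0; rewrite PopE QopE subr0 => <-.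
  by zmod.
apply: einf_ext => //; move: P0; rewrite PopE za aId0 add0r => ->; exact: esym mval0.
Qed.

Let dL0 u : L0 u -> L0 (d u).
Proof.
case=> um un; have := dzeta u; rewrite !br_zeta dz0 um un oppr0.
have -> : einf_br E 0 (u : Einf E) = 0.
  by apply: (addrI (einf_br E 0 u)); rewrite -einf_brDl !addr0.
have -> : mkE 0 0 0 0 = 0 :> Einf E by [].
rewrite sEnd0 add0r; move: (d u) => w e; split.
  by have := congr1 (@cM _ _ _ _ _) e; rewrite mkDE.
have := congr1 (@cN _ _ _ _ _) e; rewrite mkDE => /esym/eqP.
by rewrite oppr_eq0 => /eqP.
Qed.

Lemma inM_D m n : inM (m + n) = inM m + inM n.
Proof. by apply: einf_ext; rewrite !cDE /inM !mkDE ?addr0. Qed.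
Lemma inN_D m n : inN (m + n) = inN m + inN n.
Proof. by apply: einf_ext; rewrite !cDE /inN !mkDE ?addr0. Qed.
Lemma inM_rscale m (k : K) : inM (rscale m k) = rscale (inM m) k.
Proof. by rewrite rscale_einf /inM !mkDE !rscale0l. Qed.
Lemma inN_rscale m (k : K) : inN (rscale m k) = rscale (inN m) k.
Proof. by rewrite rscale_einf /inN !mkDE !rscale0l. Qed.

Let U_klin : klinearb (fun m : restr M => cM (d (inM m))).
Proof.
apply/asboolP; split=> [m n|m k]; first by rewrite inM_D sEndD.
by rewrite inM_rscale sEnd_rscale rscale_einf.
Qed.
Let V_klin : klinearb (fun m : restr M => cN (d (inN m))).
Proof.
apply/asboolP; split=> [m n|m k]; first by rewrite inN_D sEndD.
by rewrite inN_rscale sEnd_rscale rscale_einf.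
Qed.
Let U : End := SEnd U_klin.
Let V : End := SEnd V_klin.

Let UE m : d (inM m) = inM (U m).
Proof.
by have [? [? [? _]]] := dM m; apply: einf_ext; rewrite // /inM !mkDE.
Qed.
Let VE m : d (inN m) = inN (V m).
Proof.
by have [? [? [? _]]] := dN m; apply: einf_ext; rewrite // /inN !mkDE.
Qed.

Let hU : homog c U.
Proof.
apply/homog_endP => e m hm.
by have /einf_homogP[_ ? _ _] := homog_app hc (homog_inM hm).
Qed.
Let hV : homog c V.
Proof.
apply/homog_endP => e m hm.
by have /einf_homogP[_ _ ? _] := homog_app hc (homog_inN hm).
Qed.

Lemma graded_der_UV : exists UV : End * End,
  [/\ forall m, d (inM m) = inM (UV.1 m), forall m, d (inN m) = inN (UV.2 m),
      homog c UV.1, homog c UV.2 & forall u, L0 u -> L0 (d u)].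
Proof. by exists (U, V). Qed.

End Graded.

(** Let [U] and [V] be the restrictions of [d] to the copies of [M], [S] their
    half sum and [T] their half difference.  The brackets with [S] and [T] are
    the diagonal and the off-diagonal part of [d] on [A] and [E].  The values of
    [d] on the brackets [m, n] give identities whose super symmetric parts in
    [m], [n] are the conditions on [S] and on [T].  Once [T] is known to be the
    multiplication by some [a], it is the contribution of the inner derivation
    by [a]. *)
Section GradedST.
Variables (c : bool) (d : sEnd (Einf E)) (S T U V : End).
Hypothesis (hd : hder (einf_br E) c d).
Hypothesis (dL0 : forall u, L0 u -> L0 (d u)).
Hypotheses (UE : forall m, d (inM m) = inM (U m)) (VE : forall m, d (inN m) = inN (V m)).
Hypotheses (hU : homog c U) (hV : homog c V) (hS : homog c S) (hT : homog c T).
Hypotheses (UST : U = S + T) (VST : V = S - T).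

Let UPop u : L0 u -> scomm U (Pop u) = Pop (d u).
Proof.
have H (e : bool) w : homog e w -> L0 w -> scomm U (Pop w) = Pop (d w).
  move=> hw w0; apply: sEnd_ext => m; rewrite (scomm_app _ hU (Pop_homog hw)).
  have := hd (inM m) hw; rewrite UE !(br_L0M _ w0) UE (br_L0M _ (dL0 w0)).
  move=> /(congr1 (@cM _ _ _ _ _)); rewrite !cDE /inM !mkDE => ->.
  by rewrite addrK.
move=> u0; rewrite -(spart_sum u) sEndD !PopD scommDr.
by congr (_ + _); exact: H (homog_spart _ _) (L0_spart _ u0).
Qed.

Let VQop u : L0 u -> scomm V (Qop u) = Qop (d u).
Proof.
have H (e : bool) w : homog e w -> L0 w -> scomm V (Qop w) = Qop (d w).
  move=> hw w0; apply: sEnd_ext => m; rewrite (scomm_app _ hV (Qop_homog hw)).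
  have := hd (inN m) hw; rewrite VE !(br_L0N _ w0) VE (br_L0N _ (dL0 w0)).
  move=> /(congr1 (@cN _ _ _ _ _)); rewrite !cDE /inN !mkDE => ->.
  by rewrite addrK.
move=> u0; rewrite -(spart_sum u) sEndD !QopD scommDr.
by congr (_ + _); exact: H (homog_spart _ _) (L0_spart _ u0).
Qed.

Let SA a : scomm S a%:A' = (cA (d (inA a)))%:A'.
Proof.
have e1 := UPop (L0_inA a); have e2 := VQop (L0_inA a).
rewrite Pop_mk addr0 PopE in e1; rewrite Qop_mk sub0r scommNr QopE in e2.
apply: (twice_inj half); transitivity (scomm (S + T) a%:A' + scomm (S - T) a%:A').
  by rewrite scommDl scommBl; zmod.
rewrite -UST -VST e1 -[X in _ + X]opprK e2; zmod.
Qed.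

Let TA a : scomm T a%:A' = cE (d (inA a)).
Proof.
have e1 := UPop (L0_inA a); have e2 := VQop (L0_inA a).
rewrite Pop_mk addr0 PopE in e1; rewrite Qop_mk sub0r scommNr QopE in e2.
apply: (twice_inj half); transitivity (scomm (S + T) a%:A' - scomm (S - T) a%:A').
  by rewrite scommDl scommBl; zmod.
by rewrite -UST -VST e1 e2; zmod.
Qed.

Let SX x : scomm S (mval x) = cE (d (inX x)).
Proof.
have e1 := UPop (L0_inX x); have e2 := VQop (L0_inX x).
rewrite Pop_mk aId0 add0r PopE in e1; rewrite Qop_mk aId0 subr0 QopE in e2.
apply: (twice_inj half); transitivity (scomm (S + T) (mval x) + scomm (S - T) (mval x)).
  by rewrite scommDl scommBl; zmod.
by rewrite -UST -VST e1 e2; zmod.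
Qed.

Let TX x : scomm T (mval x) = (cA (d (inX x)))%:A'.
Proof.
have e1 := UPop (L0_inX x); have e2 := VQop (L0_inX x).
rewrite Pop_mk aId0 add0r PopE in e1; rewrite Qop_mk aId0 subr0 QopE in e2.
apply: (twice_inj half); transitivity (scomm (S + T) (mval x) - scomm (S - T) (mval x)).
  by rewrite scommDl scommBl; zmod.
by rewrite -UST -VST e1 e2; zmod.
Qed.

Let dMN (e f : bool) m n : homog e m -> homog f n ->
  scomm S (q m n)%:A' + scomm T (Emap q m n) =
    (q (U m) n + sgn (c && e) (q m (V n)))%:A' /\
  scomm T (q m n)%:A' + scomm S (Emap q m n) =
    Emap q (U m) n + sgn (c && e) (Emap q m (V n)).
Proof.
move=> hm hn; have := hd (inN n) (homog_inM hm); rewrite UE VE.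
have -> : einf_br E (inM m) (inN n) = inA (q m n) + inX (midE E m n).
  have [e1 e2 e3 e4] := br_inN (inM m) n.
  apply: einf_ext; rewrite ?e1 ?e2 ?e3 ?e4 !cDE /inA /inX /inM !mkDE ?addr0 ?add0r //.
  by rewrite Qop_mk mval0 aId0 subr0 zero_sEndE.
rewrite sEndD SA TA; have := SX (midE E m n); have := TX (midE E m n).
rewrite /= => -> -> ed.
have [e1 _ _ e4] := br_inN (inM (U m)) n; have [f1 _ _ f4] := br_inN (inM m) (V n).
split; [have := congr1 (@cA _ _ _ _ _) ed|have := congr1 (@cE _ _ _ _ _) ed];
  rewrite !cDE.
  by rewrite e1 f1 /inM !mkDE -aIdD => ->.
by rewrite e4 f4 /inM !mkDE => ->.
Qed.

Let S2 (e f : bool) m n : homog e m -> homog f n ->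
  scomm S (q m n)%:A' = (q (S m) n + sgn (e && f) (q (S n) m))%:A'.
Proof.
move=> hm hn; have [i1 _] := dMN hm hn; have [i2 _] := dMN hn hm.
apply: (twice_inj half).
have -> : scomm S (q m n)%:A' + scomm S (q m n)%:A' =
    (scomm S (q m n)%:A' + scomm T (Emap q m n)) +
    sgn (e && f) (scomm S (q n m)%:A' + scomm T (Emap q n m)).
  rewrite (qC q hn hm) (EC q hn hm) aId_sgn scomm_sgnr scommNr scomm_sgnr; zmod.
rewrite i1 i2 (qC q hm (homog_app hV hn)) (qC q hn (homog_app hV hm)).
rewrite UST VST !(add_sEndE, opp_sEndE, qDl, qNl) !(aIdD, aIdN, aId_sgn).
by zmod.
Qed.

Let T2 (e f : bool) m n : homog e m -> homog f n ->
  scomm T (q m n)%:A' = Emap q (T m) n + sgn (e && f) (Emap q (T n) m).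
Proof.
move=> hm hn; have [_ i1] := dMN hm hn; have [_ i2] := dMN hn hm.
apply: (twice_inj half).
have -> : scomm T (q m n)%:A' + scomm T (q m n)%:A' =
    (scomm T (q m n)%:A' + scomm S (Emap q m n)) +
    sgn (e && f) (scomm T (q n m)%:A' + scomm S (Emap q n m)).
  rewrite (qC q hn hm) (EC q hn hm) aId_sgn scomm_sgnr scommNr scomm_sgnr; zmod.
rewrite i1 i2 (EC q hm (homog_app hV hn)) (EC q hn (homog_app hV hm)).
rewrite UST VST !(add_sEndE, opp_sEndE, EDl, ENl).
by zmod.
Qed.

Hypothesis scalars : forall T' : End, homog c T' ->
  (forall a, Alinear (scomm T' a%:A')) ->
  (forall m n, exists b, scomm T' (Emap q m n) = b%:A') ->
  (forall (e f : bool) m n, homog e m -> homog f n ->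
     scomm T' (q m n)%:A' = Emap q (T' m) n + sgn (e && f) (Emap q (T' n) m)) ->
  exists2 a, homog c a & T' = a%:A'.

Lemma graded_der_ST : exists a, exists2 S', SE E S' & d = ad E (inA a) + dS E S'.
Proof.
have [|||al hal eT] := scalars hT.
- by move=> a; rewrite TA; apply: mid_Alinear; exact: cE_mid.
- by move=> m n; have := TX (midE E m n) => /= ->; eexists.
- exact: T2.
have SES : SE E S.
  apply/SEP => e; rewrite (spart_homog _ hS); case: eqP => _; last exact: hSE0.
  split=> [a||]; first by eexists; exact: SA.
  - by move=> f g m n hm hn; exact: S2 hm hn.
  - by move=> f Ef; have /= -> := SX (toMid Ef); exact: cE_mid.
exists al, S => //; apply/eqP; rewrite addrC -subr_eq; apply/eqP/esym.
apply: dS_ext => // u; rewrite !add_sEndE opp_sEndE !cDE.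
have adE' w : ad E (inA al) w = einf_br E (inA al) w by [].
have TA0 a : cE (d (inA a)) = 0.
  by rewrite -TA eT (Alinear_scomm a (aId_Alinear al)).
have TX0 x : cA (d (inX x)) = 0.
  apply: (aId_inj faithful); rewrite -TX eT aId0 scomm_aId_Alinear //.
  exact: mid_Alinear (mvalE x).
have [[m0 n0] [m1 n1]] := (dL0 (L0_inA (cA u)), dL0 (L0_inX u.2)).
rewrite adE' brA brM_raw brN_raw brE /inA !mkDE !q0l subrr subr0.
rewrite rs0l sapp0r !E0l scomm0l !zero_sEndE !addr0 !subr0 -eT.
rewrite [in d u](einf_split u) !sEndD !cDE UE VE SA SX TA0 TX0 m0 n0 m1 n1.
rewrite /inM /inN !mkDE !(addr0, add0r) opprK UST VST add_sEndE.
by rewrite [(S - T) _]add_sEndE opp_sEndE; split=> //; zmod.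
Qed.

End GradedST.

Lemma graded_der_dS (c : bool) (d : sEnd (Einf E)) :
  homog c d -> hder (einf_br E) c d -> L0 (d zeta) ->
  (forall T' : End, homog c T' ->
    (forall a, Alinear (scomm T' a%:A')) ->
    (forall m n, exists b, scomm T' (Emap q m n) = b%:A') ->
    (forall (e f : bool) m n, homog e m -> homog f n ->
       scomm T' (q m n)%:A' = Emap q (T' m) n + sgn (e && f) (Emap q (T' n) m)) ->
    exists2 a, homog c a & T' = a%:A') ->
  exists a, exists2 S', SE E S' & d = ad E (inA a) + dS E S'.
Proof.
move=> hc hd dz scalars; have [[U V] /= [UE VE hU hV dL0]] := graded_der_UV hc hd dz.
apply: (@graded_der_ST c d (hlf K *: (U + V)) (hlf K *: (U - V)) U V) => //.
- by apply: (homogZ (homog_hlf half)); apply: homogD.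
- by apply: (homogZ (homog_hlf half)); apply: homogB.
- by rewrite (hlf_sum half).
- by rewrite (hlf_diff half).
Qed.

End Decomposition.

Section Structure.
Variables (K : superComRingType) (A : superExtType K) (M : superLmodType A).
Variables (q : quadForm M) (E : midalg q).
Hypothesis half : invertible (2%:R : K).
Hypothesis faithful : forall a : A, (forall m : M, a *: m = 0) -> a = 0.
Notation End := (sEnd (restr M)).
Notation "a %:A'" := (aId M a) (at level 2, format "a %:A'").
Implicit Types (u v w : Einf E) (x y : midtype E) (m n : restr M) (a b : A).
Implicit Types (S : End).
Hypothesis scalars : forall (c : bool) (T : End), homog c T ->
  (forall a, Alinear (scomm T a%:A')) ->
  (forall m n, exists b, scomm T (Emap q m n) = b%:A') ->
  (forall (e f : bool) m n, homog e m -> homog f n ->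
     scomm T (q m n)%:A' = Emap q (T m) n + sgn (e && f) (Emap q (T n) m)) ->
  exists2 a, homog c a & T = a%:A'.

Let brDl := @einf_brDl K A M q E.
Let brDr := @einf_brDr K A M q E.
Let ad_D := adD brDl (fun u v => erefl (ad E u v)).

Lemma einf_ad_ideal : ideal (@endbr K (Einf E)) (Der (einf_br E)) (range (ad E)).
Proof.
by apply: (ad_ideal brDl brDr (@einf_brZ K A M q E) (@einf_br_homog K A M q E)
  (@einf_jacobi K A M q E)).
Qed.

Lemma einf_li_ideal :
  ideal (@endbr K (Einf E)) (Der (einf_br E)) (locally_inner (einf_br E)).
Proof.
exact: (locally_inner_ideal brDl brDr (@einf_brZ K A M q E)
  (@einf_br_homog K A M q E) (@einf_br_rscale K A M q E)).
Qed.

Lemma ad_Der' u : Der (einf_br E) (ad E u).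
Proof. by have [_ + _] := einf_ad_ideal; apply; exists u. Qed.

Lemma br_zeta_r u : cM (einf_br E u (zeta E)) = - cM u /\
  cN (einf_br E u (zeta E)) = cN u.
Proof.
have s0 m : sapp (0 : End) m = 0.
  by apply: (addrI (sapp 0 m)); rewrite -sappDl !addr0.
rewrite brM_raw brN_raw /zeta /inA !mkDE !sEnd0 !s0 !(@rscale1 A M) oppr0.
by rewrite !add0r !addr0.
Qed.

(** Subtracting an inner derivation moves the image of 1 into A (+) E, because
    the bracket with 1 is invertible on the copies of [M]. *)
Lemma homog_der_decomp (c : bool) (d : sEnd (Einf E)) : homog c d ->
  hder (einf_br E) c d -> exists u, exists2 S, SE E S & d = ad E u + dS E S.
Proof.
move=> hc hd; set z := d (zeta E).
have hz : homog c z by have := homog_app hc (homog_zeta E); rewrite addbF.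
have [_ hzm hzn _] := (einf_homogP c z).1 hz.
pose u0 : Einf E := mkE 0 (cM z) (- cN z) 0.
have hu0 : homog c u0.
  by apply: homog_mk => //; [exact: homog0|exact: homogN|exact: homog0].
have hd0 : homog c (ad E u0) by apply: (ad_homog (@einf_br_homog K A M q E)).
have [a [S hS e]] : exists a, exists2 S, SE E S & d + ad E u0 = ad E (inA E a) + dS E S.
  have h1 : homog c (d + ad E u0) by exact: homogD.
  have h2 : hder (einf_br E) c (d + ad E u0).
    have hd0' : Der (einf_br E) (ad E u0) := ad_Der' u0.
    apply: (Der_homog brDl brDr h1).
    by apply: zspanD => //; exact: (hder_Der hc).
  have h3 : L0 ((d + ad E u0) (zeta E)).
    have [e1 e2] := br_zeta_r u0.
    split; rewrite add_sEndE !cDE -/z.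
      by rewrite -[ad E u0 _]/(einf_br E u0 _) e1 mkDE subrr.
    by rewrite -[ad E u0 _]/(einf_br E u0 _) e2 mkDE subrr.
  by apply: (graded_der_dS half faithful h1 h2 h3); exact: scalars.
exists (inA E a - u0), S => //; have -> : d = d + ad E u0 - ad E u0 by rewrite addrK.
rewrite e; have -> : ad E (inA E a) = ad E (inA E a - u0) + ad E u0.
  by rewrite -ad_D subrK.
zmod.
Qed.

Lemma Der_setsum : Der (einf_br E) = setsum (range (ad E)) (d0 E (SE E)).
Proof.
apply/seteqP; split=> [d hd|_ [_ [u _ <-] [_ [S hS <-] <-]]]; last first.
  by apply: zspanD; [exact: ad_Der'|rewrite dS_dST; exact: dS_Der].
have dd c : hder (einf_br E) c (spart c d) by have /(DerP brDl brDr) := hd.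
have [u [S hS e]] := homog_der_decomp (homog_spart false d) (dd false).
have [u' [S' hS' e']] := homog_der_decomp (homog_spart true d) (dd true).
exists (ad E (u + u')); first by eexists.
exists (dS E (S + S')); first by exists (S + S'); [exact: SE_D|rewrite dS_dST].
rewrite ad_D (dSD faithful) // -[RHS](spart_sum d) e e'; zmod.
Qed.

(** The brackets with 1 show the components of [u] in the copies of [M]; the
    sum and the difference of the brackets with the two copies of [m] separate
    the parts of [u] in [A] and in [E]. *)
Lemma ad_dS_at u S m : SE E S -> einf_br E u (zeta E) = dS E S (zeta E) ->
  einf_br E u (inM E m) = dS E S (inM E m) -> einf_br E u (inN E m) = dS E S (inN E m) ->
  [/\ L0 u, (cA u)%:A' m = 0 & S m = cE u m].
Proof.
move=> hS ez eM eN; have [e1 e2] := br_zeta_r u.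
have [_ z2 z3 _] := dSE faithful (zeta E) hS.
have um : cM u = 0.
  by apply: oppr_inj; rewrite oppr0 -e1 ez z2 /zeta /inA mkDE sEnd0.
have un : cN u = 0 by rewrite -e2 ez z3 /zeta /inA mkDE sEnd0.
have u0 : L0 u by [].
have [_ f2 _ _] := dSE faithful (inM E m) hS; have [_ _ g3 _] := dSE faithful (inN E m) hS.
rewrite -eM (br_L0M _ u0) /inM !mkDE in f2.
rewrite -eN (br_L0N _ u0) /inN !mkDE in g3.
have a0 : (cA u)%:A' m = 0.
  apply: (twice0 half); transitivity (Pop u m - Qop u m).
    by rewrite PopE QopE !add_sEndE opp_sEndE; zmod.
  by rewrite f2 g3 subrr.
by split=> //; rewrite -f2 PopE add_sEndE a0 add0r.
Qed.

Lemma ad_dS u S : SE E S -> ad E u = dS E S -> u = inX u.2 /\ S = cE u.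
Proof.
move=> hS e; have H m := @ad_dS_at u S m hS
  (congr1 (fun d : sEnd (Einf E) => d (zeta E)) e)
  (congr1 (fun d : sEnd (Einf E) => d (inM E m)) e)
  (congr1 (fun d : sEnd (Einf E) => d (inN E m)) e).
split; last by apply: sEnd_ext => m; have [] := H m.
have [[um un] _ _] := H 0.
apply: einf_ext => //; first by apply: faithful => m; have [] := H m.
Qed.

Lemma d0_mid : d0 E (mid_set E) = [set ad E (einf_mid x) | x in [set: midtype E]].
Proof.
apply/seteqP; split=> [_ [f Ef <-]|_ [x _ <-]].
  by exists (toMid Ef) => //; rewrite -dS_mid // dS_dST.
by exists (mval x); [exact: mvalE|rewrite dS_dST dS_mid].
Qed.

Lemma ad_cap_d0 (X : set End) : mid_set E `<=` X -> X `<=` SE E ->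
  range (ad E) `&` d0 E X = d0 E (mid_set E).
Proof.
move=> EX XS; apply/seteqP; split=> [_ [[u _ <-] [S XS' e]]|_ [f Ef <-]]; last first.
  split; last by exists f => //; exact: EX.
  exists (einf_mid (toMid Ef)) => //; rewrite dS_dST.
  by rewrite -[in RHS](_ : mval (toMid Ef) = f) // dS_mid.
move: e; rewrite dS_dST => e; have hS := XS _ XS'.
have [_ eS] := ad_dS hS (esym e); exists S; last by rewrite dS_dST.
by rewrite eS; exact: cE_mid.
Qed.

Lemma subalgebra_d0 (S0 : set End) : S0 `<=` SE E ->
  subalgebra (@endbr K (restr M)) S0 -> subalgebra (@endbr K (Einf E)) (d0 E S0).
Proof.
move=> SS [[s0 sD sZ sP] sB]; split; first split.
- exists 0 => //; rewrite dS_dST.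
  by apply: (addrI (dS E 0)); rewrite -(dSD faithful) ?addr0 //; exact: SS.
- move=> _ _ [S hS <-] [S' hS' <-]; exists (S + S'); first exact: sD.
  by rewrite !dS_dST (dSD faithful) //; exact: SS.
- move=> k _ [S hS <-]; exists (k *: S); first exact: sZ.
  by rewrite !dS_dST (dSZ faithful) //; apply: SS => //; exact: sZ.
- move=> c _ [S hS <-]; exists (spart c S); first exact: sP.
  by rewrite !dS_dST (dS_spart faithful) //; exact: SS.
move=> _ _ [S hS <-] [S' hS' <-]; exists (scomm S S'); first exact: sB.
by rewrite !dS_dST (dS_scomm faithful) //; apply: SS => //; exact: sB.
Qed.

(** An inner d_{S,0} has [S] in [E], so a complement of [E] in S_E gives a
    complement of the inner derivations. *)
Lemma semidirect_Der (S0 : set End) :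
  semidirect (@endbr _ (restr M)) (SE E) (mid_set E) S0 ->
  semidirect (@endbr _ (Einf E)) (Der (einf_br E)) (range (ad E)) (d0 E S0).
Proof.
move=> [eSE dir _ subS0].
have E0 : mid_set E 0 := mid0 E.
have SS : S0 `<=` SE E by move=> S hS; rewrite eSE; exists 0 => //; exists S; rewrite ?add0r.
split.
- rewrite Der_setsum; apply/seteqP; split=> [_ [_ [u _ <-] [_ [S hS <-] <-]]|].
    move: (hS); rewrite eSE => -[f Ef [S' hS' eS]].
    exists (ad E (u + einf_mid (toMid Ef))); first by eexists.
    exists (dS E S'); first by exists S'; rewrite ?dS_dST.
    rewrite ad_D -dS_mid // dS_dST -eS (dSD faithful) ?addrA //; last exact: SS.
    exact: mid_SE.
  move=> _ [x hx [_ [S hS <-] <-]]; exists x => //; exists (dST E S 0) => //.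
  by exists S => //; exact: SS.
- apply/seteqP; split=> [_ [[u _ <-] [S hS e]]|_ ->]; last first.
    split; first by exists 0 => //; apply: (addrI (ad E 0)); rewrite -ad_D !addr0.
    by have [[z _ _ _] _] := subalgebra_d0 SS subS0.
  move: e; rewrite dS_dST => e; have [_ eS] := ad_dS (SS _ hS) (esym e).
  have S00 : S = 0.
    have : (mid_set E `&` S0) S by split=> //; rewrite eS; exact: cE_mid.
    by rewrite dir.
  rewrite -e S00; apply: (addrI (dS E 0)).
  by rewrite -(dSD faithful) ?addr0 //; apply: SS; rewrite -S00.
- exact: einf_ad_ideal.
- exact: subalgebra_d0.
Qed.

End Structure.

(** * Bases of orthogonal sums *)

Section SumBases.
Variables (K : superComRingType) (A : superExtType K).

Lemma fsum_seq (V : zmodType) (I : choiceType) (G : I -> V) (F : seq I) : uniq F ->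
  (forall k, k \notin F -> G k = 0) -> \sum_(i \in [set: I]) G i = \sum_(i <- F) G i.
Proof.
move=> uF zF; have fF : finite_set [set i | i \in F] by exact: finite_seq.
have -> : \sum_(i \in [set: I]) G i = \sum_(i <- fset_set [set i | i \in F]) G i.
  apply: fsbigTE => i; rewrite in_fset_set // => ni; apply: zF.
  by apply: contraNN ni => iF; rewrite in_setE.
apply: perm_big; apply: uniq_perm => // i; rewrite in_fset_set //.
by apply/idP/idP; rewrite in_setE.
Qed.

Lemma is_coord_seq (M : superLmodType A) (I : choiceType) (b : I -> M) m a :
  is_coord b m a <-> exists F : seq I, [/\ uniq F, (forall k, k \notin F -> a k = 0) &
    m = \sum_(k <- F) a k *: b k].
Proof.
split=> [[fa ->]|[F [uF Fa ->]]].
  exists (fset_set [set i | a i != 0]); split; first exact: fset_uniq.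
    by move=> k; rewrite in_fset_set // => nk; apply/eqP; apply: contraNT nk => ak; rewrite in_setE.
  by apply: (fsum_fset fa) => i ->; rewrite scale0r.
have sub : [set i | a i != 0] `<=` [set i | i \in F].
  by move=> i /=; apply: contraNT => /Fa ->.
have fF : finite_set [set i | i \in F] by exact: finite_seq.
have fa : finite_set [set i | a i != 0] by exact: sub_finite_set fF.
by split=> //; rewrite (fsum_seq uF) // => k /Fa ->; rewrite scale0r.
Qed.

Variables (M1 M2 : superLmodType A) (I1 I2 : choiceType).
Variables (b1 : I1 -> M1) (b2 : I2 -> M2).

Definition sum_coef (a1 : I1 -> A) (a2 : I2 -> A) (k : I1 + I2) : A :=
  match k with inl i => a1 i | inr j => a2 j end.

Lemma is_coord_sum m1 m2 a1 a2 : is_coord b1 m1 a1 -> is_coord b2 m2 a2 ->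
  is_coord (sum_basis b1 b2) (m1, m2) (sum_coef a1 a2).
Proof.
move=> /is_coord_seq[F1 [u1 z1 e1]] /is_coord_seq[F2 [u2 z2 e2]].
apply/is_coord_seq; exists (map inl F1 ++ map inr F2); split.
- rewrite cat_uniq !map_inj_uniq => [|x y []|x y []] //; rewrite u1 u2 andbT /=.
  by apply/hasPn => _ /mapP[j _ ->]; apply/mapP => -[].
- by case=> k; rewrite mem_cat negb_or => /andP[n1 n2] /=; [apply: z1|apply: z2];
    [apply: contraNN n1|apply: contraNN n2] => kF; rewrite map_f.
rewrite big_cat !big_map /= e1 e2.
have s1 (F : seq I1) : \sum_(i <- F) a1 i *: ((b1 i, 0) : M1 * M2) =
    (\sum_(i <- F) a1 i *: b1 i, 0).
  elim: F => [|i F IH]; first by rewrite !big_nil.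
  by rewrite !big_cons IH; congr (_, _); rewrite /= ?scaler0 ?addr0.
have s2 (F : seq I2) : \sum_(i <- F) a2 i *: ((0, b2 i) : M1 * M2) =
    (0, \sum_(i <- F) a2 i *: b2 i).
  elim: F => [|i F IH]; first by rewrite !big_nil.
  by rewrite !big_cons IH; congr (_, _); rewrite /= ?scaler0 ?addr0.
by rewrite s1 s2; congr (_, _); rewrite /= ?addr0 ?add0r.
Qed.

Lemma is_coord_fst m a : is_coord (sum_basis b1 b2) m a ->
  is_coord b1 m.1 (a \o inl) /\ is_coord b2 m.2 (a \o inr).
Proof.
move=> /is_coord_seq[F [uF zF ->]]; split; apply/is_coord_seq.
  pose p (k : I1 + I2) := if k is inl i then Some i else None.
  have pK : ocancel p inl by case.
  have mF i : (i \in pmap p F) = (inl i \in F).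
    by rewrite mem_pmap; apply/mapP/idP => [[[j|j] jF //= [->]]|iF] //; exists (inl i).
  exists (pmap p F); split; first exact: (pmap_uniq pK).
    by move=> k; rewrite mF => /zF.
  elim: F {uF zF mF} => [|k F IH]; first by rewrite !big_nil.
  rewrite big_cons /=; case: k => k /=; rewrite ?big_cons /= IH //.
  by rewrite scaler0 add0r.
pose p (k : I1 + I2) := if k is inr i then Some i else None.
have pK : ocancel p inr by case.
have mF i : (i \in pmap p F) = (inr i \in F).
  by rewrite mem_pmap; apply/mapP/idP => [[[j|j] jF //= [->]]|iF] //; exists (inr i).
exists (pmap p F); split; first exact: (pmap_uniq pK).
  by move=> k; rewrite mF => /zF.
elim: F {uF zF mF} => [|k F IH]; first by rewrite !big_nil.
rewrite big_cons /=; case: k => k /=; rewrite ?big_cons /= IH //.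
by rewrite scaler0 add0r.
Qed.

Lemma homog_basis_sum : homog_basis b1 -> homog_basis b2 -> homog_basis (sum_basis b1 b2).
Proof.
move=> hb1 hb2; split=> [[i|j]|[m1 m2]].
- have [c hc] := hb1.1 i; exists c; apply/homog_pair; split=> //; exact: homog0.
- have [c hc] := hb2.1 j; exists c; apply/homog_pair; split=> //; exact: homog0.
exists (sum_coef (Defs.coord b1 m1) (Defs.coord b2 m2)); split.
  by apply: is_coord_sum; exact: coordP.
move=> a /is_coord_fst[/= /(coord_unique hb1) -> /(coord_unique hb2) ->].
by apply/funext => -[].
Qed.

End SumBases.

Lemma homog_basis_hbasis (K : superComRingType) (A : superExtType K)
    (M : superLmodType A) (I : choiceType) (b : I -> M) : homog_basis b ->
  exists dg, hbasis (b : I -> restr M) dg (fun k (m : restr M) => Defs.coord b m k).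
Proof.
move=> hb; have [dg hdg] := choice hb.1; exists dg; split=> // [k m n|k l a|m].
- by rewrite (coordD hb).
- have -> : Defs.coord b (aId M a (b l)) = fun k => if k == l then a else 0.
    apply: (coord_unique hb); apply/is_coord_seq; exists [:: l]; split=> //.
      by move=> i; rewrite inE => /negPf ->.
    by rewrite big_seq1 eqxx.
  by [].
by have /is_coord_seq[F [uF zF e]] := coordP hb m; exists F.
Qed.

(** ** Partners *)

Section Partners.
Variables (K : superComRingType) (A : superExtType K) (M : superLmodType A).
Variables (I : choiceType) (b : I -> M) (q : quadForm M).

Lemma invertible_neq0 (x : A) : invertible x -> x <> 0.
Proof.
by move=> [y [xy _]] x0; have /eqP := oner_neq0 A; apply; rewrite -xy x0 mul0r.
Qed.

Lemma partnerP : almost_diagonalizable b q -> forall i, partner_of b q i (partner b q i).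
Proof. by move=> hq i; exact: (xgetPex i (hq i)). Qed.

Lemma partner_unique i j k : partner_of b q i j -> invertible (q (b i) (b k)) -> k = j.
Proof.
move=> [_ z] ik; apply: contrapT => kj.
by have := invertible_neq0 ik; rewrite z.
Qed.

End Partners.

(** * Normalisers *)

Lemma scomm_spart (R : superRingType) (a b : bool) (x y : R) : homog b y ->
  spart (a (+) b) (scomm x y) = scomm (spart a x) y.
Proof.
move=> hy; rewrite -{1}(spart_sum x) scommDl spartD.
rewrite !(spart_homog _ (homog_scomm (homog_spart _ x) hy)).
by case: (a) (b) => [] []; rewrite /= ?addr0 ?add0r.
Qed.

Section Normal.
Variables (K : superComRingType) (A : superExtType K) (M : superLmodType A).
Variables (q : quadForm M).
Hypothesis faithful : forall a : A, (forall m : M, a *: m = 0) -> a = 0.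
Notation End := (sEnd (restr M)).
Notation "a %:A'" := (aId M a) (at level 2, format "a %:A'").
Implicit Types (m n : restr M) (a b : A) (S T f : End).

Definition normA S : Prop := forall a, exists b, scomm S a%:A' = b%:A'.

Lemma normA_spart (c : bool) S : normA S -> normA (spart c S).
Proof.
move=> SA a; elim/(@homog_ind A): a => [a a' [b eb] [b' eb']|d a ha].
  by exists (b + b'); rewrite !aIdD scommDr eb eb'.
have [b eb] := SA a; exists (spart (c (+) d) b).
by rewrite -(scomm_spart _ _ (homog_aId ha)) eb spart_aId.
Qed.

Lemma q_spartl (c d : bool) m n : homog d n -> spart (c (+) d) (q m n) = q (spart c m) n.
Proof.
move=> hn; rewrite -{1}(spart_sum m) qDl spartD.
rewrite !(spart_homog _ (q_homog q (homog_spart _ m) hn)).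
by case: (c) (d) => [] []; rewrite /= ?addr0 ?add0r.
Qed.

Lemma leibq_spart (c : bool) S : leibq q S -> leibq q (spart c S).
Proof.
move=> hS d e m n hm hn; rewrite -(scomm_spart _ _ (homog_aId (q_homog q hm hn))).
rewrite (hS _ _ _ _ hm hn) spart_aId; congr (aId _ _); rewrite spartD spart_sgn.
rewrite (spart_endE _ _ hm) (spart_endE _ _ hn) -(q_spartl _ (S m) hn) -(q_spartl _ (S n) hm).
by congr (spart _ _ + sgn _ (spart _ _)); case: (c) (d) (e) => [] [] [].
Qed.

(** Homogeneous parts of an operator satisfying the conditions satisfy them
    too, since [A], [E] and the form are graded. *)
Lemma SE_iff (E : midalg q) S : SE E S <-> hSE E S.
Proof.
split; first exact: SE_hSE.
move=> [S1 S2 S3]; apply/SEP => c; split.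
- exact: normA_spart.
- exact: leibq_spart.
move=> f Ef; rewrite -(spart_sum f) scommDr.
have H d : mid_set E (scomm (spart c S) (spart d f)).
  rewrite -(scomm_spart c _ (homog_spart d f)).
  by apply: mid_spart; apply: S3; exact: mid_spart.
by apply: midD; exact: H.
Qed.

Lemma ospP S : osp q S <-> Alinear S /\ leibq q S.
Proof.
split=> [[SA Sq]|[SA Sq]]; split=> // c d m n hm hn; have := Sq c d m n hm hn.
  rewrite (Alinear_scomm _ SA) sgnME => ->; exact: esym (aId0 M).
by rewrite (Alinear_scomm _ SA) -(aId0 M) => /(aId_inj faithful); rewrite sgnME.
Qed.

Lemma leibqB S T : leibq q S -> leibq q T -> leibq q (S - T).
Proof.
move=> hS hT c d m n hm hn; rewrite scommBl (hS _ _ _ _ hm hn) (hT _ _ _ _ hm hn).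
by rewrite -aIdB; congr (aId _ _); rewrite !add_sEndE !opp_sEndE !qDl !qNl; zmod.
Qed.

Lemma leibq_add S T : leibq q S -> leibq q T -> leibq q (S + T).
Proof.
move=> hS hT c d m n hm hn; rewrite scommDl (hS _ _ _ _ hm hn) (hT _ _ _ _ hm hn).
by rewrite -aIdD; congr (aId _ _); rewrite !add_sEndE !qDl; zmod.
Qed.

Lemma AlinearB S T : Alinear S -> Alinear T -> Alinear (S - T).
Proof.
move=> hS hT; apply: scomm_Alinear => a.
by rewrite scommBl !Alinear_scomm // subrr.
Qed.

Lemma AlinearD S T : Alinear S -> Alinear T -> Alinear (S + T).
Proof.
move=> hS hT; apply: scomm_Alinear => a.
by rewrite scommDl !Alinear_scomm // addr0.
Qed.

Lemma ospB S T : osp q S -> osp q T -> osp q (S - T).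
Proof.
move=> /ospP[SA Sq] /ospP[TA Tq]; apply/ospP; split; first exact: AlinearB.
exact: leibqB.
Qed.

Lemma osp_D S T : osp q S -> osp q T -> osp q (S + T).
Proof.
move=> /ospP[SA Sq] /ospP[TA Tq]; apply/ospP; split; first exact: AlinearD.
exact: leibq_add.
Qed.

Lemma osp0 : osp q 0.
Proof.
split=> [m a|c d m n _ _]; last by rewrite !q0l mulr0 addr0.
exact/esym/(@rscale0l A M).
Qed.

Lemma leibq_scomm_h (c d : bool) S T : homog c S -> homog d T ->
  leibq q S -> leibq q T -> leibq q (scomm S T).
Proof.
move=> hS hT Sq Tq e f m n hm hn; rewrite (scomm_app _ hS hT) (scomm_app _ hS hT).
have J z : scomm (scomm S T) z = scomm S (scomm T z) - sgn (c && d) (scomm T (scomm S z)).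
  by rewrite (scomm_jacobi z hS hT) addrK.
have [hSm hSn] := (homog_app hS hm, homog_app hS hn).
have [hTm hTn] := (homog_app hT hm, homog_app hT hn).
rewrite J (SE_q Tq hT hm hn) (SE_q Sq hS hm hn) !aIdD !aId_sgn !scommDr !scomm_sgnr.
rewrite (SE_q Sq hS hTm hn) (SE_q Sq hS hm hTn) (SE_q Tq hT hSm hn) (SE_q Tq hT hm hSn).
rewrite (qC q hm (homog_app hS hTn)) (qC q hm (homog_app hT hSn)).
rewrite !qDl !qNl !qsl !(aIdD, aIdN, aId_sgn).
by zmod.
Qed.

Lemma leibq_scomm S T : leibq q S -> leibq q T -> leibq q (scomm S T).
Proof.
move=> Sq Tq; rewrite -(spart_sum S) -(spart_sum T) scommDl !scommDr.
have H c d : leibq q (scomm (spart c S) (spart d T)).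
  by apply: (leibq_scomm_h (homog_spart c S) (homog_spart d T)); exact: leibq_spart.
by apply: leibq_add; apply: leibq_add; exact: H.
Qed.

Lemma Alinear_scomm_normA S f : normA S -> Alinear f -> Alinear (scomm S f).
Proof.
move=> SA fA; rewrite -(spart_sum S) -(spart_sum f) scommDl !scommDr.
have H c d : Alinear (scomm (spart c S) (spart d f)).
  apply: scomm_Alinear => a.
  have J : scomm (scomm (spart c S) (spart d f)) a%:A' =
     scomm (spart c S) (scomm (spart d f) a%:A') -
     sgn (c && d) (scomm (spart d f) (scomm (spart c S) a%:A')).
    by rewrite (scomm_jacobi _ (homog_spart c S) (homog_spart d f)) addrK.
  have [b eb] := normA_spart c SA a; have fd := Alinear_spart d fA.
  by rewrite J eb !(Alinear_scomm _ fd) scomm0r sgn0 subr0.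
by apply: AlinearD; apply: AlinearD; exact: H.
Qed.

Lemma osp_norm S f : normA S -> leibq q S -> osp q f -> osp q (scomm S f).
Proof.
move=> SA Sq /ospP[fA fq]; apply/ospP; split; first exact: Alinear_scomm_normA.
exact: leibq_scomm.
Qed.

Lemma osp_normA S : osp q S -> normA S.
Proof. by move=> [SA _] a; exists 0; rewrite Alinear_scomm // aId0. Qed.

Lemma osp_leibq S : osp q S -> leibq q S. Proof. by move=> /ospP[]. Qed.

Lemma eosp_gen m n : eosp q (Emap q m n).
Proof. by apply: zspan_gen; exists m, n. Qed.

Lemma eosp_sgn e f : eosp q f -> eosp q (sgn e f).
Proof. by case: e => //= ef; exact: zspanN. Qed.

Lemma eosp_norm S f : leibq q S -> eosp q f -> eosp q (scomm S f).
Proof.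
move=> Sq; move: f; apply: zspan_ind => [|x y hx hy|_ [m [n ->]]].
- by rewrite scomm0r; exact: zspan0.
- by rewrite scommBr; exact: zspanB.
rewrite -(spart_sum m) -(spart_sum n) EDl !EDr -(spart_sum S) scommDl !scommDr.
have H (a c d : bool) : eosp q (scomm (spart a S) (Emap q (spart c m) (spart d n))).
  rewrite (SE_Emap (leibq_spart a Sq) (homog_spart a S) (homog_spart c m) (homog_spart d n)).
  by apply: zspanD; [|apply: eosp_sgn]; exact: eosp_gen.
by apply: zspanD; apply: zspanD; apply: zspanD; exact: H.
Qed.

Lemma scomm_Emap0 S (c d : bool) m n : leibq q S -> homog c m -> homog d n ->
  S m = 0 -> S n = 0 -> scomm S (Emap q m n) = 0.
Proof.
move=> Sq hm hn Sm Sn; rewrite -(spart_sum S) scommDl.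
have H (a : bool) : scomm (spart a S) (Emap q m n) = 0.
  rewrite (SE_Emap (leibq_spart a Sq) (homog_spart a S) hm hn).
  by rewrite (spart_endE _ _ hm) (spart_endE _ _ hn) Sm Sn !spart0 E0l E0r sgn0 addr0.
by rewrite !H addr0.
Qed.

Lemma normA_der (c : bool) S : homog c S -> normA S ->
  exists D : sEnd A, [/\ homog c D, hder *%R c D & forall a, scomm S a%:A' = (D a)%:A'].
Proof.
move=> hc SA; have [g hg] := choice SA; have inj := aId_inj faithful.
have kg : klinearb (g : A -> A).
  apply/asboolP; split=> [a b|a k]; apply: inj.
    by rewrite -hg !aIdD scommDr !hg.
  by rewrite -hg !aId_rscale scomm_rscale hg.
exists (SEnd kg); split=> //.
- apply/homog_endP => d a ha; apply: (homog_aId_inv faithful); rewrite -[SEnd kg a]/(g a) -hg.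
  by apply: homog_scomm => //; exact: homog_aId.
- move=> d a b ha; apply: inj; rewrite -[SEnd kg _]/(g (a * b)) -hg aIdM.
  rewrite (scommMr _ hc (homog_aId ha)) !hg -!aIdM -aId_sgn -aIdD.
  by [].
Qed.

End Normal.

(** * Extending derivations of A to M *)

Section Ext.
Variables (K : superComRingType) (A : superExtType K) (N R : superLmodType A).
Variables (I J : choiceType) (n : I -> N) (r : J -> R).
Variable qN : quadForm N.
Hypothesis half : invertible (2%:R : K).
Hypotheses (hn : homog_basis n) (hr : homog_basis r).
Hypothesis hqN : almost_diagonalizable n qN.
Notation M := (N * R)%type.
Notation End := (sEnd (restr M)).
Notation "a %:A'" := (aId M a) (at level 2, format "a %:A'").
Notation B := (sum_basis n r : I + J -> restr M).
Notation co := (fun (k : I + J) (m : restr M) => Defs.coord (sum_basis n r) m k).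
Variable dg : I + J -> bool.
Hypothesis hB : hbasis B dg co.
Variable i0 : I.
Notation DerA := (Der (V := A) *%R).
Notation DerM' := (DerM n r qN).
Notation EndR := (EndAR N R).
Notation S0 := (setsum EndR DerM').
Notation normE E := [set S | forall x, mid_set E x -> mid_set E (endbr S x)].
Implicit Types (D : sEnd A) (a b : A) (S T f : End).
Notation ext' := (ext n r qN).
Notation p := (partner n qN).

Notation u_ i := (diag_entry n qN i).

(** Delta_M multiplies the basis vector [B k] by [wt D k]. *)
Definition wt D (k : I + J) : A :=
  match k with
  | inl i => rinv (2%:R : A) * D (u_ i) * rinv (u_ i)
  | inr _ => 0
  end.

Let faith a : (forall m : M, a *: m = 0) -> a = 0.
Proof. exact: (hb_faithful hB (inl i0)). Qed.

Lemma half_A : invertible (2%:R : A).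
Proof.
have [y [y1 y2]] := half; exists (y%:A).
have e : (2%:R : A) = (2%:R : K)%:A by rewrite scaler_nat.
by rewrite e -!scalerAl !mul1r !scalerA y1 y2 scale1r.
Qed.

Lemma homog_rinv2 : homog false (rinv (2%:R : A)).
Proof. by apply: homog_rinv half_A; have h := @homog1 A; exact: homogD. Qed.

Lemma u_inv i : invertible (u_ i).
Proof. by have [] := partnerP hqN i. Qed.

(** An odd element of [A] has square 0, as 2 is invertible, and so it is not
    invertible. *)
Lemma u_homog i : homog false (u_ i).
Proof.
have h : homog (dg (inl i) (+) dg (inl (p i))) (u_ i).
  have [h1 _] := (homog_pair _ _).1 (hb_homog hB (inl i)).
  have [h2 _] := (homog_pair _ _).1 (hb_homog hB (inl (p i))).
  exact: (qf_homog qN h1 h2).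
move: h; case: (_ (+) _) => // h; exfalso.
apply: (invertible_neq0 (u_inv i)).
have uu : u_ i * u_ i = 0.
  apply: (twice0 half); have /= e := smulCE h h.
  by rewrite {1}e addNr.
by apply: (invertible_inj (u_inv i)); rewrite uu mulr0.
Qed.

(** The weight is half the logarithmic derivative of the Gram entry.  This
    equation determines it, which replaces computations with inverses. *)
Lemma twice_wt D i : (wt D (inl i) + wt D (inl i)) * u_ i = D (u_ i).
Proof.
have [_ uV] := rinvP (u_inv i); have [h2 _] := rinvP half_A.
rewrite mulrDl /= -!mulrA uV mulr1 -mulrDl -mulr2n -[_ *+ 2]mulr_natl.
by rewrite h2 mul1r.
Qed.

Lemma wt_unique D i w : (w + w) * u_ i = D (u_ i) -> w = wt D (inl i).
Proof.
rewrite -(twice_wt D) => e; apply: (twice_inj half).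
have [uV _] := rinvP (u_inv i).
by rewrite -[LHS]mulr1 -[RHS]mulr1 -uV !mulrA e.
Qed.

Lemma wt_homog (c : bool) D k : homog c D -> homog c (wt D k).
Proof.
case: k => [i|j] hc /=; last exact: homog0.
have h1 := homogM homog_rinv2 (homog_app hc (u_homog i)).
have := homogM h1 (homog_rinv (u_homog i) (u_inv i)).
by rewrite !addbF.
Qed.

Lemma wtD D D' k : wt (D + D') k = wt D k + wt D' k.
Proof. by case: k => [i|j] /=; rewrite ?addr0 // mulrDr mulrDl. Qed.

Lemma extDE D (a : A) k : ext' D (a%:A' (B k)) = (wt D k * a + D a)%:A' (B k).
Proof.
rewrite extE // /ext_fun !aIdE.
have f0 (X : choiceType) (V : zmodType) (F : X -> V) : (forall x, F x = 0) ->
    \sum_(x \in [set: X]) F x = 0 by move=> F0; apply: fsbig1 => x _; exact: F0.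
have f1 (X : choiceType) (V : zmodType) (F : X -> V) i : (forall x, x != i -> F x = 0) ->
    \sum_(x \in [set: X]) F x = F i.
  move=> Fi; have -> : \sum_(x \in [set: X]) F x = \sum_(x <- [fset i]%fset) F x.
    by apply: fsbigTE => x; rewrite inE => /Fi.
  by rewrite big_seq_fset1.
have cE (X : choiceType) (V : superLmodType A) (b : X -> V) : homog_basis b ->
    forall i, Defs.coord b (a *: b i) = fun x => if x == i then a else 0.
  move=> hb i; apply: (coord_unique hb); apply/is_coord_seq; exists [:: i]; split=> //.
    by move=> x; rewrite inE => /negPf ->.
  by rewrite big_seq1 eqxx.
have c0 (X : choiceType) (V : superLmodType A) (b : X -> V) : homog_basis b ->
    Defs.coord b (a *: 0) = fun=> 0.
  move=> hb; rewrite scaler0; apply: (coord_unique hb); apply/is_coord_seq; exists [::].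
  by rewrite big_nil.
case: k => k; rewrite /sum_basis /=.
- rewrite (cE _ _ _ hn) (c0 _ _ _ hr) [X in (_, X)]f0; last first.
    by move=> x; rewrite sEnd0 scale0r.
  rewrite (f1 _ _ _ k) ?eqxx; last first.
    by move=> x /negPf ->; rewrite mulr0 sEnd0 addr0 scale0r.
  by congr (_, _); rewrite scaler0.
- rewrite (c0 _ _ _ hn) (cE _ _ _ hr) [X in (X, _)]f0; last first.
    by move=> x; rewrite mulr0 sEnd0 addr0 scale0r.
  rewrite (f1 _ _ _ k) ?eqxx; last first.
    by move=> x /negPf ->; rewrite sEnd0 scale0r.
  by congr (_, _); rewrite ?scaler0 // mul0r add0r.
Qed.

Lemma ext_D D D' : ext' (D + D') = ext' D + ext' D'.
Proof.
apply: (hb_ext hB) => c a k ha; rewrite [RHS]add_sEndE !extDE wtD.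
by rewrite -[RHS]add_sEndE -aIdD add_sEndE mulrDl addrACA.
Qed.

Lemma wtZ (k : K) D l : wt (k *: D) l = k *: wt D l.
Proof.
case: l => [i|j]; last by rewrite /= scaler0.
by apply/esym/wt_unique; rewrite -scalerDr -scalerAl twice_wt.
Qed.

Lemma ext_Z (k : K) D : ext' (k *: D) = k *: ext' D.
Proof.
apply: (hb_ext hB) => c a l ha; rewrite [RHS]scale_sEndE !extDE.
by rewrite -[RHS]scale_sEndE -aIdZ scalerDr wtZ scalerAl.
Qed.

Lemma wt_rscale (k : K) D l : wt (rscale D k) l = wt D l * k%:A.
Proof.
case: l => [i|j]; last by rewrite /= mul0r.
apply/esym/wt_unique; rewrite -mulrDl -mulrA -(central0 _ (u_homog i)) mulrA twice_wt.
rewrite rscale_sEndE -rscale_ext -sEnd_rscale rscale_ext (central0 _ (u_homog i)).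
by rewrite -scalerAl mul1r.
Qed.

Lemma ext_rscale (k : K) D : ext' (rscale D k) = rscale (ext' D) k.
Proof.
apply: (hb_ext hB) => c a l ha; rewrite [RHS]rscale_sEndE scale_aId.
rewrite aId_app !extDE wt_rscale rscale_sEndE.
by rewrite -mulrA -scalerAl mul1r.
Qed.

Lemma spart_homog' (V : superZmodType) (a : bool) (v : V) : homog a v -> spart a v = v.
Proof. by []. Qed.

Lemma ext_homog (c : bool) D : homog c D -> homog c (ext' D).
Proof.
move=> hc; apply: (hb_ext hB) => e a l ha.
have hl := homog_app (homog_aId ha) (hb_homog hB l).
rewrite (spart_endE _ _ hl) extDE; apply: spart_homog'.
have h1 := homogM (wt_homog l hc) ha; have h2 := homog_app hc ha.
have := homog_app (homog_aId (homogD h1 h2)) (hb_homog hB l).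
by rewrite addbA.
Qed.

Lemma ext_spart (c : bool) D : spart c (ext' D) = ext' (spart c D).
Proof.
rewrite -{1}(spart_sum D) ext_D spartD !(spart_homog _ (ext_homog (homog_spart _ D))).
by case: c; rewrite /= ?addr0 ?add0r.
Qed.

(** ** Derivations *)

Lemma mulDl' (w : A) : {morph *%R^~ w : a b / a + b}. Proof. by move=> a b; exact: mulrDl. Qed.
Lemma mulDr' (w : A) : {morph *%R w : a b / a + b}. Proof. by move=> a b; exact: mulrDr. Qed.

Lemma DerA_P D : DerA D <-> forall c, hder *%R c (spart c D).
Proof. exact: (DerP mulDl' mulDr'). Qed.

Lemma DerA_spart c D : DerA D -> DerA (spart c D).
Proof. exact: (Der_spart mulDl' mulDr'). Qed.

Lemma hderE (c e : bool) D a b : hder *%R c D -> homog e a ->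
  D (a * b) = D a * b + sgn (c && e) (a * D b).
Proof. by move=> hD ha; exact: hD ha. Qed.

(** Delta_M induces Delta on [A], so Delta can be recovered from it. *)
Lemma ext_aId_h (c : bool) D a : homog c D -> hder *%R c D ->
  scomm (ext' D) a%:A' = (D a)%:A'.
Proof.
move=> hc hD; elim/(@homog_ind A): a => [a b ha hb|e a ha].
  by rewrite aIdD scommDr ha hb sEndD aIdD.
apply: (hb_ext hB) => f b k hb; rewrite (scomm_app _ (ext_homog hc) (homog_aId ha)).
rewrite !aId_app !extDE !aId_app (hderE _ hD ha).
rewrite -sgn_sEndE -aId_sgn -opp_sEndE -aIdN -add_sEndE -aIdD; congr (aId _ _ _).
rewrite mulrDr !mulrA (smulCE ha (wt_homog k hc)) sgnMl.
zmod.
Qed.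

Lemma ext_aId D a : DerA D -> scomm (ext' D) a%:A' = (D a)%:A'.
Proof.
move=> /DerA_P hD; rewrite -(spart_sum D) ext_D scommDl.
by rewrite !(ext_aId_h _ (homog_spart _ D) (hD _)) -aIdD.
Qed.

Lemma ext_inj D D' : DerA D -> DerA D' -> ext' D = ext' D' -> D = D'.
Proof.
move=> hD hD' e; apply: sEnd_ext => a.
have := congr1 (fun f : End => scomm f a%:A') e; rewrite !ext_aId //.
exact: (aId_inj faith).
Qed.

(** [Delta, Delta'] applied to the Gram entry u, with Delta u = 2 w u and
    Delta' u = 2 w' u: the products w w' cancel. *)
Lemma wt_scomm (c e : bool) D D' k : homog c D -> homog e D' ->
  hder *%R c D -> hder *%R e D' ->
  wt (scomm D D') k = D (wt D' k) - sgn (c && e) (D' (wt D k)).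
Proof.
move=> hc he hD hD'; case: k => [i|j]; last by rewrite /= !sEnd0 sgn0 subr0.
apply/esym/wt_unique; rewrite (scomm_app _ hc he) -!(twice_wt D') -!(twice_wt D).
have hw := wt_homog (inl i) hc; have hw' := wt_homog (inl i) he.
move: (wt D (inl i)) (wt D' (inl i)) (twice_wt D i) (twice_wt D' i) hw hw'.
move=> w w' ew ew' hw hw'.
rewrite !mulrDl !sEndD (hderE _ hD hw') (hderE _ hD' hw) -ew -ew'.
rewrite !(mulrDl, mulrDr, mulNr, sgnMl, sgnD, sgn_sgn, mulrA) (smulCE hw hw').
rewrite !(sgnMl, sgn_sgn); zmod.
Qed.

Lemma ext_scomm_h (c e : bool) D D' : homog c D -> homog e D' ->
  hder *%R c D -> hder *%R e D' -> ext' (scomm D D') = scomm (ext' D) (ext' D').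
Proof.
move=> hc he hD hD'; apply: (hb_ext hB) => f a k ha.
rewrite (scomm_app _ (ext_homog hc) (ext_homog he)) !extDE.
rewrite -sgn_sEndE -aId_sgn -opp_sEndE -aIdN -add_sEndE -aIdD; congr (aId _ _ _).
rewrite (wt_scomm k hc he hD hD') (scomm_app _ hc he).
have hw := wt_homog k hc; have hw' := wt_homog k he.
rewrite !sEndD (hderE _ hD hw') (hderE _ hD' hw).
rewrite !(mulrDl, mulrDr, mulNr, sgnMl, sgnD, sgn_sgn, mulrA) (smulCE hw hw').
rewrite !(sgnMl, sgn_sgn); zmod.
Qed.

Lemma ext_scomm D D' : DerA D -> DerA D' ->
  ext' (scomm D D') = scomm (ext' D) (ext' D').
Proof.
move=> /DerA_P hD /DerA_P hD'.
have H c e := ext_scomm_h (homog_spart c D) (homog_spart e D') (hD c) (hD' e).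
rewrite -(spart_sum D) -(spart_sum D') !(scommDl, scommDr, ext_D) !H.
by [].
Qed.

Lemma DerA_scomm D D' : DerA D -> DerA D' -> DerA (scomm D D').
Proof. exact: (Der_scomm mulDl' mulDr'). Qed.

Lemma ext_iso : lie_iso (@endbr _ A) (@endbr _ (restr M)) DerA (DerM n r qN) ext'.
Proof.
split.
- split=> [D hD|D D' hD hD'|_ [D hD <-]]; first by exists D.
    by rewrite !in_setE in hD hD' *; exact: ext_inj.
  by exists D.
- by move=> D D' _ _; exact: ext_D.
- by move=> D k _; exact: ext_rscale.
- by move=> a D _; exact: ext_homog.
- exact: ext_scomm.
Qed.

(** ** The Leibniz rule for the form *)

(** By symmetry of the form, [i] pairs nontrivially with nothing but [p i], and
    conversely. *)
Lemma partner_partner i : p (p i) = i.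
Proof.
apply/esym/(partner_unique (partnerP hqN (p i))).
have [h1 _] := (homog_pair _ _).1 (hb_homog hB (inl i)).
have [h2 _] := (homog_pair _ _).1 (hb_homog hB (inl (p i))).
have [v [uv vu]] := u_inv i; rewrite (qfC qN h2 h1) sgnME.
exists (sgn (dg (inl (p i)) && dg (inl i)) v); rewrite !sgnMl !sgnMr !sgnK.
by split.
Qed.

Lemma wt_partner D i : wt D (inl (p i)) = wt D (inl i).
Proof.
apply: wt_unique; have [h1 _] := (homog_pair _ _).1 (hb_homog hB (inl i)).
have [h2 _] := (homog_pair _ _).1 (hb_homog hB (inl (p i))).
have e : u_ i = sgn (dg (inl i) && dg (inl (p i))) (u_ (p i)).
  by rewrite /diag_entry partner_partner -sgnME; exact: (qfC qN h1 h2).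
have := twice_wt D (p i); move: (wt D (inl (p i))) => w ew.
by rewrite e sEnd_sgn -ew sgnMr.
Qed.

(** The form is used through its Gram matrix only. *)
Variable Q : quadForm M.
Hypothesis hQ : forall k l, Q (B k) (B l) = match k, l with
  | inl i, inl j => if j == p i then u_ i else 0 | _, _ => 0 end.

Lemma D_QBB D k l : D (Q (B k) (B l)) = (wt D k + wt D l) * Q (B k) (B l).
Proof.
rewrite hQ; case: k l => [i|i] [j|j]; rewrite ?sEnd0 ?mulr0 //.
by case: eqP => [->|_]; rewrite ?sEnd0 ?mulr0 // wt_partner twice_wt.
Qed.

(** The sign (-1)^{c |m|}, extended linearly to all of [M]; it makes the
    Leibniz rule for the form additive in both arguments. *)
Definition twist (c : bool) (m : restr M) : restr M :=
  if c then spart false m - spart true m else m.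

Lemma twistD c : {morph twist c : x y / x + y}.
Proof. by case: c => x y //=; rewrite /twist !spartD; zmod. Qed.
Lemma twist_homog (c e : bool) m : homog e m -> twist c m = sgn (c && e) m.
Proof.
move=> hm; rewrite /twist !(spart_homog _ hm).
by case: c; case: (e) => //=; rewrite ?subr0 ?sub0r.
Qed.

(** Both sides are additive, and on multiples of basis vectors the rule
    amounts to Delta u = 2 w u for the Gram entries u. *)
Lemma ext_q (c : bool) D m m' : homog c D -> hder *%R c D ->
  D (Q m m') = Q (ext' D m) m' + Q (twist c m) (ext' D m').
Proof.
move=> hc hD; have hW := ext_homog hc.
have t0 : twist c 0 = 0 by apply: (addrI (twist c 0)); rewrite -twistD !addr0.
elim/(hb_ind hB): m => [|m1 m2 e1 e2|a k].
- by rewrite t0 sEnd0 !q0l sEnd0 addr0.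
- by rewrite twistD sEndD !qDl sEndD e1 e2; zmod.
elim/(@homog_ind A): a => [a b ha hb|e a ha].
  by rewrite aIdD add_sEndE twistD sEndD !qDl sEndD ha hb; zmod.
have hk := hb_homog hB k; have hak := homog_app (homog_aId ha) hk.
rewrite (twist_homog _ hak).
elim/(hb_ind hB): m' => [|m1 m2 e1 e2|b l].
- by rewrite sEnd0 !q0r sEnd0 addr0.
- by rewrite sEndD !qDr sEndD e1 e2; zmod.
elim/(@homog_ind A): b => [b b' hb hb'|f b hb].
  by rewrite aIdD add_sEndE sEndD !qDr sEndD hb hb'; zmod.
rewrite qsl !extDE !qal (qar Q _ hb hk).
have hw := wt_homog k hc; have hw' := wt_homog l hc.
have hx := homogD (homogM hw' hb) (homog_app hc hb).
rewrite (qar Q _ hx hk) sgnMr sEnd_sgn (hderE _ hD ha) (hderE _ hD hb) D_QBB.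
rewrite !(mulrDl, mulrDr, mulNr, sgnMl, sgnMr, sgnD, sgn_sgn, mulrA).
rewrite (smulCE hw ha) -![a * b * wt D _]mulrA (smulCE hb hw) (smulCE hb hw').
rewrite !(sgnMl, sgnMr, sgn_sgn, mulrA).
by case: (dg k); zmod.
Qed.

Lemma ext_leibq_h (c : bool) D : homog c D -> hder *%R c D -> leibq Q (ext' D).
Proof.
move=> hc hD d e m m' hm hm'; rewrite (ext_aId_h _ hc hD) (ext_q _ _ hc hD).
congr (aId _ _); rewrite (twist_homog _ hm) qsl.
by rewrite (qC Q hm (homog_app (ext_homog hc) hm')); zmod.
Qed.

Lemma ext_leibq D : DerA D -> leibq Q (ext' D).
Proof.
move=> /DerA_P hD; rewrite -(spart_sum D) ext_D; apply: leibq_add.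
  exact: (ext_leibq_h (homog_spart _ _) (hD _)).
exact: (ext_leibq_h (homog_spart _ _) (hD _)).
Qed.

(** * The structure of osp(q) and of the normalisers *)

Lemma DerM_normA D : DerA D -> normA (ext' D).
Proof. by move=> hD a; exists (D a); rewrite ext_aId. Qed.

Lemma ext_leibq' D : DerA D -> leibq Q (ext' D).
Proof. exact: ext_leibq. Qed.

(** An element [S] of S_E induces a derivation Delta of [A], and [S] minus
    Delta_M is then [A]-linear and skew for the form. *)
Lemma SE_char (E : midalg Q) : SE E = setsum (osp Q) DerM' `&` normE E.
Proof.
apply/seteqP; split=> [S hS|S [[x hx [_ [D hD <-] <-]] hN]]; last first.
  apply/SE_iff; split=> //.
    move=> a; exists (D a); rewrite scommDl ext_aId //.
    by rewrite (Alinear_scomm a hx.1) add0r.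
  by apply: leibq_add; [exact: (osp_leibq faith hx)|exact: ext_leibq'].
have [S1 S2 S3] := SE_hSE hS; split=> //.
have H c : exists x D, [/\ osp Q x, DerA D & spart c S = x + ext' D].
  have [D [hc hD eD]] := normA_der faith (homog_spart c S) (normA_spart c S1).
  have dD : DerA D by exact: (hder_Der hc hD).
  exists (spart c S - ext' D), D; rewrite subrK; split=> //.
  apply: (iffRL (ospP Q faith _)); split.
    by apply: scomm_Alinear => a; rewrite scommBl eD ext_aId // subrr.
  by apply: leibqB; [exact: leibq_spart|exact: ext_leibq'].
have [x [D [hx hD e]]] := H false; have [x' [D' [hx' hD' e']]] := H true.
exists (x + x'); first exact: (osp_D faith).
exists (ext' (D + D')); first by exists (D + D') => //; exact: zspanD.
by rewrite ext_D addrACA -e -e' spart_sum.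
Qed.

Lemma ext0 : ext' 0 = 0.
Proof. by apply: (addrI (ext' 0)); rewrite -ext_D !addr0. Qed.

Lemma Der0 : DerA 0. Proof. exact: zspan0. Qed.

Lemma direct_osp_DerM : direct (osp Q) DerM'.
Proof.
apply/seteqP; split=> [S [hS [D hD eS]]|_ ->]; last first.
  by split; [exact: osp0|exists 0; [exact: Der0|exact: ext0]].
rewrite -eS; rewrite -eS in hS; suff -> : D = 0 by exact: ext0.
apply: sEnd_ext => a; apply: (aId_inj faith).
by rewrite -ext_aId // (Alinear_scomm a hS.1) aId0.
Qed.

(** ** Operators on the radical *)

Lemma rscale_M (u : restr M) (k : K) : rscale u k =
  (rscale (u.1 : restr N) k, rscale (u.2 : restr R) k).
Proof. by rewrite !rscale_restr rscale_pair. Qed.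

Lemma prR_klin : klinearb (fun u : restr M => (0, u.2) : restr M).
Proof.
apply/asboolP; split=> [u v|u k]; first by congr (_, _); rewrite addr0.
by rewrite !rscale_M rscale0l.
Qed.
Definition prR : End := SEnd prR_klin.

Lemma prRE (u : M) : prR u = (0, u.2). Proof. by []. Qed.

Lemma prR_Alinear : Alinear prR.
Proof. by move=> u a; rewrite !prRE !rscale_pair rscale0l. Qed.

Lemma AlinearM S T : Alinear S -> Alinear T -> Alinear (S * T).
Proof. by move=> hS hT m a; rewrite !mul_sEndE hT hS. Qed.

Lemma homog_fst (c : bool) (x : N) : homog c x -> homog c ((x, 0) : restr M).
Proof. by move=> hx; apply/(@homog_pair N R); split=> //; exact: homog0. Qed.
Lemma homog_snd (c : bool) (y : R) : homog c y -> homog c ((0, y) : restr M).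
Proof. by move=> hy; apply/(@homog_pair N R); split=> //; exact: homog0. Qed.
Lemma fst_D (x x' : N) : ((x + x', 0) : restr M) = ((x, 0) : restr M) + ((x', 0) : restr M).
Proof. by congr (_, _); rewrite addr0. Qed.
Lemma snd_D (y y' : R) : ((0, y + y') : restr M) = ((0, y) : restr M) + ((0, y') : restr M).
Proof. by congr (_, _); rewrite addr0. Qed.
Lemma pair_split (u : M) : (u : restr M) = ((u.1, 0) : restr M) + ((0, u.2) : restr M).
Proof. by case: u => x y; congr (_, _); rewrite ?addr0 ?add0r. Qed.

Lemma EndR_P S : EndR S <->
  [/\ Alinear S, forall x : N, S (x, 0) = 0 & forall u : M, (S u).1 = 0].
Proof.
split=> [[f [fA Sf]]|[SA SN SR]].
  split=> [u a|x|u]; rewrite ?Sf //; last by rewrite /= sEnd0.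
  by rewrite !rscale_pair fA rscale0l.
have gk : klinearb (fun y : restr R => (S (0, y)).2 : restr R).
  apply/asboolP; split=> [y y'|y k]; first by rewrite snd_D sEndD.
  have -> : (0, rscale y k) = rscale ((0, y) : restr M) k :> restr M.
    by rewrite rscale_M rscale0l.
  by rewrite sEnd_rscale rscale_M.
exists (SEnd gk); split=> [y a|u].
  rewrite -[LHS]/((S (0, rscale (y : R) a)).2).
  have -> : (0, rscale y a) = rscale ((0, y) : M) a :> M by rewrite rscale_pair rscale0l.
  by rewrite SA rscale_pair.
rewrite {1}(pair_split u) sEndD SN add0r.
by rewrite [LHS]surjective_pairing SR.
Qed.

Lemma EndR_submodule : graded_submodule EndR.
Proof.
split.
- by apply/EndR_P; split=> // m a; rewrite !zero_sEndE rscale0l.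
- move=> S T /EndR_P[SA SN SR] /EndR_P[TA TN TR]; apply/EndR_P; split.
  + exact: AlinearD.
  + by move=> x; rewrite add_sEndE SN TN addr0.
  + by move=> u; rewrite add_sEndE -[LHS]/((S u).1 + (T u).1) SR TR addr0.
- move=> k S /EndR_P[SA SN SR]; apply/EndR_P; split.
  + by apply: scomm_Alinear => a; rewrite scommZl Alinear_scomm // scaler0.
  + by move=> x; rewrite scale_sEndE SN scaler0.
  + by move=> u; rewrite scale_sEndE -[LHS]/((k%:A : A) *: (S u).1) SR scaler0.
- move=> c S /EndR_P[SA SN SR]; apply/EndR_P; split.
  + exact: Alinear_spart.
  + apply: homog_ind => [x x' e e'|d x hx]; first by rewrite fst_D sEndD e e' addr0.
    by rewrite (spart_endE _ _ (homog_fst hx)) SN spart0.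
  + apply: (@homog_ind (restr M)) => [u v e e'|d u hu].
      by rewrite sEndD -[LHS]/((spart c S u).1 + (spart c S v).1) e e' addr0.
    by rewrite (spart_endE _ _ hu) -[LHS]/(spart (c (+) d) (S u).1) SR spart0.
Qed.

Lemma EndR_D S T : EndR S -> EndR T -> EndR (S + T).
Proof. by have [_ H _ _] := EndR_submodule; exact: H. Qed.
Lemma EndR_sgn e S : EndR S -> EndR (sgn e S).
Proof. by have [_ _ H _] := EndR_submodule; move=> /(H (-1)); case: e; rewrite ?scaleN1r // => /(H (-1)); rewrite scaleN1r opprK. Qed.
Lemma EndR_spart c S : EndR S -> EndR (spart c S).
Proof. by have [_ _ _ H] := EndR_submodule; exact: H. Qed.

Lemma EndR_scomm S T : EndR S -> EndR T -> EndR (scomm S T).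
Proof.
move=> hS hT; rewrite -(spart_sum S) -(spart_sum T) scommDl !scommDr.
have EM X Y : EndR X -> EndR Y -> EndR (X * Y).
  move=> /EndR_P[SA SN SR] /EndR_P[TA TN TR]; apply/EndR_P; split.
  + exact: AlinearM.
  + by move=> x; rewrite mul_sEndE TN sEnd0.
  + by move=> u; rewrite mul_sEndE SR.
have H c d : EndR (scomm (spart c S) (spart d T)).
  rewrite (scommE (homog_spart c S) (homog_spart d T)) -[- _]/(sgn true _).
  by apply: EndR_D; [|apply: (@EndR_sgn true); apply: EndR_sgn]; apply: EM; exact: EndR_spart.
by apply: EndR_D; apply: EndR_D; exact: H.
Qed.

Lemma ext_pres D : (forall x : N, (ext' D (x, 0)).2 = 0) /\ (forall y : R, (ext' D (0, y)).1 = 0).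
Proof.
suff H (m : restr M) : (ext' D (m.1, 0)).2 = 0 /\ (ext' D (0, m.2)).1 = 0.
  by split=> z; [have [] := H ((z, 0) : restr M)|have [] := H ((0, z) : restr M)].
elim/(hb_ind hB): m => [|m m' [e1 e2] [e3 e4]|a k].
- by rewrite sEnd0.
- rewrite -[(m + m').1]/(m.1 + m'.1) -[(m + m').2]/(m.2 + m'.2) fst_D snd_D !sEndD.
  split; first by rewrite -[LHS]/((ext' D (m.1, 0)).2 + (ext' D (m'.1, 0)).2) e1 e3 addr0.
  by rewrite -[LHS]/((ext' D (0, m.2)).1 + (ext' D (0, m'.2)).1) e2 e4 addr0.
case: k => k.
  have em (b : A) : b%:A' (B (inl k)) = (b *: n k, 0) by congr (_, _); exact: scaler0.
  have := extDE D a (inl k); rewrite !em => e /=.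
  by rewrite e -[(0, 0)]/(0 : restr M) sEnd0.
have em (b : A) : b%:A' (B (inr k)) = (0, b *: r k) by congr (_, _); exact: scaler0.
have := extDE D a (inr k); rewrite !em => e /=.
by rewrite e -[(0, 0)]/(0 : restr M) sEnd0.
Qed.

Lemma EndR_ext S D : EndR S -> DerA D -> EndR (scomm S (ext' D)).
Proof.
move=> hS hD; rewrite -(spart_sum S) -(spart_sum D) ext_D scommDl !scommDr.
have H c d : EndR (scomm (spart c S) (ext' (spart d D))).
  have hSc := EndR_spart c hS; have /EndR_P[SA SN SR] := hSc.
  have hDd : DerA (spart d D) by exact: DerA_spart.
  have hd := ext_homog (homog_spart d D).
  have [pN pR] := ext_pres (spart d D).
  apply/EndR_P; split.
  - rewrite (scommC (homog_spart c S) hd) -[- _]/(sgn true _) sgn_sgn.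
    apply: scomm_Alinear => a; rewrite scomm_sgnl.
    by rewrite (Alinear_scomm _ (Alinear_scomm_normA (DerM_normA hDd) SA)) sgn0.
  - move=> x; rewrite (scomm_app _ (homog_spart c S) hd) SN sEnd0 sgn0 subr0.
    by rewrite [ext' _ _]surjective_pairing pN SN.
  - move=> u; rewrite (scomm_app _ (homog_spart c S) hd).
    have e1 : spart c S u = (0, (spart c S u).2) :> restr M.
      by rewrite {1}[spart c S u]surjective_pairing SR.
    have w0 : (ext' (spart d D) (spart c S u)).1 = 0 by rewrite e1 pR.
    have v0 := SR (ext' (spart d D) u).
    move: (ext' (spart d D) (spart c S u)) (spart c S (ext' (spart d D) u)) w0 v0 => w v w0 v0.
    by case: (c && d); rewrite /sgn -[LHS]/(v.1 - _) v0 /= w0 ?opprK ?oppr0 addr0.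
by apply: EndR_D; apply: EndR_D; exact: H.
Qed.

(** ** End_A R (+) (Der A)_M is a subalgebra *)

(** Delta_M preserves [N] and [R], hence normalises End_A R. *)
Lemma S0_subalgebra : subalgebra (@endbr _ (restr M)) S0.
Proof.
have [E0 ED EZ EP] := EndR_submodule.
split; first split.
- by exists 0 => //; exists 0; [exists 0; [exact: Der0|exact: ext0]|rewrite addr0].
- move=> _ _ [f hf [_ [D hD <-] <-]] [g hg [_ [D' hD' <-] <-]].
  exists (f + g); first exact: ED.
  exists (ext' (D + D')); first by exists (D + D') => //; exact: zspanD.
  by rewrite ext_D addrACA.
- move=> k _ [f hf [_ [D hD <-] <-]]; exists (k *: f); first exact: EZ.
  exists (ext' (k *: D)).
    exists (k *: D) => //; apply: DerZ => //.
    + by move=> w x y; exact: mulrDl.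
    + by move=> w x y; exact: mulrDr.
    + by move=> l x y; rewrite scalerAl.
    + by move=> c d x y; exact: homogM.
    + by move=> x y l; rewrite !rscale_ext mulrA.
  by rewrite ext_Z scalerDr.
- move=> c _ [f hf [_ [D hD <-] <-]]; exists (spart c f); first exact: EP.
  exists (ext' (spart c D)); first by exists (spart c D) => //; exact: DerA_spart.
  by rewrite -ext_spart spartD.
move=> _ _ [f hf [_ [D hD <-] <-]] [g hg [_ [D' hD' <-] <-]].
exists (scomm f g + scomm f (ext' D') + scomm (ext' D) g).
  apply: EndR_D; first by apply: EndR_D; [exact: EndR_scomm|exact: EndR_ext].
  rewrite -(spart_sum (ext' D)) -(spart_sum g) !ext_spart scommDl !scommDr.
  have H c d : EndR (scomm (ext' (spart c D)) (spart d g)).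
    rewrite (scommC (ext_homog (homog_spart c D)) (homog_spart d g)).
    rewrite -[- _]/(sgn true _) sgn_sgn; apply: EndR_sgn; apply: EndR_ext.
      exact: EndR_spart.
    exact: DerA_spart.
  by apply: EndR_D; apply: EndR_D; exact: H.
exists (ext' (scomm D D')); first by exists (scomm D D') => //; exact: DerA_scomm.
rewrite ext_scomm // /endbr scommDl !scommDr; zmod.
Qed.

Lemma DerM_subalgebra : subalgebra (@endbr _ (restr M)) DerM'.
Proof.
split; first split.
- by exists 0; [exact: Der0|exact: ext0].
- move=> _ _ [D hD <-] [D' hD' <-]; exists (D + D'); first exact: zspanD.
  exact: ext_D.
- move=> k _ [D hD <-]; exists (k *: D); last exact: ext_Z.
  apply: DerZ => //.
  + by move=> w x y; exact: mulrDl.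
  + by move=> w x y; exact: mulrDr.
  + by move=> l x y; rewrite scalerAl.
  + by move=> c d x y; exact: homogM.
  + by move=> x y l; rewrite !rscale_ext mulrA.
- move=> c _ [D hD <-]; exists (spart c D); first exact: DerA_spart.
  exact/esym/ext_spart.
move=> _ _ [D hD <-] [D' hD' <-]; exists (scomm D D'); first exact: DerA_scomm.
exact: ext_scomm.
Qed.

(** * Expanding osp(q) along the basis *)

Lemma coord_pair (x : N) (y : R) : Defs.coord (sum_basis n r) (x, y) =
  sum_coef (Defs.coord n x) (Defs.coord r y).
Proof.
apply: (coord_unique (homog_basis_sum hn hr)).
by apply: is_coord_sum; exact: coordP.
Qed.

Lemma coord0 (V : superLmodType A) (X : choiceType) (b : X -> V) : homog_basis b ->
  Defs.coord b 0 = fun=> 0.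
Proof.
by move=> hb; apply: (coord_unique hb); apply/is_coord_seq; exists [::]; rewrite big_nil.
Qed.

Lemma coord_eq0 (V : superLmodType A) (X : choiceType) (b : X -> V) v : homog_basis b ->
  (forall i, Defs.coord b v i = 0) -> v = 0.
Proof.
move=> hb v0; have /is_coord_seq[F [_ _ ->]] := coordP hb v.
by rewrite big1 // => i _; rewrite v0 scale0r.
Qed.

Lemma Q_coord (v : restr M) j : Q v (B (inl j)) = co (inl (p j)) v * u_ (p j).
Proof.
have pp := partner_partner.
elim/(hb_ind hB): v => [|v v' e e'|a k].
- by rewrite (co0 hB) q0l mul0r.
- by rewrite qDl (hb_coD hB) e e' mulrDl.
rewrite qal hQ (hb_co hB); case: k => k /=; last by rewrite mulr0 mul0r.
have -> : (j == p k) = (inl (p j) == inl k :> I + J).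
  by apply/eqP/eqP => [->|[<-]]; rewrite pp.
by case: eqP => [[->]|_]; rewrite ?mulr0 ?mul0r.
Qed.

Lemma Q_rad_l (v : restr M) j : Q v (B (inr j)) = 0.
Proof.
elim/(hb_ind hB): v => [|v v' e e'|a k]; first by rewrite q0l.
  by rewrite qDl e e' addr0.
by rewrite qal hQ; case: k => k /=; rewrite mulr0.
Qed.

Lemma Q_eq0 (v m : restr M) : (forall k, Q v (B k) = 0) -> Q v m = 0.
Proof.
move=> v0; elim/(hb_ind hB): m => [|m m' e e'|a k]; first by rewrite q0r.
  by rewrite qDr e e' addr0.
elim/(@homog_ind A): a => [a b ha hb|c a ha].
  by rewrite aIdD add_sEndE qDr ha hb addr0.
have -> : a%:A' (B k) = sgn (c && dg k) (rscale (B k : M) a).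
  by rewrite (rscale_aId ha (hb_homog hB k)) sgnK.
by rewrite qsr qfZr v0 mul0r sgn0.
Qed.

Lemma Q_radl (y : R) m : Q ((0, y) : restr M) m = 0.
Proof.
apply: Q_eq0 => -[j|j]; last exact: Q_rad_l.
by rewrite Q_coord coord_pair /= (coord0 hn) mul0r.
Qed.

Lemma Q_radr (y : R) m : Q m ((0, y) : restr M) = 0.
Proof.
elim/(@homog_ind R): y => [y y' e e'|c y hy]; first by rewrite snd_D qDr e e' addr0.
elim/(@homog_ind (restr M)): m => [m m' e e'|d m hm]; first by rewrite qDl e e' addr0.
by rewrite (qC Q hm (homog_snd hy)) Q_radl sgn0.
Qed.

Lemma radP (v : restr M) : (forall m, Q v m = 0) -> v.1 = 0.
Proof.
move=> v0; apply: (coord_eq0 hn) => i.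
have [uV _] := rinvP (u_inv i).
have := Q_coord v (p i); rewrite v0 partner_partner => /esym.
rewrite [v in co _ v](surjective_pairing v) coord_pair /= => e.
by rewrite -[LHS]mulr1 -uV mulrA e mul0r.
Qed.

Lemma osp_skew S (c d : bool) m m' : osp Q S -> homog c m -> homog d m' ->
  Q (S m) m' = - sgn (c && d) (Q (S m') m).
Proof.
move=> [_ h] hm hm'; have /eqP := h _ _ _ _ hm hm'.
by rewrite sgnME addr_eq0 => /eqP.
Qed.

(** The radical [R] of the form is invariant under skew operators. *)
Lemma osp_R S (y : R) : osp Q S -> (S (0, y)).1 = 0.
Proof.
move=> hS; elim/(@homog_ind R): y => [y y' e e'|c y hy].
  by rewrite snd_D sEndD -[LHS]/((S (0, y)).1 + (S (0, y')).1) e e' addr0.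
apply: radP => m; elim/(@homog_ind (restr M)): m => [m m' e e'|d m hm].
  by rewrite qDr e e' addr0.
by rewrite (osp_skew hS (homog_snd hy) hm) Q_radr sgn0 oppr0.
Qed.

Lemma EndR_osp S : EndR S -> osp Q S.
Proof.
move=> /EndR_P[SA SN SR]; split=> // c d m m' hm hm'.
have SQ v w : Q (S v) w = 0.
  by rewrite [S v]surjective_pairing SR Q_radl.
by rewrite !SQ mulr0 addr0.
Qed.

Definition osp_N S : Prop := osp Q S /\ forall y : R, S (0, y) = 0.

(** The part of [S] acting on [R] alone is skew for trivial reasons. *)
Lemma osp_split S : osp Q S -> exists S' f, [/\ osp_N S', EndR f & S = S' + f].
Proof.
move=> hS; pose f := prR * S * prR.
have fE u : f u = (0, (S (0, u.2)).2) by [].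
have hf : EndR f.
  apply/EndR_P; split=> [|x|u]; rewrite ?fE //.
    apply: AlinearM; last exact: prR_Alinear.
    by apply: AlinearM; [exact: prR_Alinear|exact: hS.1].
  by rewrite -[(0, (x, 0).2)]/(0 : restr M) sEnd0.
exists (S - f), f; rewrite subrK; split=> //; split.
  by apply: (ospB faith) => //; exact: EndR_osp.
move=> y; rewrite add_sEndE opp_sEndE fE /= [S (0, y)]surjective_pairing (osp_R y hS).
exact: subrr.
Qed.

Lemma osp_N_EndR S : osp_N S -> EndR S -> S = 0.
Proof.
move=> [_ SN] /EndR_P[_ SR _]; apply: sEnd_ext => u.
by rewrite (pair_split u) sEndD SR SN addr0.
Qed.

Lemma eosp_kills S (y : R) : eosp Q S -> S (0, y) = 0.
Proof.
move: S; apply: zspan_ind => // [S T eS eT|_ [m [m' ->]]].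
  by rewrite add_sEndE opp_sEndE eS eT subrr.
elim/(@homog_ind (restr M)): m => [m v e e'|c m hm]; first by rewrite EDl add_sEndE e e' addr0.
elim/(@homog_ind (restr M)): m' => [m' v e e'|d m' hm'].
  by rewrite EDr add_sEndE e e' addr0.
elim/(@homog_ind R): y => [y y' e e'|b y hy]; first by rewrite snd_D sEndD e e' addr0.
by rewrite (EmapE Q hm hm' (homog_snd hy)) !Q_radr aId0 !zero_sEndE !sgn0 subrr.
Qed.

(** ** Truncated expansions *)

Definition dual (i : I) : restr M := (rinv (u_ (p i)))%:A' (B (inl (p i))).

(** The coefficients of the expansion of [S] as the sum of the operators
    E_{m_i, n_i'}, with n_i' dual to n_i.  Each of the two terms of E_{m,n}
    contributes to the component of [S] from [N] to [N], whence the factor 1/2;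
    only the first contributes to the component from [N] to [R]. *)
Definition half_N S (i : I) : restr M :=
  hlf K *: (((S (B (inl i))).1, 0) : restr M) + ((0, (S (B (inl i))).2) : restr M).

Definition trunc S (F : seq I) : End := \sum_(i <- F) Emap Q (half_N S i) (dual i).

Lemma dg_partner i : dg (inl (p i)) = dg (inl i).
Proof.
have h : homog (dg (inl i) (+) dg (inl (p i))) (u_ i).
  have [h1 _] := (homog_pair _ _).1 (hb_homog hB (inl i)).
  have [h2 _] := (homog_pair _ _).1 (hb_homog hB (inl (p i))).
  exact: (qf_homog qN h1 h2).
have h0 := u_homog i.
case e : (dg (inl i) (+) dg (inl (p i))) h => h.
  exfalso; apply: (invertible_neq0 (u_inv i)).
  by rewrite -h (spart_homog _ h0).
by move: e; case: (dg _); case: (dg _).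
Qed.

Lemma dual_homog i : homog (dg (inl i)) (dual i).
Proof.
have h := homog_rinv (u_homog (p i)) (u_inv (p i)).
have := homog_app (homog_aId h) (hb_homog hB (inl (p i))).
by rewrite dg_partner.
Qed.

Lemma Q_dual i k : Q (dual i) (B k) = if k == inl i then 1 else 0.
Proof.
have pp := partner_partner; have [_ Vu] := rinvP (u_inv (p i)).
rewrite /dual qal hQ pp; case: k => k /=; last by rewrite mulr0.
have -> : (inl k == inl i :> I + J) = (k == i) by apply/eqP/eqP => [[->]|->].
by case: eqP => _; rewrite ?mulr0.
Qed.

Lemma Q_half_N S i m : Q (half_N S i) m = hlf K *: Q (S (B (inl i))) m.
Proof.
rewrite /half_N qDl Q_radl addr0 qZl; congr (_ *: _).
by rewrite [in RHS](pair_split (S (B (inl i)))) qDl Q_radl addr0.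
Qed.

Lemma Emap_dual S i k : osp Q S -> Emap Q (half_N S i) (dual i) (B (inl k)) =
  (if k == i then half_N S i else 0) + hlf K *: ((Q (S (B (inl k))) (B (inl i)))%:A' (dual i)).
Proof.
move=> hS; have hk := hb_homog hB (inl k); have hi := hb_homog hB (inl i).
rewrite [LHS](Efun_homog Q _ (dual_homog i) hk) Q_dual Q_half_N sgnZE.
have -> : (inl k == inl i :> I + J) = (k == i) by apply/eqP/eqP => [[->]|->].
congr (_ + _); first by case: eqP => _; rewrite ?(@rscale1 A M) // rscale0r.
rewrite (osp_skew hS hi hk) -aIdE aIdZ scale_sEndE.
rewrite aIdN aId_sgn opp_sEndE sgn_sEndE scalerN sgn_scale.
by case: (dg (inl i)); case: (dg (inl k)); zmod.
Qed.

Lemma sum_uniq_ext (V : zmodType) (X : eqType) (G : X -> V) (F F' : seq X) :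
  uniq F -> uniq F' -> (forall k, k \notin F -> G k = 0) ->
  (forall k, k \notin F' -> G k = 0) -> \sum_(k <- F) G k = \sum_(k <- F') G k.
Proof.
move=> u u' z z'; have fl (L L' : seq X) : (forall k, k \notin L' -> G k = 0) ->
    \sum_(k <- L) G k = \sum_(k <- [seq k <- L | k \in L']) G k.
  move=> zz; rewrite big_filter (bigID (mem L')) /= [X in _ + X]big1 ?addr0 //.
rewrite (fl F F') // (fl F' F) //; apply: perm_big; apply: uniq_perm.
- exact: filter_uniq.
- exact: filter_uniq.
- by move=> k; rewrite !mem_filter andbC.
Qed.

Lemma eosp_trunc S F : eosp Q (trunc S F).
Proof.
apply: (big_ind (eosp Q)) => [|x y hx hy|i _].
- exact: zspan0.
- exact: zspanD.
- exact: eosp_gen.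
Qed.

Lemma eosp_Alinear S : eosp Q S -> Alinear S.
Proof.
move: S; apply: zspan_ind => [|S T|_ [m [m' ->]]].
- by move=> m a; rewrite !zero_sEndE rscale0l.
- exact: AlinearB.
- exact: E_Alinear.
Qed.

Lemma trunc_app S F v : trunc S F v = \sum_(i <- F) Emap Q (half_N S i) (dual i) v.
Proof. exact: (big_morph (fun f : End => f v) (fun f g => erefl) erefl). Qed.

Lemma sum_fst (v : restr M) : exists F0 : seq I, forall F, uniq F -> {subset F0 <= F} ->
  \sum_(i <- F) (Q v (B (inl i)))%:A' (dual i) = ((v.1, 0) : restr M).
Proof.
have pp := partner_partner.
have /is_coord_seq[F' [uF' zF' e]] := coordP hn v.1.
exists (map p F') => F uF sF.
pose G j : restr M := (Defs.coord n v.1 j)%:A' (B (inl j)).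
have -> : ((v.1, 0) : restr M) = \sum_(j <- F') G j.
  have G_fst (L : seq I) : \sum_(j <- L) G j =
      ((\sum_(j <- L) Defs.coord n v.1 j *: n j, 0) : restr M).
    elim: L => [|j L IH]; first by rewrite !big_nil.
    by rewrite !big_cons IH; congr (_, _); rewrite /= ?scaler0 ?addr0.
  by rewrite G_fst -e.
have -> : \sum_(j <- F') G j = \sum_(i <- map p F') G (p i).
  by rewrite big_map; apply: eq_bigr => j _; rewrite pp.
have GE i : (Q v (B (inl i)))%:A' (dual i) = G (p i).
  have [uV _] := rinvP (u_inv (p i)).
  rewrite /dual aId_app Q_coord -mulrA uV mulr1.
  by rewrite [v in co _ v](surjective_pairing v) coord_pair.
rewrite (eq_bigr (fun i => G (p i))); last by move=> i _; exact: GE.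
have G0 i : i \notin map p F' -> G (p i) = 0.
  move=> ni; rewrite /G zF' ?aId0 ?zero_sEndE //.
  by apply: contraNN ni => pF; rewrite -(pp i) map_f.
apply: sum_uniq_ext => //.
- by rewrite map_inj_uniq //; exact: (can_inj pp).
- by move=> i ni; apply: G0; apply: contraNN ni => /sF.
Qed.

Lemma Alinear_kill S k a : Alinear S -> S (B k) = 0 -> S (a%:A' (B k)) = 0.
Proof.
move=> SA Sk; elim/(@homog_ind A): a => [a b ha hb|c a ha].
  by rewrite aIdD add_sEndE sEndD ha hb addr0.
rewrite -(spart_sum S) add_sEndE.
have H d : spart d S (a%:A' (B k)) = 0.
  rewrite (AlinearE _ (Alinear_spart d SA) (homog_spart d S) ha).
  by rewrite (spart_endE _ _ (hb_homog hB k)) Sk spart0 sEnd0 sgn0.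
by rewrite !H addr0.
Qed.

(** All truncations over sets containing [F0] are allowed, so that one
    truncation serves finitely many vectors at once. *)
Lemma osp_trunc S v : osp_N S -> exists F0 : seq I,
  forall F, uniq F -> {subset F0 <= F} -> S v = trunc S F v.
Proof.
move=> [hS SN]; elim/(hb_ind hB): v => [|v v' [F1 e1] [F2 e2]|a k].
- by exists [::] => F _ _; rewrite !sEnd0.
- exists (F1 ++ F2) => F uF sF; rewrite !sEndD -e1 -?e2 // => i iF; apply: sF.
    by rewrite mem_cat iF orbT.
  by rewrite mem_cat iF.
case: k => k; last first.
  exists [::] => F _ _; have -> : a%:A' (B (inr k)) = (0, a *: r k).
    by congr (_, _); exact: scaler0.
  by rewrite SN (eosp_kills _ (eosp_trunc S F)).
have [F1 e1] := sum_fst (S (B (inl k))).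
exists (k :: F1) => F uF sF; apply/eqP; rewrite -subr_eq0; apply/eqP.
rewrite -[LHS]/((S - trunc S F) (a%:A' (B (inl k)))); apply: Alinear_kill.
  by apply: AlinearB; [exact: hS.1|exact: eosp_Alinear (eosp_trunc S F)].
rewrite add_sEndE opp_sEndE trunc_app.
rewrite (eq_bigr _ (fun i _ => Emap_dual i k hS)) big_split /= -scaler_sumr e1 //; last first.
  by move=> i iF; apply: sF; rewrite inE iF orbT.
have -> : \sum_(i <- F) (if k == i then half_N S i else 0) = half_N S k.
  rewrite (@sum_uniq_ext _ _ _ F [:: k]) //.
  - by rewrite big_seq1 eqxx.
  - by move=> i; case: eqP => [<-|//]; rewrite sF // inE eqxx.
  - by move=> i; rewrite inE eq_sym => /negPf ->.
rewrite {1}(pair_split (S (B (inl k)))) /half_N.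
set x : restr M := (_, 0); set y : restr M := (0, _).
have ex : x = hlf K *: x + hlf K *: x by rewrite -scalerDr (hlfD half).
by rewrite {1}ex; zmod.
Qed.

Lemma osp_N_eosp S : finite_set [set: I] -> osp_N S -> eosp Q S.
Proof.
move=> fI hS; have F_all i : i \in (fset_set [set: I] : seq I).
  by have := in_fset_set fI i; rewrite in_setT => ->.
have -> : S = trunc S (fset_set [set: I]).
  apply: sEnd_ext => v; have [F0 e] := osp_trunc v hS.
  by apply: e => [|i _]; [exact: fset_uniq|exact: F_all].
exact: eosp_trunc.
Qed.

Lemma osp_N_closure S : osp_N S -> sum_closure (eosp Q) S.
Proof.
move=> hS; exists I, (fun i => Emap Q (half_N S i) (dual i)).
have H v : exists F : seq I, [/\ uniq F,
    forall i, i \notin F -> Emap Q (half_N S i) (dual i) v = 0 &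
    S v = \sum_(i <- F) Emap Q (half_N S i) (dual i) v].
  have [F0 e] := osp_trunc v hS; exists (undup F0).
  have e0 : S v = trunc S (undup F0) v.
    by apply: e; [exact: undup_uniq|move=> i; rewrite mem_undup].
  split; [exact: undup_uniq| |by rewrite -trunc_app].
  move=> i ni; have : S v = trunc S (i :: undup F0) v.
    apply: e; first by rewrite /= ni undup_uniq.
    by move=> j jF; rewrite inE mem_undup jF orbT.
  rewrite trunc_app big_cons -trunc_app -e0 => /eqP.
  by rewrite -subr_eq subrr => /eqP.
split=> [i|v|v]; first exact: eosp_gen.
- have [F [_ zF _]] := H v; apply: (@sub_finite_set _ _ [set i | i \in F]).
    by move=> i; apply: contraNT => /zF e; apply/eqP; exact: e.
  exact: finite_seq.
have [F [uF zF ->]] := H v; exact/esym/fsum_seq.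
Qed.

Lemma closure_kills S (y : R) : sum_closure (eosp Q) S -> S (0, y) = 0.
Proof.
move=> [X [x [hx _ e]]]; rewrite e; apply: fsbig1 => i _.
exact: eosp_kills (hx i).
Qed.

(** ** Local innerness *)

Section Local.
Variable E : midalg Q.
Hypothesis hE : mid_set E = eosp Q.

Lemma osp_SE S : osp Q S -> SE E S.
Proof.
move=> hS; apply/SE_iff; split.
- exact: osp_normA hS.
- exact: (osp_leibq faith hS).
- by rewrite hE => f; apply: eosp_norm => //; exact: (osp_leibq faith hS).
Qed.

Lemma scomm_trunc S f : osp_N S -> eosp Q f -> exists F0 : seq I,
  forall F, uniq F -> {subset F0 <= F} -> scomm S f = scomm (trunc S F) f.
Proof.
move=> hS; move: f; apply: zspan_ind => [|f g [F1 e1] [F2 e2]|_ [m [m' ->]]].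
- by exists [::] => F _ _; rewrite !scomm0r.
- exists (F1 ++ F2) => F uF sF; rewrite !scommBr -e1 -?e2 // => i iF; apply: sF.
    by rewrite mem_cat iF orbT.
  by rewrite mem_cat iF.
have [F1 e1] := osp_trunc (spart false m) hS; have [F2 e2] := osp_trunc (spart true m) hS.
have [F3 e3] := osp_trunc (spart false m') hS; have [F4 e4] := osp_trunc (spart true m') hS.
exists (F1 ++ F2 ++ F3 ++ F4) => F uF sF; apply/eqP; rewrite -subr_eq0 -scommBl; apply/eqP.
have hT : osp Q (trunc S F) by apply: (mid_osp (m := E)); rewrite hE; exact: eosp_trunc.
have lS : leibq Q (S - trunc S F).
  by apply: leibqB; [exact: (osp_leibq faith hS.1)|exact: (osp_leibq faith hT)].
have Z c : (S - trunc S F) (spart c m) = 0 /\ (S - trunc S F) (spart c m') = 0.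
  rewrite !add_sEndE !opp_sEndE; case: c; rewrite -?e1 -?e2 -?e3 -?e4 ?subrr // => i iF;
    by apply: sF; rewrite !mem_cat iF ?orbT.
have H c d : scomm (S - trunc S F) (Emap Q (spart c m) (spart d m')) = 0.
  have [[z1 _] [_ z2]] := (Z c, Z d).
  exact: (scomm_Emap0 lS (homog_spart c m) (homog_spart d m') z1 z2).
rewrite -(spart_sum m) -(spart_sum m') EDl !EDr !scommDr.
by rewrite !H !addr0.
Qed.

(** On a finite set, d_{S,0} agrees with the inner derivation by a truncation:
    elements of eosp(q) are determined by finitely many vectors, as
    [S, E_{m,n}] only depends on [S m] and [S n]. *)
Lemma osp_N_locally_inner S : osp_N S -> locally_inner (einf_br E) (dS E S).
Proof.
move=> hS; have SES := osp_SE hS.1; split; first exact: dS_Der.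
have ET F : mid_set E (trunc S F) by rewrite hE; exact: eosp_trunc.
have loc u : exists F0 : seq I, forall F, uniq F -> {subset F0 <= F} ->
    dS E S u = dS E (trunc S F) u.
  have Eu : eosp Q (cE u) by rewrite -hE; exact: cE_mid.
  have [F1 e1] := osp_trunc (cM u) hS; have [F2 e2] := osp_trunc (cN u) hS.
  have [F3 e3] := scomm_trunc hS Eu.
  exists (F1 ++ F2 ++ F3) => F uF sF.
  have [f1 f2 f3 f4] := dSE faith u SES.
  have [g1 g2 g3 g4] := dSE faith u (mid_SE (ET F)).
  apply: einf_ext.
  - apply: (aId_inj faith); rewrite f1 g1 (Alinear_scomm _ hS.1.1).
    by rewrite (Alinear_scomm _ (mid_Alinear (ET F))).
  - by rewrite f2 g2; apply: e1 => // i iF; apply: sF; rewrite !mem_cat iF.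
  - by rewrite f3 g3; apply: e2 => // i iF; apply: sF; rewrite !mem_cat iF orbT.
  - by rewrite f4 g4; apply: e3 => // i iF; apply: sF; rewrite !mem_cat iF !orbT.
move=> s; have [F0 e] : exists F0 : seq I, forall F, uniq F -> {subset F0 <= F} ->
    forall u, u \in s -> dS E S u = dS E (trunc S F) u.
  elim: s => [|u s [F1 e1]]; first by exists [::].
  have [F2 e2] := loc u; exists (F1 ++ F2) => F uF sF v; rewrite inE => /orP[/eqP ->|vs].
    by apply: e2 => // i iF; apply: sF; rewrite mem_cat iF orbT.
  by apply: e1 => // i iF; apply: sF; rewrite mem_cat iF.
exists (einf_mid (toMid (ET (undup F0)))) => u us.
rewrite (e (undup F0)) ?undup_uniq //; last by move=> i; rewrite mem_undup.
by rewrite -[in LHS](_ : mval (toMid (ET (undup F0))) = trunc S (undup F0)) // dS_mid.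
Qed.

End Local.

(** * The theorem for the data of a single basis *)

Variables (o o' : I) (g : I + J).
Hypotheses (ho : partner_of n qN o o) (ho' : partner_of n qN o' o').
Hypotheses (oo' : o != o') (go : g != inl o) (go' : g != inl o').

Lemma self_partner i : partner_of n qN i i -> p i = i.
Proof. by move=> hi; apply: (partner_unique hi); have [] := partnerP hqN i. Qed.

Lemma Q_self i : p i = i -> Q (B (inl i)) (B (inl i)) = u_ i.
Proof. by move=> hi; rewrite hQ hi eqxx. Qed.

(** The two vectors of the invertibly diagonalizable summand are axes. *)
Lemma scalars_M (c : bool) T : homog c T ->
  (forall a, Alinear (scomm T a%:A')) ->
  (forall m m', exists b, scomm T (Emap Q m m') = b%:A') ->
  (forall (e f : bool) m m', homog e m -> homog f m' ->
     scomm T (Q m m')%:A' = Emap Q (T m) m' + sgn (e && f) (Emap Q (T m') m)) ->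
  exists2 a, homog c a & T = a%:A'.
Proof.
move=> hT TA TE T2.
have ax i : partner_of n qN i i -> axis B dg Q T (inl i).
  move=> /self_partner pi; have hi := hb_homog hB (inl i).
  have ui : invertible (Q (B (inl i)) (B (inl i))).
    by rewrite (Q_self pi); exact: u_inv.
  have dg0 : dg (inl i) = false.
    case e : (dg (inl i)) => //; exfalso; apply: (invertible_neq0 ui).
    apply: (twice0 half); rewrite {1}(qC Q hi hi) e.
    exact: addNr.
  split=> // [k|].
    rewrite hQ; case: k => // j; rewrite pi; case: (eqVneq j i) => [->|//].
    by rewrite eqxx.
  by rewrite (T2 _ _ _ _ hi hi) dg0.
apply: (T_scalar hB hT TA TE (ax _ ho) (ax _ ho') _ go go').
by apply: contraNN oo' => /eqP[->].
Qed.

Section Mid.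
Variable E : midalg Q.

Lemma DerE_setsum : Der (einf_br E) = setsum (range (ad E)) (d0 E (SE E)).
Proof. by apply: (Der_setsum E half faith) => c T; exact: scalars_M. Qed.

Lemma semidirect_DerE (X : set End) :
  semidirect (@endbr _ (restr M)) (SE E) (mid_set E) X ->
  semidirect (@endbr _ (Einf E)) (Der (einf_br E)) (range (ad E)) (d0 E X).
Proof. by apply: (semidirect_Der half faith) => c T; exact: scalars_M. Qed.

Lemma SE_split S : SE E S -> exists x D, [/\ osp Q x, DerA D & S = x + ext' D].
Proof.
rewrite SE_char => -[[x hx [_ [D hD <-] <-]] _].
by exists x, D.
Qed.

Lemma osp_norm_SE S : osp Q S -> (forall x, mid_set E x -> mid_set E (endbr S x)) -> SE E S.
Proof.
by move=> hS nS; apply/SE_iff; split=> //; [exact: osp_normA hS|exact: (osp_leibq faith hS)].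
Qed.

Lemma ext_norm_SE D : DerA D ->
  (forall x, mid_set E x -> mid_set E (endbr (ext' D) x)) -> SE E (ext' D).
Proof.
move=> hD nD; apply/SE_iff; split=> //.
  exact: (DerM_normA hD).
exact: (ext_leibq' hD).
Qed.

(** An [A]-linear Delta_M lies in osp(q), which meets (Der A)_M trivially. *)
Lemma S0_Alinear f D : EndR f -> DerA D -> Alinear (f + ext' D) -> ext' D = 0.
Proof.
move=> /EndR_P[fA _ _] hD fD; suff : (osp Q `&` DerM') (ext' D).
  by rewrite direct_osp_DerM.
split; last by exists D.
apply/(iffRL (ospP Q faith _)); split; last exact: (ext_leibq' hD).
by rewrite -[ext' D](addKr f) addrC; apply: AlinearB.
Qed.

Lemma mid_ideal : ideal (@endbr _ (restr M)) (SE E) (mid_set E).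
Proof.
split; [exact: (mid_subalgebra E).1|exact: mid_SE|].
move=> S f hS Ef; split; first by have [_ _] := SE_hSE hS; exact.
apply: (@scomm_swap K (restr M) (mid_set E) S f) => [x y|e x|a b].
- exact: midD.
- exact: mid_sgn.
by have [_ _] := SE_hSE (SE_spart a hS); apply; exact: mid_spart.
Qed.

(** ** The case in which E consists of the elements of osp(q) killing R *)

(** Both E = eosp(q) in finite rank and the closure of eosp(q) are of this
    kind, by the expansion above. *)
Lemma semidirect_killing :
  (forall S, osp_N S -> mid_set E S) -> (forall S, mid_set E S -> forall y : R, S (0, y) = 0) ->
  S0 `<=` SE E -> semidirect (@endbr _ (restr M)) (SE E) (mid_set E) S0.
Proof.
move=> NE EN SS; split.
- apply/seteqP; split=> [S hS|_ [x Ex [S hS <-]]]; last first.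
    by apply: SE_D; [exact: mid_SE|exact: SS].
  have [x [D [hx hD ->]]] := SE_split hS.
  have [x' [f [hx' hf ->]]] := osp_split hx.
  exists x'; first exact: NE.
  exists (f + ext' D); last by rewrite addrA.
  by exists f => //; exists (ext' D) => //; exists D.
- apply/seteqP; split=> [S [ES [f hf [_ [D hD <-] eS]]]|_ ->]; last first.
    split; first exact: mid0.
    by have [[z _ _ _] _] := S0_subalgebra.
  have eD : ext' D = 0.
    by apply: (S0_Alinear hf hD); rewrite eS; exact: mid_Alinear ES.
  rewrite eD addr0 in eS; rewrite -eS in ES *; apply: osp_N_EndR => //.
  by split; [exact: mid_osp ES|exact: EN].
- exact: mid_ideal.
- exact: S0_subalgebra.
Qed.

Lemma scomm_kills S f : (forall y : R, (S (0, y)).1 = 0) -> (forall y : R, f (0, y) = 0) ->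
  forall y : R, scomm S f (0, y) = 0.
Proof.
move=> SR fR y; rewrite -(spart_sum S) -(spart_sum f) scommDl !scommDr.
have H c d : scomm (spart c S) (spart d f) (0, y) = 0.
  elim/(@homog_ind R): y => [y y' e e'|b y hy]; first by rewrite snd_D sEndD e e' addr0.
  rewrite (scomm_app _ (homog_spart c S) (homog_spart d f)).
  rewrite (spart_endE d f (homog_snd hy)) fR spart0 sEnd0 sub0r.
  have -> : spart c S ((0, y) : restr M) = (0, (spart c S ((0, y) : restr M)).2).
    rewrite [LHS]surjective_pairing; congr (_, _).
    by rewrite (spart_endE c S (homog_snd hy)) -[LHS]/(spart (c (+) b) (S (0, y)).1) SR spart0.
  set z := (_).2; suff -> : spart d f ((0, z) : restr M) = 0 by rewrite sgn0 oppr0.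
  elim/(@homog_ind R): z => [z z' e e'|b' z hz]; first by rewrite snd_D sEndD e e' addr0.
  by rewrite (spart_endE d f (homog_snd hz)) fR spart0.
by rewrite !add_sEndE !H !addr0.
Qed.

Lemma S0_SE_eosp : mid_set E = eosp Q -> S0 `<=` SE E.
Proof.
move=> hE _ [f hf [_ [D hD <-] <-]]; apply: SE_D.
  by apply: (osp_SE hE); exact: (EndR_osp).
apply: ext_norm_SE => // x; rewrite hE; apply: eosp_norm.
exact: (ext_leibq' hD).
Qed.

Lemma S0_SE_closure : mid_set E = sum_closure (eosp Q) -> S0 `<=` SE E.
Proof.
move=> hE.
have norm S : normA S -> leibq Q S -> (forall y : R, (S (0, y)).1 = 0) ->
    forall x, mid_set E x -> mid_set E (endbr S x).
  move=> SA Sq SR x Ex; rewrite hE; apply: (osp_N_closure); split.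
    by apply: (osp_norm faith SA Sq); exact: mid_osp Ex.
  apply: scomm_kills => // y; apply: (closure_kills).
  by rewrite -hE.
move=> _ [f hf [_ [D hD <-] <-]]; apply: SE_D.
  have of_ := EndR_osp hf; apply: osp_norm_SE => //; apply: norm.
  - exact: osp_normA of_.
  - exact: (osp_leibq faith of_).
  - by move=> y; have /EndR_P[_ _ fR] := hf; exact: fR.
apply: ext_norm_SE => //; apply: norm.
- exact: (DerM_normA hD).
- exact: (ext_leibq' hD).
- exact: (ext_pres D).2.
Qed.

Lemma DerM_SE_osp : mid_set E = osp Q -> DerM' `<=` SE E.
Proof.
move=> hE _ [D hD <-]; apply: ext_norm_SE => // x; rewrite hE; apply: (osp_norm faith).
  exact: (DerM_normA hD).
exact: (ext_leibq' hD).
Qed.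

Lemma semidirect_osp : mid_set E = osp Q ->
  semidirect (@endbr _ (restr M)) (SE E) (mid_set E) DerM'.
Proof.
move=> hE; have DS := DerM_SE_osp hE; split.
- apply/seteqP; split=> [S hS|_ [x Ex [S hS <-]]]; last first.
    by apply: SE_D; [exact: mid_SE|exact: DS].
  have [x [D [hx hD ->]]] := SE_split hS; rewrite hE; exists x => //.
  by exists (ext' D) => //; exists D.
- by rewrite hE; exact: direct_osp_DerM.
- exact: mid_ideal.
- exact: DerM_subalgebra.
Qed.

(** A locally inner d_{S,0} has [S] trivial on [A] and on [R]: at the elements 1,
    [a] and the copies of [m], it agrees with an inner derivation by an element
    of E. *)
Lemma semidirect_local : mid_set E = eosp Q ->
  semidirect (@endbr _ (Einf E)) (Der (einf_br E)) (locally_inner (einf_br E)) (d0 E S0).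
Proof.
move=> hE; have SS := S0_SE_eosp hE.
have lad u : locally_inner (einf_br E) (ad E u).
  by split; [exact: ad_Der'|move=> s; exists u].
split.
- apply/seteqP; split=> [d|_ [x [hx _] [_ [S hS <-] <-]]]; last first.
    by apply: zspanD => //; rewrite dS_dST; apply: (dS_Der faith); exact: SS.
  rewrite DerE_setsum => -[_ [u _ <-] [_ [S hS <-] <-]].
  have [x [D [hx hD eS]]] := SE_split hS.
  have [x' [f [hx' hf ex]]] := osp_split hx.
  have S0fD : S0 (f + ext' D) by exists f => //; exists (ext' D) => //; exists D.
  exists (ad E u + dS E x').
    have [[_ liD _ _] _ _] := einf_li_ideal E.
    by apply: liD => //; exact: (osp_N_locally_inner hE).
  exists (dS E (f + ext' D)); first by exists (f + ext' D); rewrite ?dS_dST.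
  have S1 : SE E x' by apply: (osp_SE hE); case: hx'.
  by rewrite dS_dST eS ex -!addrA (dSD faith S1 (SS _ S0fD)).
- apply/seteqP; split=> [d [[_ li] [S hS e]]|_ ->]; last first.
    have [[z1 _ _ _] _ _] := einf_li_ideal E.
    have [[z2 _ _ _] _] := subalgebra_d0 faith SS S0_subalgebra.
    by split.
  move: (e); rewrite dS_dST => e'; rewrite -e' in li *.
  have hSE := SS _ hS; case: (hS) => [f hf [_ [D hD <-] eS]].
  have H m b : exists u : Einf E, [/\ scomm S b%:A' = 0 & S m = cE u m].
    have [u hu] := li [:: zeta E; inM E m; inN E m; inA E b].
    have [[um un] _ Sm] : [/\ L0 u, (cA u)%:A' m = 0 & S m = cE u m].
      by apply: (ad_dS_at half faith hSE); apply/esym/hu; rewrite !inE eqxx ?orbT.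
    exists u; split=> //; have [e1 _ _ _] := dSE faith (inA E b) hSE.
    rewrite -[b in LHS]/(cA (inA E b)) -e1 hu; last by rewrite !inE eqxx !orbT.
    by rewrite brA um un !q0l subrr aId0.
  have SA : Alinear S by apply: scomm_Alinear => b; have [u []] := H 0 b.
  have eD : ext' D = 0 by apply: (S0_Alinear hf hD); rewrite eS.
  have Sf : S = f by rewrite -eS eD addr0.
  have S00 : S = 0.
    apply: osp_N_EndR; last by rewrite Sf.
    split; first by rewrite Sf; exact: (EndR_osp).
    move=> y; have [u [_ ->]] := H ((0, y) : restr M) 0.
    by apply: (eosp_kills); rewrite -hE; exact: cE_mid.
  rewrite S00; apply: (addrI (dS E 0)).
  by rewrite -(dSD faith) ?addr0 //; rewrite -S00.
- exact: einf_li_ideal.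
- by apply: (subalgebra_d0 faith SS); exact: S0_subalgebra.
Qed.

End Mid.
End Ext.

(** * Orthogonal sums of diagonalizable forms *)

Section SumForms.
Variables (K : superComRingType) (A : superExtType K) (N1 N2 : superLmodType A).
Variables (I1 I2 : choiceType) (b1 : I1 -> N1) (b2 : I2 -> N2).
Variables (q1 : quadForm N1) (q2 : quadForm N2).

Let q0 (N : superLmodType A) (q : quadForm N) (x : N) : q x 0 = 0.
Proof. by apply: (addrI (q x 0)); rewrite -qfDr !addr0. Qed.
Let q0' (N : superLmodType A) (q : quadForm N) (x : N) : q 0 x = 0.
Proof. by apply: (addrI (q 0 x)); rewrite -qfDl !addr0. Qed.

Lemma partner_of_inl i j : partner_of b1 q1 i j ->
  partner_of (sum_basis b1 b2) (orth_sum q1 q2) (inl i) (inl j).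
Proof.
move=> [iv z]; split=> [|[k|k] kj]; rewrite /= ?q0' ?q0 ?addr0 //.
by apply: z => kj'; apply: kj; rewrite kj'.
Qed.

Lemma partner_of_inr i j : partner_of b2 q2 i j ->
  partner_of (sum_basis b1 b2) (orth_sum q1 q2) (inr i) (inr j).
Proof.
move=> [iv z]; split=> [|[k|k] kj]; rewrite /= ?q0' ?q0 ?add0r //.
by apply: z => kj'; apply: kj; rewrite kj'.
Qed.

Lemma almost_diagonalizable_sum : almost_diagonalizable b1 q1 ->
  almost_diagonalizable b2 q2 ->
  almost_diagonalizable (sum_basis b1 b2) (orth_sum q1 q2).
Proof.
move=> h1 h2 [i|i]; first by have [j hj] := h1 i; exists (inl j); exact: partner_of_inl.
by have [j hj] := h2 i; exists (inr j); exact: partner_of_inr.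
Qed.

End SumForms.

Lemma orth_sum_radical (K : superComRingType) (A : superExtType K)
    (N R : superLmodType A) (I J : choiceType) (n : I -> N) (r : J -> R)
    (qN : quadForm N) (qR : quadForm R) : almost_diagonalizable n qN ->
  (forall x y : R, qR x y = 0) -> forall k l : I + J,
  orth_sum qN qR (sum_basis n r k) (sum_basis n r l) = match k, l with
    | inl i, inl j => if j == partner n qN i then diag_entry n qN i else 0
    | _, _ => 0 end.
Proof.
move=> hqN qR0 k l.
have q0 (x : N) : qN x 0 = 0 by apply: (addrI (qN x 0)); rewrite -qfDr !addr0.
have q0' (x : N) : qN 0 x = 0 by apply: (addrI (qN 0 x)); rewrite -qfDl !addr0.
rewrite /= qR0 addr0; case: k l => [i|i] [j|j] //=.
by case: eqP => [->|/eqP ij] //; have [_ ->] := partnerP hqN i => //; apply/eqP.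
Qed.

Lemma third_index (X : choiceType) (x y : X) : ~~ ([set: X] #<= `I_2)%card ->
  exists z, z != x /\ z != y.
Proof.
move=> hX; apply: contrapT => nz; move/negP: hX; apply.
have -> : [set: X] = (fun k : nat => if k == 0%N then x else y) @` `I_2.
  apply/seteqP; split=> // z _; case: (eqVneq z x) => [->|zx]; first by exists 0%N.
  exists 1%N => //=; case: (eqVneq z y) => [->|zy] //.
  by exfalso; apply: nz; exists z.
exact: card_image_le.
Qed.

Theorem theorem4p9 (K : superComRingType) (half : invertible (2%:R : K))
    (A : superExtType K) (N1 N2 R : superLmodType A) (I J : choiceType)
    (n1 : I -> N1) (n2 : 'I_2 -> N2) (r : J -> R)
    (q1 : quadForm N1) (q2 : quadForm N2) (qR : quadForm R)
    (n1_basis : homog_basis n1) (n2_basis : homog_basis n2)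
    (r_basis : homog_basis r)
    (q1_diag : almost_diagonalizable n1 q1)
    (q2_diag : invertibly_diagonalizable n2 q2)
    (qR0 : forall x y : R, qR x y = 0)
    (rank_gt2 : ~~ ([set: I + 'I_2 + J] #<= `I_2)%card)
    (E : midalg (orth_sum (orth_sum q1 q2) qR)) :
  let M := (N1 * N2 * R)%type : superLmodType A in
  let qN := orth_sum q1 q2 in
  let q := orth_sum qN qR in
  let n := sum_basis n1 n2 in
  let DerA := Der (V := A) *%R in
  let DerA_M := DerM n r qN in
  let DerEinf := Der (einf_br E) in
  let adEinf := range (ad E) in
  let adE := [set ad E (einf_mid x) | x in [set: midtype E]] in
  let End_R := EndAR (N1 * N2)%type R in
  let normE := [set S | forall x, mid_set E x -> mid_set E (endbr S x)] in
  lie_iso (@endbr _ A) (@endbr _ (restr M))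
    DerA DerA_M (ext n r qN) /\
  direct (osp q) DerA_M /\
  DerEinf = setsum adEinf (DE E `&` d0 E (setsum (osp q) DerA_M `&` normE)) /\
  adEinf `&` (DE E `&` d0 E (osp q `&` normE)) = adE /\
  adE = d0 E (mid_set E) /\
  (forall S0 : set (sEnd (restr M)),
     semidirect (@endbr _ (restr M)) (SE E) (mid_set E) S0 ->
     semidirect (@endbr _ (Einf E)) DerEinf adEinf (DE E `&` d0 E S0)) /\
  direct End_R DerA_M /\
  (mid_set E = eosp q ->
     setsum End_R DerA_M `<=` SE E /\
     semidirect (@endbr _ (Einf E)) DerEinf (locally_inner (einf_br E))
       (d0 E (setsum End_R DerA_M)) /\
     (finite_set [set: I + 'I_2 + J] ->
        semidirect (@endbr _ (Einf E)) DerEinf adEinf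
          (d0 E (setsum End_R DerA_M)))) /\
  (mid_set E = sum_closure (eosp q) ->
     setsum End_R DerA_M `<=` SE E /\
     semidirect (@endbr _ (Einf E)) DerEinf adEinf (d0 E (setsum End_R DerA_M))) /\
  (mid_set E = osp q ->
     DerA_M `<=` SE E /\
     semidirect (@endbr _ (Einf E)) DerEinf adEinf (d0 E DerA_M)).
Proof.
move=> M qN q n DerA DerA_M DerEinf adEinf adE End_R normE.
have n_basis : homog_basis n by exact: homog_basis_sum.
have n_diag : almost_diagonalizable n qN.
  by apply: almost_diagonalizable_sum => // i; exists i; exact: q2_diag.
have [dg hB] := homog_basis_hbasis (homog_basis_sum n_basis r_basis).
have hQ := orth_sum_radical r n_diag qR0.
pose o : I + 'I_2 := inr ord0; pose o' : I + 'I_2 := inr ord_max.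
have ho : partner_of n qN o o by apply: partner_of_inr; exact: q2_diag.
have ho' : partner_of n qN o' o' by apply: partner_of_inr; exact: q2_diag.
have oo' : o != o' by [].
have [g [go go']] := third_index (inl o) (inl o') rank_gt2.
have faith (a : A) : (forall m : M, a *: m = 0) -> a = 0.
  exact: (hb_faithful hB (inl o)).
have eSE := SE_char half n_basis r_basis n_diag hB o hQ E.
have ospSE : osp q `&` normE `<=` SE E.
  move=> S [hS nS]; rewrite eSE; split=> //; exists S => //.
  exists 0; last by rewrite addr0.
  by exists 0; [exact: Der0|exact: (ext0 qN n_basis r_basis hB)].
have midN : mid_set E `<=` osp q `&` normE.
  by move=> S ES; split; [exact: mid_osp ES|move=> x Ex; exact: mid_scomm].
have semi := semidirect_DerE half n_diag hB o hQ ho ho' oo' go go' (E := E).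
have kill S : sum_closure (eosp q) S \/ eosp q S -> forall y : R, S (0, y) = 0.
  case=> hS y; first exact: (closure_kills n_basis r_basis n_diag hB hQ).
  exact: (eosp_kills n_basis r_basis n_diag hB hQ).
refine (conj _ (conj _ (conj _ (conj _ (conj _ (conj _ (conj _ (conj _ (conj _ _))))))))).
- exact: (ext_iso half n_basis r_basis n_diag hB o).
- exact: (direct_osp_DerM half n_basis r_basis n_diag hB o).
- rewrite -eSE sub_d0 //.
  exact: (DerE_setsum half n_diag hB o hQ ho ho' oo' go go').
- by rewrite (sub_d0 ospSE) (ad_cap_d0 half faith) // (d0_mid E faith).
- by rewrite (d0_mid E faith).
- move=> S0 hS0; rewrite sub_d0; first exact: semi.
  move=> S hS; have [-> _ _ _] := hS0.
  by exists 0; [exact: mid0|exists S => //; rewrite add0r].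
- apply/seteqP; split=> [S [hS DS]|_ ->].
    have : (osp q `&` DerA_M) S by split=> //; exact: (EndR_osp n_basis r_basis n_diag hB hQ).
    by rewrite (direct_osp_DerM half n_basis r_basis n_diag hB o).
  split; first by have [] := EndR_submodule (N1 * N2)%type R.
  by exists 0; [exact: Der0|exact: (ext0 qN n_basis r_basis hB)].
- move=> hE; have SS := S0_SE_eosp half n_basis r_basis n_diag hB o hQ hE.
  split=> //; split.
    exact: (semidirect_local half n_basis r_basis n_diag hB o hQ ho ho' oo' go go' hE).
  move=> fin; apply: semi; apply: (semidirect_killing half n_basis r_basis n_diag hB o hQ) => //.
    have fI : finite_set [set: I + 'I_2].
      have -> : [set: I + 'I_2] =
          (fun k : I + 'I_2 + J => if k is inl i then i else o) @` [set: I + 'I_2 + J].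
        by apply/seteqP; split=> // i _; exists (inl i).
      exact: finite_image.
    by move=> S hS; rewrite hE; exact: (osp_N_eosp half n_basis r_basis n_diag hB hQ fI hS).
  by rewrite hE => S hS; apply: kill; right.
- move=> hE; have SS := S0_SE_closure half n_basis r_basis n_diag hB o hQ hE.
  split=> //; apply: semi.
  apply: (semidirect_killing half n_basis r_basis n_diag hB o hQ) => //.
    by rewrite hE => S hS; exact: (osp_N_closure half n_basis r_basis n_diag hB hQ hS).
  by rewrite hE => S hS; apply: kill; left.
- move=> hE; split; first exact: (DerM_SE_osp half n_basis r_basis n_diag hB o hQ hE).
  by apply: semi; exact: (semidirect_osp half n_basis r_basis n_diag hB o hQ hE).
Qed.
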